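(* Let $X$ be a computable Polish space, $\nu$ a computable Borel probability measure on $X$, and $(\mathscr F_n)$ an almost-full effective filtration equipped uniformly with Schnorr disintegrations $\rho^{(n)}$. Then for $x\in X$ the following are equivalent: (1) $x\in\mathsf{SR}^\nu$; (2) $x\in\mathsf{KR}^\nu$ and $\lim_nM_n(x)$ exists for every martingale $(M_n)$ of $L_2(\nu)$ Schnorr tests adapted to $\mathscr F_n$ and $\rho^{(n)}$ such that both $\sup_n\|M_n\|_2$ is a computable real and the maximal function $\sup_nM_n$ is an $L_2(\nu)$ Schnorr test.
   Context: A computable Polish space is a Polish space $X$ with a distinguished dense sequence $x_0,x_1,\dots$ and a compatible complete metric $d$ with $d(x_i,x_j)$ uniformly computable. An open set is c.e. open if it equals $\bigcup_i B(x_{n(i)},r_i)$ for computable $n(\cdot)$ and a computable sequence of positive rationals $r_i$. $f:X\to(-\infty,\infty]$ is lower semi-computable (lsc) if the sets $f^{-1}(q,\infty]$, $q\in\mathbb Q$, are uniformly c.e. open. $\nu$ computable means $\nu(U)$ is left-c.e. uniformly in c.e. open $U$. For computable $p\ge1$, an $L_p(\nu)$ Schnorr test is an lsc $f:X\to[0,\infty]$ with $\|f\|_p$ computable. $\mathsf{KR}^\nu$ is the set of points in every c.e. open set of $\nu$-measure 1; $\mathsf{SR}^\nu$ the set of $x$ with $f(x)<\infty$ for every $L_1(\nu)$ Schnorr test. A $\nu$-computable basis is a computable sequence of c.e. open sets such that every c.e. open set is effectively a union of its members, finite unions of members have uniformly computable $\nu$-measure, and each member is uniformly paired with an effectively closed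 superset of equal $\nu$-measure. An almost-full effective filtration is an increasing sequence $(\mathscr F_n)$ of $\sigma$-algebras, $\mathscr F_n$ generated by a sequence $\{A_{n,m}\}_m$, uniformly computable in $n,m$, of members of the algebra generated by a $\nu$-computable basis, with a uniform procedure computing from a c.e. open $U$ a sequence $A_{n_i,m_i}$ with $U\cap\mathsf{KR}^\nu=\bigcup_iA_{n_i,m_i}\cap\mathsf{KR}^\nu$. For countably generated $\mathscr F$, $[x]_{\mathscr F}$ is the set of points in exactly the same members of $\mathscr F$ as $x$. For a $\nu$-measure one $\mathsf{XR}^\nu\subseteq\mathsf{KR}^\nu$, a Borel measurable $\rho:X\to\mathcal M^+(X)$ is an $\mathsf{XR}^\nu$ disintegration of $\mathscr F$ w.r.t. $\nu$ if: (a) for every Borel $f$ with $\int|f|d\nu<\infty$, $x\mapsto\int f\,d\rho_x$ is a version of the conditional expectation of $f$ given $\mathscr F$; (b) for $x\in\mathsf{XR}^\nu$, $\rho_x(X)=1$ and $\rho_x([x]_{\mathscr F}\cap\mathsf{XR}^\nu)=1$; (c) $x\mapsto\rho_x(U)$ is lsc uniformly in c.e. open $U$. A Schnorr disintegration is both a $\mathsf{KR}^\nu$ and an $\mathsf{SR}^\nu$ disintegration. Equipped uniformly: each $\rho^{(n)}$ is such for $\mathscr F_n$, uniformly; $\mathbb E_\nu[f\mid\mathscr F_n](x)=\int f\,d\rho^{(n)}_x$. A martingale of $L_p(\nu)$ Schnorr tests adapted to $\mathscr F_n$ and $\rho^{(n)}$ is a uniformly computable sequence $(M_n)$ of $\mathscr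 F_n$-measurable $L_p(\nu)$ Schnorr tests with $M_n=\mathbb E_\nu[M_{n+1}\mid\mathscr F_n]$ on $\mathsf{SR}^\nu$. ''The limit exists'' means it exists and is finite. *)

(* Defs.v *)
From HB Require Import structures.
From mathcomp Require Import all_boot all_order all_algebra.
From mathcomp Require Import all_classical all_reals all_analysis.
From mathcomp Require Import measurable_realfun.

Set Implicit Arguments.
Unset Strict Implicit.
Unset Printing Implicit Defensive.

Import Order.TTheory GRing.Theory Num.Theory.
Import numFieldNormedType.Exports.

Local Open Scope classical_set_scope.

(** * Computability on natural numbers *)

(* Cantor's bijection between nat * nat and nat. *)
Definition npair (x y : nat) : nat := ((x + y) * (x + y).+1)./2 + y.

Fixpoint unpair (n : nat) : nat * nat :=
  if n is m.+1 then
    let (x, y) := unpair m in if x is x'.+1 then (x', y.+1) else (y.+1, 0)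
  else (0, 0).

Lemma npair0r n : npair n.+1 0 = (npair 0 n).+1.
Proof.
rewrite /npair !addn0 !add0n.
have -> : n.+1 * n.+2 = n * n.+1 + n.+1.*2.
  by rewrite (mulnC n) -muln2 -mulnDr addn2.
by rewrite halfD odd_double andbF add0n doubleK addnS.
Qed.

Lemma npairSr m n : npair m n.+1 = (npair m.+1 n).+1.
Proof. by rewrite /npair addnS addSn addnS. Qed.

Lemma unpairK n : npair (unpair n).1 (unpair n).2 = n.
Proof.
elim: n => //= n; case: (unpair n) => -[|x] y /= <-; first exact: npair0r.
exact: npairSr.
Qed.

Lemma npairK x y : unpair (npair x y) = (x, y).
Proof.
elim: {x y}(npair x y) {-2}x {-2}y (erefl (npair x y)) => [|n IH] x [|y].
- by case: x => // x; rewrite npair0r.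
- by rewrite npairSr.
- by case: x => // x; rewrite npair0r => -[/IH /= ->].
- by rewrite npairSr => -[/IH /= ->].
Qed.

(* Programs for the unary partial recursive functions, tuples being encoded
   by [npair]. *)
Inductive code : Type :=
  | Zero | Succ | Fst | Snd
  | Pair of code & code
  | Comp of code & code
  | Prec of code & code
  | Mu of code.

(* [runs c a b]: the program [c] halts on input [a] with output [b].
   In [Prec c d] on input <x, n>, [h] is the history of the recursion
   h 0 = c x and h (i + 1) = d <x, <i, h i>>. *)
Fixpoint runs (c : code) (a b : nat) : Prop :=
  match c with
  | Zero => b = 0
  | Succ => b = a.+1
  | Fst => b = (unpair a).1
  | Snd => b = (unpair a).2
  | Pair c d => exists u v, [/\ runs c a u, runs d a v & b = npair u v]
  | Comp c d => exists2 u, runs d a u & runs c u b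
  | Prec c d => let (x, n) := unpair a in exists h : nat -> nat,
      [/\ runs c x (h 0),
          forall i, i < n -> runs d (npair x (npair i (h i))) (h i.+1) &
          b = h n]
  | Mu c => runs c (npair a b) 0 /\
      forall m, m < b -> exists v, runs c (npair a m) v.+1
  end.

(* Gödel numbering of programs (a bijection onto nat). *)
Fixpoint godel (c : code) : nat :=
  match c with
  | Zero => 0
  | Succ => 1
  | Fst => 2
  | Snd => 3
  | Pair c d => 4 * npair (godel c) (godel d) + 4
  | Comp c d => 4 * npair (godel c) (godel d) + 5
  | Prec c d => 4 * npair (godel c) (godel d) + 6
  | Mu c => 4 * godel c + 7
  end.

Definition computable (f : nat -> nat) : Prop :=
  exists c, forall n, runs c n (f n).

Definition computable2 (f : nat -> nat -> nat) : Prop :=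
  computable (fun n => f (unpair n).1 (unpair n).2).

(* The e-th computably enumerable set. *)
Definition W (e : nat) : set nat :=
  [set n | exists2 c, godel c = e & exists m, runs c n m].

Definition ce (A : set nat) : Prop := exists e, A = W e.

(* The finite set with canonical index F = \sum_(i in A) 2 ^ i. *)
Definition fin_index (F : nat) : set nat := [set i | odd (F %/ 2 ^ i)].

Local Open Scope ring_scope.

(** * Computable reals *)

Section reals.
Variable R : realType.

(* Surjections from nat onto the rationals and the positive rationals. *)
Definition qnum (k : nat) : R :=
  let: (m, b) := unpair k in
  ((unpair m).1%:R - (unpair m).2%:R) / b.+1%:R.

Definition posqnum (k : nat) : R :=
  (unpair k).1.+1%:R / (unpair k).2.+1%:R.

(* Uniform computability of a sequence of reals, presented as extended reals;
   the bound forces every u n to be finite. *)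
Definition computable_reals (u : nat -> \bar R) : Prop :=
  exists2 a : nat -> nat -> nat, computable2 a &
    forall n k, (`|u n - (qnum (a n k))%:E| <= (2 ^- k)%:E)%E.

Definition computable_real (r : \bar R) : Prop := computable_reals (fun=> r).

(* Uniformly left-c.e. sequences: the left cuts are uniformly c.e. *)
Definition left_ce (u : nat -> \bar R) : Prop :=
  ce [set n | ((qnum (unpair n).2)%:E < u (unpair n).1)%E].

End reals.

(** * Computable Polish spaces *)

#[short(type="completeMetricType")]
HB.structure Definition CompleteMetric (R : numDomainType) :=
  {T of Complete T & Metric R T}.

Notation Borel X := (g_sigma_algebraType (@open X)).

Section computable_polish.
Variables (R : realType) (X : completeMetricType R) (s : nat -> X).

Definition computable_polish : Prop :=
  dense (range s) /\
  computable_reals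
    (fun n => (mdist (s (unpair n).1) (s (unpair n).2))%:E : \bar R).

(* The c.e. open set with index e. W e may be empty or finite, so that the empty
   set is c.e. open. "Uniformly in c.e. open U" means uniformly in e. *)
Definition ceopen (e : nat) : set X :=
  \bigcup_(k in W e) ball (s (unpair k).1) (posqnum R (unpair k).2).

(* Uniform lower semi-computability of a sequence of functions with values in
   (-oo, +oo]. *)
Definition lsc_seq (f : nat -> X -> \bar R) : Prop :=
  (forall n x, f n x != -oo%E) /\
  exists2 h : nat -> nat -> nat, computable2 h &
    forall n k, [set x | ((qnum R k)%:E < f n x)%E] = ceopen (h n k).

Variable nu : probability (Borel X) R.

Definition computable_measure : Prop := left_ce (fun e => nu (ceopen e)).

(** * Schnorr tests, Kurtz and Schnorr randomness *)

(* A uniformly computable sequence of L_p(nu) Schnorr tests. *)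
Definition schnorr_tests (p : R) (f : nat -> X -> \bar R) : Prop :=
  [/\ lsc_seq f,
      forall n x, (0 <= f n x)%E &
      computable_reals (fun n => ('N[nu]_(p%:E)[f n])%E)].

Definition schnorr_test (p : R) (f : X -> \bar R) : Prop :=
  schnorr_tests p (fun=> f).

Definition KR : set X :=
  [set x | forall e, nu (ceopen e) = 1%E -> ceopen e x].

Definition SR : set X :=
  [set x | forall f, schnorr_test 1 f -> (f x < +oo)%E].

(** * Effective filtrations *)

(* The computable sequence b of indices describes the basis (ceopen (b i))_i. *)
Definition computable_basis (b : nat -> nat) : Prop :=
  [/\ computable b,
      exists2 h, computable h &
        forall e, ceopen e = \bigcup_(i in W (h e)) ceopen (b i),
      computable_reals
        (fun F => nu (\bigcup_(i in fin_index F) ceopen (b i))) &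
      exists2 c, computable c &
        forall i, ceopen (b i) `<=` ~` ceopen (c i) /\
                  nu (~` ceopen (c i)) = nu (ceopen (b i))].

(* Members of the algebra generated by a sequence of sets are given
   by Boolean expressions, and these by their Gödel numbers. *)
Inductive bexpr : Type :=
  | Gen of nat | Compl of bexpr | Union of bexpr & bexpr.

Fixpoint bexpr_num (t : bexpr) : nat :=
  match t with
  | Gen i => (3 * i)%N
  | Compl t => (3 * bexpr_num t + 1)%N
  | Union t u => (3 * npair (bexpr_num t) (bexpr_num u) + 2)%N
  end.

Fixpoint bexpr_set (B : nat -> set X) (t : bexpr) : set X :=
  match t with
  | Gen i => B i
  | Compl t => ~` bexpr_set B t
  | Union t u => bexpr_set B t `|` bexpr_set B u
  end.

Definition almost_full_filtration (F : nat -> set (set X)) : Prop :=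
  (forall n, F n `<=` F n.+1) /\
  exists (b : nat -> nat) (a : nat -> nat -> nat) (A : nat -> nat -> set X),
    [/\ computable_basis b,
        computable2 a /\
        forall n m, exists2 t, bexpr_num t = a n m &
          A n m = bexpr_set (fun i => ceopen (b i)) t,
        forall n, F n = <<s range (A n) >> &
        exists2 h, computable h &
          forall e, ceopen e `&` KR =
            (\bigcup_(k in W (h e)) A (unpair k).1 (unpair k).2) `&` KR].

(** * Disintegrations *)

(* The atom [x]_G. *)
Definition atom (G : set (set X)) (x : X) : set X :=
  [set y | forall A, G A -> (A y <-> A x)].

(* Used for sigma-algebras G only, for which <<s G>> = G. *)
Definition measurable_wrt (G : set (set X)) (g : X -> \bar R) : Prop :=
  measurable_fun setT (g : g_sigma_algebraType G -> \bar R).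

(* For nu-integrable f and a sub-sigma-algebra G of the Borel sets. *)
Definition cond_expectation (G : set (set X)) (f g : Borel X -> \bar R) :
    Prop :=
  [/\ measurable_wrt G g,
      nu.-integrable setT g &
      forall A, G A ->
        (\int[nu]_(x in A) g x = \int[nu]_(x in A) f x)%E].

(* For each n, rho n is an XR disintegration of F n, uniformly in n. The Borel
   measurable maps from X to the finite Borel measures are the finite
   transition kernels. *)
Definition disintegrations (XR : set X) (F : nat -> set (set X))
    (rho : nat -> R.-ftker Borel X ~> Borel X) : Prop :=
  [/\ forall n (f : Borel X -> \bar R), nu.-integrable setT f ->
        cond_expectation (F n) f (fun x => (\int[rho n x]_y f y)%E),
      forall n x, XR x ->
        rho n x setT = 1%E /\ rho n x (atom (F n) x `&` XR) = 1%E &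
      lsc_seq (fun j x => rho (unpair j).1 x (ceopen (unpair j).2))].

Definition schnorr_disintegrations (F : nat -> set (set X))
    (rho : nat -> R.-ftker Borel X ~> Borel X) : Prop :=
  disintegrations KR F rho /\ disintegrations SR F rho.

Definition schnorr_martingale (p : R) (F : nat -> set (set X))
    (rho : nat -> R.-ftker Borel X ~> Borel X) (M : nat -> X -> \bar R) :
    Prop :=
  [/\ schnorr_tests p M,
      forall n, measurable_wrt (F n) (M n) &
      forall n x, SR x -> M n x = (\int[rho n x]_y M n.+1 y)%E].

End computable_polish.

(* Main.v *)
(* Randomness implies convergence. Schnorr random points are Kurtz random. Let
   M be a martingale as in (2), and approximate M n from below by computable
   functions gam n whose squared norms are within 4^-n of that of M n. As
   the supremum of the norms is computable, one finds nk such that the squared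
   norm of M grows by at most 16^-k after nk k. By Doob's maximal inequality the
   functions 2^n (M n^2 - (gam n)^2) and 4^k max (gam m - gam (nk k))^2, the
   maximum being over nk k <= m <= nk (k+1), have summable and computable
   integrals, so that they are bounded at every Schnorr random x, and M n x
   converges.

   Convergence implies randomness. Let f be an L1 Schnorr test, infinite at the
   Kurtz random point x. The martingale M n = E[sqrt f | F n] satisfies (2):
   its norms increase to that of sqrt f, by Fatou's lemma, and the norm of
   its maximal function is computable, by Doob's inequality applied to
   sqrt f - G for computable minorants G of sqrt f, and to the increments of M.
   Since {sqrt f > q} is a union of members of the filtration on Kurtz random
   points, M n x tends to infinity.

   Computability of an integral is used as the conjunction of being left-c.e.,
   for lower semicomputable integrands, and right-c.e., as an infimum of
   computable upper bounds. *)
Require Import Defs.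
From HB Require Import structures.
From mathcomp Require Import all_boot all_order all_algebra.
From mathcomp Require Import all_classical all_reals all_analysis.
From mathcomp Require Import measurable_realfun.
From mathcomp Require Import zify ring lra.

Set Implicit Arguments.
Unset Strict Implicit.
Unset Printing Implicit Defensive.

Import Order.TTheory GRing.Theory Num.Theory.
Import numFieldNormedType.Exports.

Local Open Scope classical_set_scope.

(** * Computable functions *)

#[local] Opaque npair unpair.

(** Lower semicomputability gives lower bounds on integrals for free, so the work lies in the upper
    bounds. They come from bounded computable minorants [G j <= j]: the integral of [G j], or its
    conditional expectation at a Kurtz random point, is [j] minus that of [j - G j], and what is
    lost is controlled by the squared norm of the defect. The square root moves an L1 test to L2,
    where Doob's inequality bounds a maximal function by the norm of a single term; the norm of the
    maximal function can then be approximated by finite maxima of conditional expectations of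
    minorants. Differences of lower semicomputable functions need not be lower semicomputable. This
    is why, for convergence, increments are taken of the computable [gam] and not of [M], with the
    defects M n^2 - (gam n)^2 as a separate test. The weight 4^k on increments with integral of
    order 16^-k leaves the summable 4^-k. Martingale identities are first obtained almost
    everywhere. They pass to all Schnorr random points because two lower semicomputable functions
    that agree almost everywhere and have the same computable integral agree there. *)

Lemma computable_ext f g : f =1 g -> computable f -> computable g.
Proof. by move=> fg [c hc]; exists c => n; rewrite -fg. Qed.

Lemma computable_id : computable (fun n => n).
Proof.
exists (Pair Fst Snd) => n /=.
by exists (unpair n).1, (unpair n).2; rewrite unpairK.
Qed.

Lemma computable_comp f g :
  computable f -> computable g -> computable (fun n => f (g n)).
Proof. by move=> [c hc] [d hd]; exists (Comp c d) => n /=; exists (g n). Qed.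

Lemma computable_npair f g :
  computable f -> computable g -> computable (fun n => npair (f n) (g n)).
Proof.
by move=> [c hc] [d hd]; exists (Pair c d) => n /=; exists (f n), (g n).
Qed.

Lemma computable_fst f : computable f -> computable (fun n => (unpair (f n)).1).
Proof. by apply: (@computable_comp (fun n => (unpair n).1)); exists Fst. Qed.

Lemma computable_snd f : computable f -> computable (fun n => (unpair (f n)).2).
Proof. by apply: (@computable_comp (fun n => (unpair n).2)); exists Snd. Qed.

Lemma computable_S f : computable f -> computable (fun n => (f n).+1).
Proof. by apply: (@computable_comp succn); exists Succ. Qed.

Lemma computable_const k : computable (fun=> k).
Proof. by elim: k => [|k /computable_S//]; exists Zero. Qed.

Lemma computable2_comp h f g : computable2 h -> computable f -> computable g ->
  computable (fun n => h (f n) (g n)).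
Proof.
move=> hh hf hg.
have := computable_comp hh (computable_npair hf hg).
by apply: computable_ext => n; rewrite npairK.
Qed.

(* The context n stays available in the step function d. *)
Lemma computable_rec (c g : nat -> nat) (d : nat -> nat -> nat -> nat) :
  computable c -> computable g ->
  computable (fun m => d (unpair m).1 (unpair (unpair m).2).1
                         (unpair (unpair m).2).2) ->
  computable (fun n => nat_rect (fun=> nat) (c n) (d n) (g n)).
Proof.
move=> [kc hc] hg [kd hd].
have [k hk] := computable_npair computable_id hg.
exists (Comp (Prec kc kd) k) => n /=; exists (npair n (g n)); first exact: hk.
rewrite npairK; exists (fun i => nat_rect (fun=> nat) (c n) (d n) i).
split=> // i _ /=.
by have := hd (npair n (npair i (nat_rect (fun=> nat) (c n) (d n) i)));
  rewrite !npairK.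
Qed.

Lemma computable_iter (c g : nat -> nat) (d : nat -> nat -> nat) :
  computable c -> computable g -> computable2 d ->
  computable (fun n => iter (g n) (d n) (c n)).
Proof.
move=> hc hg hd.
have := @computable_rec c g (fun n _ r => d n r) hc hg.
move=> /(_ _)/computable_ext; apply; first by move=> n; elim: (g n) => //= m ->.
have e1 := @computable_fst _ computable_id.
have e2 := computable_snd (@computable_snd _ computable_id).
exact: (@computable2_comp d _ _ hd e1 e2).
Qed.

(** Bootstraps the closure lemmas for arithmetic: it knows only constants, pairing, projections and
    successor, and leaves the other goals open. *)
Ltac computable_base :=
  lazymatch goal with
  | |- computable2 _ => rewrite /computable2; computable_base
  | |- computable (fun n => n) => exact: computable_id
  | |- computable (fun=> ?k) => exact: (computable_const k)
  | |- computable (fun n => npair _ _) =>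
      apply: computable_npair; computable_base
  | |- computable (fun n => (unpair _).1) =>
      apply: computable_fst; computable_base
  | |- computable (fun n => (unpair _).2) =>
      apply: computable_snd; computable_base
  | |- computable (fun n => _.+1) => apply: computable_S; computable_base
  | |- _ => idtac
  end.

Lemma computable_add f g :
  computable f -> computable g -> computable (fun n => f n + g n).
Proof.
move=> hf hg; have := @computable_rec f g (fun _ _ r => r.+1) hf hg.
move=> /(_ _)/computable_ext; apply; last by computable_base.
by move=> n; elim: (g n) => [|m /= ->]; rewrite ?addn0 ?addnS.
Qed.

Lemma computable_mul f g :
  computable f -> computable g -> computable (fun n => f n * g n).
Proof.
move=> hf hg.
have := @computable_rec (fun=> 0) g (fun n _ r => r + f n)
  (computable_const 0) hg.
move=> /(_ _)/computable_ext; apply; first by move=> n; elim: (g n) => [|m /= ->]; rewrite ?muln0 ?mulnSr.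
apply: computable_add; computable_base.
by apply: (computable_comp hf); computable_base.
Qed.

Lemma computable_pred f : computable f -> computable (fun n => (f n).-1).
Proof.
move=> hf; have := @computable_rec (fun=> 0) f (fun _ m _ => m)
  (computable_const 0) hf.
move=> /(_ _)/computable_ext; apply; last by computable_base.
by move=> n; case: (f n).
Qed.

Lemma computable_sub f g :
  computable f -> computable g -> computable (fun n => f n - g n).
Proof.
move=> hf hg; have := @computable_rec f g (fun _ _ r => r.-1) hf hg.
move=> /(_ _)/computable_ext; apply; last by apply: computable_pred; computable_base.
by move=> n; elim: (g n) => [|m /= ->]; rewrite ?subn0 ?subnS.
Qed.

Lemma computable_exp f g :
  computable f -> computable g -> computable (fun n => f n ^ g n).
Proof.
move=> hf hg.
have := @computable_rec (fun=> 1) g (fun n _ r => r * f n)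
  (computable_const 1) hg.
move=> /(_ _)/computable_ext; apply; first by move=> n; elim: (g n) => [|m /= ->]; rewrite ?expn0 ?expnSr.
apply: computable_mul; computable_base.
by apply: (computable_comp hf); computable_base.
Qed.

Lemma computable_eq0 f :
  computable f -> computable (fun n => nat_of_bool (f n == 0)).
Proof.
move=> hf; have := computable_sub (computable_const 1) hf.
by apply: computable_ext => n; case: (f n) => // m; rewrite subn1.
Qed.

Lemma computable_leq f g :
  computable f -> computable g -> computable (fun n => nat_of_bool (f n <= g n)).
Proof. by move=> hf hg; apply: computable_eq0; exact: computable_sub. Qed.

Lemma computable_neg (b : nat -> bool) :
  computable b -> computable (fun n => ~~ b n).
Proof. by move=> /computable_eq0; apply: computable_ext => n; case: (b n). Qed.

Lemma computable_and (a b : nat -> bool) :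
  computable a -> computable b -> computable (fun n => a n && b n).
Proof.
move=> ha hb; have := computable_mul ha hb.
by apply: computable_ext => n; rewrite mulnb.
Qed.

Lemma computable_eqn f g :
  computable f -> computable g -> computable (fun n => nat_of_bool (f n == g n)).
Proof.
move=> hf hg; have := computable_and (computable_leq hf hg) (computable_leq hg hf).
by apply: computable_ext => n; rewrite -eqn_leq.
Qed.

Lemma computable_if (b : nat -> bool) f g :
  computable b -> computable f -> computable g ->
  computable (fun n => if b n then f n else g n).
Proof.
move=> hb hf hg.
have := computable_add (computable_mul hb hf) (computable_mul (computable_neg hb) hg).
by apply: computable_ext => n; case: (b n); rewrite /= ?mul1n ?mul0n ?addn0.
Qed.

Lemma computable_sum (f : nat -> nat -> nat) g :
  computable2 f -> computable g ->
  computable (fun n => \sum_(i < g n) f n i).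
Proof.
move=> hf hg.
have := @computable_rec (fun=> 0) g (fun n i r => r + f n i)
  (computable_const 0) hg.
move=> /(_ _)/computable_ext; apply; first by move=> n; elim: (g n) => [|m /= ->]; rewrite ?big_ord0 ?big_ord_recr.
apply: computable_add; computable_base.
have e1 := @computable_fst _ computable_id.
have e2 := computable_fst (@computable_snd _ computable_id).
exact: (@computable2_comp f _ _ hf e1 e2).
Qed.

(** A quotient counts multiples, which reduces division to bounded sums. *)
Lemma divn_sum m d : 0 < d -> m %/ d = \sum_(i < m) (i.+1 * d <= m).
Proof.
move=> d0; rewrite (eq_bigr (fun i : 'I_m => nat_of_bool (i < m %/ d))); last first.
  by move=> i _; rewrite leq_divRL.
have : m %/ d <= m by exact: leq_div.
move: (m %/ d) => k; elim: m => [|m IH]; first by rewrite leqn0 => /eqP->; rewrite big_ord0.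
rewrite big_ord_recr leq_eqVlt => /orP[/eqP->|] /=.
  rewrite ltnSn (eq_bigr (fun=> 1)) ?sum_nat_const ?card_ord ?muln1 ?addn1//.
  by move=> i _; rewrite ltnS ltnW.
rewrite ltnS => km; have := IH km.
by rewrite ltnNge km addn0.
Qed.

Lemma computable_divn f d : 0 < d ->
  computable f -> computable (fun n => f n %/ d).
Proof.
move=> d0 hf; have := @computable_sum (fun n i => i.+1 * d <= f n) f _ hf.
move=> /(_ _)/computable_ext; apply; first by move=> n; rewrite divn_sum.
apply: computable_leq; last by apply: (computable_comp hf); computable_base.
by apply: computable_mul; computable_base.
Qed.

Lemma computable_modn f d : 0 < d ->
  computable f -> computable (fun n => f n %% d).
Proof.
move=> d0 hf; have := computable_sub hf (computable_mul (computable_divn d0 hf)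
  (computable_const d)).
by apply: computable_ext => n; rewrite [in X in X - _](divn_eq (f n) d) addKn.
Qed.

(** Follows the syntax of the body. The last cases read an application as a composition and look for
    the computability of its head in the context or in the hint database [computable]. *)
Ltac computable :=
  lazymatch goal with
  | |- computable2 _ => rewrite /computable2; computable
  | |- computable (fun n => n) => exact: computable_id
  | |- computable (fun=> ?k) => exact: (computable_const k)
  | |- computable (fun n => npair _ _) => apply: computable_npair; computable
  | |- computable (fun n => (unpair _).1) => apply: computable_fst; computable
  | |- computable (fun n => (unpair _).2) => apply: computable_snd; computable
  | |- computable (fun n => _.+1) => apply: computable_S; computable
  | |- computable (fun n => _.-1) => apply: computable_pred; computable
  | |- computable (fun n => _ + _) => apply: computable_add; computable
  | |- computable (fun n => _ * _) => apply: computable_mul; computable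
  | |- computable (fun n => _ - _) => apply: computable_sub; computable
  | |- computable (fun n => expn _ _) => apply: computable_exp; computable
  | |- computable (fun n => _ %/ _) => apply: computable_divn; [by []|computable]
  | |- computable (fun n => _ %% _) => apply: computable_modn; [by []|computable]
  | |- computable (fun n => nat_of_bool (~~ _)) =>
      apply: computable_neg; computable
  | |- computable (fun n => nat_of_bool (_ && _)) =>
      apply: computable_and; computable
  | |- computable (fun n => nat_of_bool (_ <= _)) =>
      apply: computable_leq; computable
  | |- computable (fun n => nat_of_bool (_ == _)) =>
      apply: computable_eqn; computable
  | |- computable (fun n => if _ then _ else _) =>
      apply: computable_if; computable
  | |- computable (fun n => nat_of_bool (?p (@?g n))) =>
      first [ assumption
            | refine (@computable_comp (fun k => nat_of_bool (p k)) g _ _);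
                [solve [assumption | eauto 2 with computable]|computable] ]
  | |- computable (fun n => ?h (@?f n) (@?g n)) =>
      first [ assumption | solve [eauto 2 with computable]
            | refine (@computable2_comp h f g _ _ _);
                [solve [assumption | eauto 2 with computable]
                |computable|computable] ]
  | |- computable (fun n => ?h (@?g n)) =>
      first [ assumption | solve [eauto 2 with computable]
            | refine (@computable_comp h g _ _);
                [solve [assumption | eauto 2 with computable]|computable] ]
  | |- computable (?h ?a) =>
      first [ assumption | change (computable (fun n => h a n)); computable ]
  | |- _ => first [assumption | solve [eauto 2 with computable] | idtac]
  end.
Create HintDb computable.

Lemma unlock_npair x y : npair x y = ((x + y) * (x + y).+1)./2 + y.
Proof. by []. Qed.

Lemma leq_npair1 x y : x <= npair x y.
Proof.
rewrite unlock_npair; apply: leq_trans (leq_addr _ _); apply: (leq_trans (leq_addr y x)).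
by case: (x + y) => // k; rewrite geq_half_double -muln2 leq_mul2l.
Qed.

Lemma leq_npair2 x y : y <= npair x y.
Proof. by rewrite unlock_npair leq_addl. Qed.

Lemma leq_unpair1 n : (unpair n).1 <= n.
Proof. by rewrite -[X in _ <= X]unpairK leq_npair1. Qed.

Lemma leq_unpair2 n : (unpair n).2 <= n.
Proof. by rewrite -[X in _ <= X]unpairK leq_npair2. Qed.

(* The i-th term of the sequence with code l. *)
Definition elt (l i : nat) : nat := (unpair (iter i (fun m => (unpair m).2) l)).1.

Lemma computable_elt : computable2 elt.
Proof.
apply: computable_fst.
by apply: (computable_iter (d := fun=> fun m => (unpair m).2)); computable.
Qed.
#[export] Hint Resolve computable_elt : computable.

(** Prefixes of arbitrary functions, computable or not, have codes. This turns a choice of finitely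
    many witnesses into the choice of one number. *)
Lemma eltP (u : nat -> nat) k : exists l, forall i, i < k -> elt l i = u i.
Proof.
elim: k u => [|k IH] u; first by exists 0.
have [l hl] := IH (fun i => u i.+1).
exists (npair (u 0) l) => -[|i] ik; first by rewrite /elt /= npairK.
by rewrite -hl// /elt iterSr npairK.
Qed.

(** * A universal machine *)

(* A state either evaluates the program e on a, or returns the value v, to the
   stack K, where 0 is the empty stack. *)
Definition ev (e a K : nat) := npair 0 (npair e (npair a K)).
Definition rt (v K : nat) := npair 1 (npair v K).
(** The successor keeps a nonempty stack distinct from [0]. The tags are: 0, the second component of
    a pair is still to be evaluated; 1, the value of the first component; 2, the outer program of a
    composition; 3, a recursion in progress; 4, a search in progress. *)
Definition push (tag data K : nat) := (npair (npair tag data) K).+1.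

(** Here [q] and [r] undo [godel]: numbers below 4 are the basic programs, and any other is
    [4 * q + r + 4], with [r] telling the constructor. *)
Definition ev_step (e a K : nat) : nat :=
  let q := (e - 4) %/ 4 in let r := (e - 4) %% 4 in
  if e == 0 then rt 0 K else
  if e == 1 then rt a.+1 K else
  if e == 2 then rt (unpair a).1 K else
  if e == 3 then rt (unpair a).2 K else
  if r == 0 then ev (unpair q).1 a (push 0 (npair (unpair q).2 a) K) else
  if r == 1 then ev (unpair q).2 a (push 2 (unpair q).1 K) else
  if r == 2 then ev (unpair q).1 (unpair a).1
    (push 3 (npair (npair (unpair q).2 (unpair a).1) (npair 0 (unpair a).2)) K)
  else ev q (npair a 0) (push 4 (npair q (npair a 0)) K).

Definition rt_step (v K : nat) : nat :=
  let tag := (unpair (unpair K.-1).1).1 in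
  let x := (unpair (unpair K.-1).1).2 in
  let L := (unpair K.-1).2 in
  if K == 0 then rt v K else
  if tag == 0 then ev (unpair x).1 (unpair x).2 (push 1 v L) else
  if tag == 1 then rt (npair x v) L else
  if tag == 2 then ev x v L else
  if tag == 3 then
    let d := (unpair (unpair x).1).1 in let y := (unpair (unpair x).1).2 in
    let i := (unpair (unpair x).2).1 in let n := (unpair (unpair x).2).2 in
    if i.+1 <= n then ev d (npair y (npair i v))
      (push 3 (npair (npair d y) (npair i.+1 n)) L)
    else rt v L
  else
    let c := (unpair x).1 in
    let a := (unpair (unpair x).2).1 in let b := (unpair (unpair x).2).2 in
    if v == 0 then rt b L
    else ev c (npair a b.+1) (push 4 (npair c (npair a b.+1)) L).

Definition step (s : nat) : nat :=
  let p := (unpair s).2 in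
  if (unpair s).1 == 0 then
    ev_step (unpair p).1 (unpair (unpair p).2).1 (unpair (unpair p).2).2
  else rt_step (unpair p).1 (unpair p).2.

Lemma computable_step : computable step.
Proof. by rewrite /step /ev_step /rt_step /ev /rt /push; computable. Qed.
#[export] Hint Resolve computable_step : computable.

Lemma step_ev e a K : step (ev e a K) = ev_step e a K.
Proof. by rewrite /step /ev !npairK. Qed.

Lemma step_rt v K : step (rt v K) = rt_step v K.
Proof. by rewrite /step /rt !npairK. Qed.

Lemma step_rt0 v : step (rt v 0) = rt v 0.
Proof. by rewrite step_rt. Qed.

Lemma ev_step_op e q r a K : r < 4 -> e = 4 * q + r + 4 ->
  ev_step e a K =
  if r == 0 then ev (unpair q).1 a (push 0 (npair (unpair q).2 a) K) else
  if r == 1 then ev (unpair q).2 a (push 2 (unpair q).1 K) else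
  if r == 2 then ev (unpair q).1 (unpair a).1
    (push 3 (npair (npair (unpair q).2 (unpair a).1) (npair 0 (unpair a).2)) K)
  else ev q (npair a 0) (push 4 (npair q (npair a 0)) K).
Proof.
move=> r4 ->; rewrite /ev_step !addnK !addn4 /=.
by rewrite mulnC divnMDl// (divn_small r4) addn0 modnMDl (modn_small r4).
Qed.

Lemma step_pair c d a K : step (ev (godel (Pair c d)) a K) =
  ev (godel c) a (push 0 (npair (godel d) a) K).
Proof.
by rewrite step_ev (@ev_step_op _ (npair (godel c) (godel d)) 0) ?addn0// npairK.
Qed.

Lemma step_comp c d a K : step (ev (godel (Comp c d)) a K) =
  ev (godel d) a (push 2 (godel c) K).
Proof.
by rewrite step_ev (@ev_step_op _ (npair (godel c) (godel d)) 1) ?npairK//= -addnA.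
Qed.

Lemma step_prec c d a K : step (ev (godel (Prec c d)) a K) =
  ev (godel c) (unpair a).1
    (push 3 (npair (npair (godel d) (unpair a).1) (npair 0 (unpair a).2)) K).
Proof.
by rewrite step_ev (@ev_step_op _ (npair (godel c) (godel d)) 2) ?npairK//= -addnA.
Qed.

Lemma step_mu c a K : step (ev (godel (Mu c)) a K) =
  ev (godel c) (npair a 0) (push 4 (npair (godel c) (npair a 0)) K).
Proof. by rewrite step_ev (@ev_step_op _ (godel c) 3)//= -addnA. Qed.

Lemma step_ret_pair v e a K :
  step (rt v (push 0 (npair e a) K)) = ev e a (push 1 v K).
Proof. by rewrite step_rt /rt_step /push /= !npairK. Qed.

Lemma step_ret_pair2 v u K : step (rt v (push 1 u K)) = rt (npair u v) K.
Proof. by rewrite step_rt /rt_step /push /= !npairK. Qed.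

Lemma step_ret_comp v e K : step (rt v (push 2 e K)) = ev e v K.
Proof. by rewrite step_rt /rt_step /push /= !npairK. Qed.

Lemma step_ret_prec v e y i n K :
  step (rt v (push 3 (npair (npair e y) (npair i n)) K)) =
  if i < n then ev e (npair y (npair i v))
    (push 3 (npair (npair e y) (npair i.+1 n)) K) else rt v K.
Proof. by rewrite step_rt /rt_step /push /= !npairK. Qed.

Lemma step_ret_mu v e a b K :
  step (rt v (push 4 (npair e (npair a b)) K)) =
  if v == 0 then rt b K
  else ev e (npair a b.+1) (push 4 (npair e (npair a b.+1)) K).
Proof. by rewrite step_rt /rt_step /push /= !npairK. Qed.

Definition reaches (s s' : nat) := exists t, iter t step s = s'.

Lemma reaches_refl s : reaches s s.
Proof. by exists 0. Qed.

Lemma reaches_trans s2 s1 s3 : reaches s1 s2 -> reaches s2 s3 -> reaches s1 s3.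
Proof. by move=> [t <-] [u <-]; exists (u + t); rewrite iterD. Qed.

Lemma reaches_step s s' : reaches (step s) s' -> reaches s s'.
Proof. by move=> [t <-]; exists t.+1; rewrite iterSr. Qed.

(** The stack is arbitrary so that the induction can run a subprogram in the middle of a larger
    computation. [Prec] and [Mu] need an inner induction on the rounds of the loop. *)
Lemma runs_reaches c a b K : runs c a b -> reaches (ev (godel c) a K) (rt b K).
Proof.
elim: c a b K => [||||c IHc d IHd|c IHc d IHd|c IHc d IHd|c IHc] a b K.
- by move=> ->; exists 1; rewrite /= step_ev.
- by move=> ->; exists 1; rewrite /= step_ev.
- by move=> ->; exists 1; rewrite /= step_ev.
- by move=> ->; exists 1; rewrite /= step_ev.
- move=> [u [v [/IHc hu /IHd hv ->]]].
  apply: reaches_step; rewrite step_pair; apply: (reaches_trans (hu _)).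
  apply: reaches_step; rewrite step_ret_pair; apply: (reaches_trans (hv _)).
  by apply: reaches_step; rewrite step_ret_pair2; exact: reaches_refl.
- move=> [u /IHd hu /IHc hv].
  apply: reaches_step; rewrite step_comp; apply: (reaches_trans (hu _)).
  by apply: reaches_step; rewrite step_ret_comp.
- rewrite /=; case ha : (unpair a) => [x n] [h [/IHc h0 hS ->]].
  apply: reaches_step; rewrite step_prec ha /=; apply: (reaches_trans (h0 _)).
  have main i : i <= n -> reaches
      (rt (h 0) (push 3 (npair (npair (godel d) x) (npair 0 n)) K))
      (rt (h i) (push 3 (npair (npair (godel d) x) (npair i n)) K)).
    elim: i => [_|i IH lin]; first exact: reaches_refl.
    apply: (reaches_trans (IH (ltnW lin))); apply: reaches_step.
    by rewrite step_ret_prec lin; exact: IHd (hS _ lin).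
  apply: (reaches_trans (main n (leqnn n))); apply: reaches_step.
  by rewrite step_ret_prec ltnn; exact: reaches_refl.
- move=> [/IHc h0 hm]; apply: reaches_step; rewrite step_mu.
  have main i : i <= b -> reaches
      (ev (godel c) (npair a 0) (push 4 (npair (godel c) (npair a 0)) K))
      (ev (godel c) (npair a i) (push 4 (npair (godel c) (npair a i)) K)).
    elim: i => [_|i IH lib]; first exact: reaches_refl.
    apply: (reaches_trans (IH (ltnW lib))); have [v /IHc hv] := hm _ lib.
    apply: (reaches_trans (hv _)); apply: reaches_step.
    by rewrite step_ret_mu; exact: reaches_refl.
  apply: (reaches_trans (main b (leqnn b))); apply: (reaches_trans (h0 _)).
  by apply: reaches_step; rewrite step_ret_mu; exact: reaches_refl.
Qed.

Definition halts t s := exists v, iter t step s = rt v 0.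

Lemma not_halted_ev e a K v : ev e a K <> rt v 0.
Proof. by move=> /(congr1 unpair); rewrite !npairK. Qed.

Lemma not_halted_rt u tag x K v : rt u (push tag x K) <> rt v 0.
Proof.
move=> /(congr1 (fun s => (unpair (unpair s).2).2)).
by rewrite /rt !npairK.
Qed.

Lemma halts_ev t e a K : halts t (ev e a K) ->
  exists2 u, t = u.+1 & halts u (step (ev e a K)).
Proof.
case: t => [[v]/not_halted_ev//|t [v]]; rewrite iterSr => h.
by exists t => //; exists v.
Qed.

Lemma halts_rt t v tag x K : halts t (rt v (push tag x K)) ->
  exists2 u, t = u.+1 & halts u (step (rt v (push tag x K))).
Proof.
case: t => [[w]/not_halted_rt//|t [w]]; rewrite iterSr => h.
by exists t => //; exists w.
Qed.

(** Converse of [runs_reaches]: a computation that ends with the empty stack must have returned from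
    the program on top of it. The strict decrease of the remaining time is what the induction for
    [Mu] runs on, where no bound on the number of rounds is known in advance. *)
Lemma halts_runs c a K t : halts t (ev (godel c) a K) ->
  exists b t', [/\ t' < t, halts t' (rt b K) & runs c a b].
Proof.
elim: c a K t => [||||c IHc d IHd|c IHc d IHd|c IHc d IHd|c IHc] a K t
  /halts_ev[{}t -> ht].
- by exists 0, t; split => //; rewrite step_ev in ht.
- by exists a.+1, t; split => //; rewrite step_ev in ht.
- by exists (unpair a).1, t; split => //; rewrite step_ev in ht.
- by exists (unpair a).2, t; split => //; rewrite step_ev in ht.
- move: ht; rewrite step_pair => /IHc[u [t1 [lt1 + ru]]].
  move=> /halts_rt[t2 e1]; subst t1; rewrite step_ret_pair => /IHd[v [t3 [lt3 + rv]]].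
  move=> /halts_rt[t4 e3]; subst t3; rewrite step_ret_pair2 => h4.
  exists (npair u v), t4; split => //; last by exists u, v.
  by lia.
- move: ht; rewrite step_comp => /IHd[u [t1 [lt1 + ru]]].
  move=> /halts_rt[t2 e1]; subst t1; rewrite step_ret_comp => /IHc[v [t3 [lt3 h3 rv]]].
  exists v, t3; split => //; last by exists u.
  by lia.
- move: ht; rewrite step_prec /=; case ha : (unpair a) => [x n] /=.
  move=> /IHc[u [t1 [lt1 + ru]]].
  (* Induction on the number [m] of rounds left. *)
  have main m : forall i t1 u, n = i + m ->
    halts t1 (rt u (push 3 (npair (npair (godel d) x) (npair i n)) K)) ->
    exists (h : nat -> nat) t', [/\ t' < t1, halts t' (rt (h n) K), h i = u &
     forall j, i <= j < n -> runs d (npair x (npair j (h j))) (h j.+1)].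
    elim: m => [|m IH] i {lt1}t1 {ru}u ni /halts_rt[t2 ->];
      rewrite step_ret_prec.
      rewrite ni addn0 ltnn => h2; exists (fun=> u), t2; split=> // j.
      by case: ltnP => // + /(leq_trans _) => /[swap] h /h; rewrite ltnn.
    rewrite {1}ni -{1}[i]addn0 ltn_add2l /= => /IHd[v [t3 [lt3 + rv]]].
    have ni1 : n = i.+1 + m by rewrite addSnnS.
    move=> /(IH _ _ _ ni1) [h [t' [lt' h' hi hj]]].
    (* The history of the later rounds, with the current value put at index [i]. *)
    exists (fun j => if j == i then u else h j), t'; split.
    - by lia.
    - by rewrite {1}ni -{2}[i]addn0 eqn_add2l.
    - by rewrite eqxx.
    - move=> j /andP[]; rewrite leq_eqVlt => /orP[/eqP <- _|ij jn].
        by rewrite eqxx gtn_eqF// hi.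
      by rewrite !gtn_eqF//; [apply: hj; rewrite ij|rewrite ltnW].
  move=> /(main n 0 _ _ erefl)[h [t' [lt' h' h0 hS]]].
  exists (h n), t'; split => //.
    by lia.
  by exists h; rewrite h0; split.
- move: ht; rewrite step_mu.
  have main : forall t b, (forall m, m < b -> exists v, runs c (npair a m) v.+1) ->
    halts t (ev (godel c) (npair a b) (push 4 (npair (godel c) (npair a b)) K)) ->
    exists b' t', [/\ t' < t, halts t' (rt b' K) & runs (Mu c) a b'].
    move=> {}t; elim/ltn_ind: t => t IH b hb /IHc[v [t1 [lt1 + rv]]].
    move=> /halts_rt[t2 e1]; subst t1; rewrite step_ret_mu.
    case: v rv => [|v] rv /= h2.
      by exists b, t2; split => //; lia.
    have hb1 m : m < b.+1 -> exists v, runs c (npair a m) v.+1.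
      by rewrite ltnS leq_eqVlt => /orP[/eqP ->|/hb//]; exists v.
    have [b' [t' [lt' h' hr]]] := IH t2 (ltnW lt1) b.+1 hb1 h2.
    by exists b', t'; split => //; lia.
  move=> /(main _ 0 (fun m => ltac:(by []))) [b [t' [lt' h' r]]].
  by exists b, t'; split => //; lia.
Qed.

Lemma godel_surj e : exists c, godel c = e.
Proof.
elim/ltn_ind: e => e IH.
case: (ltnP e 4) => [|e4].
  by case: e {IH} => [|[|[|[|//]]]] _;
    [exists Zero|exists Succ|exists Fst|exists Snd].
pose q := (e - 4) %/ 4; pose r := (e - 4) %% 4.
have eE : e = 4 * q + r + 4 by rewrite mulnC -divn_eq subnK.
have qe : q < e.
  by rewrite (leq_ltn_trans (leq_div _ _))//; lia.
have [c1 e1] := IH _ (leq_ltn_trans (leq_unpair1 q) qe).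
have [c2 e2] := IH _ (leq_ltn_trans (leq_unpair2 q) qe).
have [c0 e0] := IH _ qe.
have : r < 4 by rewrite ltn_mod.
move: eE; case: r => [|[|[|[|//]]]] eE _.
- by exists (Pair c1 c2); rewrite /= e1 e2 unpairK eE addn0.
- by exists (Comp c1 c2); rewrite /= e1 e2 unpairK eE -addnA.
- by exists (Prec c1 c2); rewrite /= e1 e2 unpairK eE -addnA.
- by exists (Mu c0); rewrite /= e0 eE -addnA.
Qed.

Lemma halts_halted t v : iter t step (rt v 0) = rt v 0.
Proof. by elim: t => //= t ->; exact: step_rt0. Qed.

(** Final states are fixed by [step], so two halting runs meet at a common later time. The programs
    share only their number, since a number is all that [W] provides. *)
Lemma runs_inj c c' a b b' : godel c = godel c' ->
  runs c a b -> runs c' a b' -> b = b'.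
Proof.
move=> cc' /(runs_reaches 0)[t ht] /(runs_reaches 0)[t' ht'].
have : rt b 0 = rt b' 0.
  rewrite -(halts_halted t' b) -(halts_halted t b') -ht -ht' cc' -!iterD.
  by rewrite addnC.
by move=> /(congr1 (fun s => (unpair (unpair s).2).1)); rewrite /rt !npairK.
Qed.

Lemma WP e n : W e n <-> exists t, halts t (ev e n 0).
Proof.
split=> [[c <- [m /(runs_reaches 0)[t ht]]]|[t]]; first by exists t, m.
have [c <-] := godel_surj e => /halts_runs[b [t' [_ _ r]]].
by exists c => //; exists b.
Qed.

(** * Computably enumerable relations *)

(** Normal form of a c.e. predicate, as the projection of a computable zero set. Closure properties
    are proved in this form, without reference to programs. *)
Definition sig (P : nat -> Prop) : Prop := exists2 f, computable f &
  forall n, P n <-> exists m, f (npair n m) = 0.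

Lemma sig_ext P Q : (forall n, P n <-> Q n) -> sig P -> sig Q.
Proof. by move=> PQ [f hf h]; exists f => // n; rewrite -PQ. Qed.

Lemma sig_dec (p : nat -> bool) : computable p -> sig (fun n => p n).
Proof.
move=> hp; exists (fun n => ~~ p (unpair n).1); first by computable.
move=> n; split=> [pn|[m]]; first by exists 0; rewrite npairK pn.
by rewrite npairK; case: (p n).
Qed.

Lemma sig_comp P g : sig P -> computable g -> sig (fun n => P (g n)).
Proof.
move=> [f hf h] hg.
exists (fun n => f (npair (g (unpair n).1) (unpair n).2)); first by computable.
by move=> n; rewrite h; split=> -[m hm]; exists m; move: hm; rewrite !npairK.
Qed.

Lemma sig_and P Q : sig P -> sig Q -> sig (fun n => P n /\ Q n).
Proof.
move=> [f hf h] [g hg h'].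
exists (fun n => f (npair (unpair n).1 (unpair (unpair n).2).1) +
                 g (npair (unpair n).1 (unpair (unpair n).2).2)).
  by computable.
move=> n; rewrite h h'; split=> [[[m hm] [m' hm']]|[m]].
  by exists (npair m m'); rewrite !npairK hm hm'.
move=> /eqP; rewrite !npairK addn_eq0 => /andP[/eqP hm /eqP hm'].
by split; [exists (unpair m).1|exists (unpair m).2].
Qed.

Lemma sig_or P Q : sig P -> sig Q -> sig (fun n => P n \/ Q n).
Proof.
move=> [f hf h] [g hg h'].
exists (fun n => f n * g n); first by computable.
move=> n; rewrite h h'; split=> [[[m hm]|[m hm]]|[m]].
- by exists m; rewrite hm.
- by exists m; rewrite hm muln0.
- by move=> /eqP; rewrite muln_eq0 => /orP[] /eqP ?; [left|right]; exists m.
Qed.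

Lemma sig_ex (P : nat -> nat -> Prop) :
  sig (fun n => P (unpair n).1 (unpair n).2) -> sig (fun n => exists m, P n m).
Proof.
move=> [f hf h].
exists (fun n => f (npair (npair (unpair n).1 (unpair (unpair n).2).1)
                          (unpair (unpair n).2).2)); first by computable.
move=> n; split=> [[m]|[m]].
  have := h (npair n m); rewrite npairK => -> [w hw].
  by exists (npair m w); rewrite !npairK.
rewrite !npairK => hm; exists (unpair m).1.
by have := h (npair n (unpair m).1); rewrite npairK => ->; exists (unpair m).2.
Qed.

(** The witnesses for all [i < g n] are packed into one sequence code, and a sum of naturals
    vanishes only if every term does. *)
Lemma sig_forall (P : nat -> nat -> Prop) g : computable g ->
  sig (fun n => P (unpair n).1 (unpair n).2) ->
  sig (fun n => forall i, i < g n -> P n i).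
Proof.
move=> hg [f hf h].
pose F n i := f (npair (npair (unpair n).1 i) (elt (unpair n).2 i)).
have hF : computable2 F by rewrite /F; computable.
have hG : computable (fun n => g (unpair n).1) by computable.
exists (fun n => \sum_(i < g (unpair n).1) F n i).
  exact: (@computable_sum F (fun n => g (unpair n).1) hF hG).
have h2 n i : P n i <-> exists m, f (npair (npair n i) m) = 0.
  by have := h (npair n i); rewrite npairK.
move=> n; split=> [hn|[m]].
  have {}hn i : exists m, i < g n -> f (npair (npair n i) m) = 0.
    case: (ltnP i (g n)) => [/hn/h2[m hm]|]; first by exists m.
    by exists 0.
  have [u hu] := choice hn; have [l hl] := eltP u (g n).
  exists l; rewrite npairK big1// => i _; rewrite /F npairK hl//.
  exact: hu.
rewrite npairK => /eqP; rewrite sum_nat_eq0 => /forallP hm i lti.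
apply/h2; exists (elt m i).
by have /eqP := hm (Ordinal lti); rewrite /F npairK.
Qed.

Lemma rt_eta s : (unpair (unpair s).2).2 = 0 -> (unpair s).1 = 1 ->
  s = rt (unpair (unpair s).2).1 0.
Proof.
move=> s0 s1; rewrite /rt -{1}[s]unpairK s1; congr npair.
by rewrite -{1}[(unpair s).2]unpairK s0.
Qed.

(** In one direction [Mu] searches for the witness; in the other the witness is the halting time of
    the universal machine. *)
Lemma sigE P : sig P <-> ce P.
Proof.
split=> [[f [c hc] h]|[e ->]].
  exists (godel (Mu c)); apply/seteqP; split=> [n|n [c' e [m r]]].
    move=> /h hn; exists (Mu c) => //.
    have hn' : exists m, f (npair n m) == 0 by case: hn => m /eqP; exists m.
    exists (ex_minn hn'); case: ex_minnP => m /eqP fm mmin.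
    split; first by rewrite -fm; exact: hc.
    move=> k km; exists (f (npair n k)).-1; rewrite prednK; first exact: hc.
    by rewrite lt0n; apply: contraL km => /mmin; rewrite -leqNgt.
  have [t ht] := (WP (godel c') n).1 (ex_intro2 _ _ c' erefl (ex_intro _ m r)).
  rewrite e in ht; have [b [_ [_ _ [r0 _]]]] := halts_runs ht.
  apply/h; exists b; exact: runs_inj (erefl (godel c)) (hc _) r0.
pose H n := let s := iter (unpair n).2 step (ev e (unpair n).1 0) in
  ~~ (((unpair s).1 == 1) && ((unpair (unpair s).2).2 == 0)).
exists H.
  have hs : computable (fun n => iter (unpair n).2 step (ev e (unpair n).1 0)).
    by apply: (computable_iter (d := fun=> step)); rewrite /ev; computable.
  by rewrite /H; computable.
move=> n; rewrite WP; split=> [[t [v h]]|[t]].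
  by exists t; rewrite /H npairK h /rt !npairK.
rewrite /H npairK; case: eqP => //; case: eqP => //= s0 s1 _; exists t.
by eexists; exact: rt_eta s0 s1.
Qed.

Lemma sig_W : sig (fun n => W (unpair n).1 (unpair n).2).
Proof.
pose H n := let s := iter (unpair n).2 step
    (ev (unpair (unpair n).1).1 (unpair (unpair n).1).2 0) in
  ~~ (((unpair s).1 == 1) && ((unpair (unpair s).2).2 == 0)).
exists H.
  have hs : computable (fun n => iter (unpair n).2 step
      (ev (unpair (unpair n).1).1 (unpair (unpair n).1).2 0)).
    by apply: (computable_iter (d := fun=> step)); rewrite /ev; computable.
  by rewrite /H; computable.
move=> n; rewrite WP; split=> [[t [v h]]|[t]].
  by exists t; rewrite /H npairK h /rt !npairK.
rewrite /H npairK; case: eqP => //; case: eqP => //= s0 s1 _; exists t.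
by eexists; exact: rt_eta s0 s1.
Qed.

(** The s-m-n theorem: composing a program with one that pairs its input with the constant [n] is an
    arithmetic operation on Gödel numbers. *)
Lemma smn P : sig P -> exists2 h, computable h &
  forall n m, W (h n) m <-> P (npair n m).
Proof.
move=> /sigE[e ->]; have [c he] := godel_surj e.
(* [4 * npair 1 r + 5] numbers [Comp Succ] of the program numbered [r], so [cst n] numbers a program
   with constant value [n]. *)
pose cst n := nat_rect (fun=> nat) 0 (fun _ r => 4 * npair 1 r + 5) n.
have cstE n : cst n = godel (iter n (Comp Succ) Zero).
  by elim: n => //= n; rewrite /cst /= => ->.
have runs_cst n a : runs (iter n (Comp Succ) Zero) a n.
  by elim: n => //= n IH; exists n.
pose I := godel (Pair Fst Snd).
exists (fun n => 4 * npair e (4 * npair (cst n) I + 4) + 5).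
  have : computable cst.
    have := @computable_rec (fun=> 0) (fun n => n) (fun _ _ r => 4 * npair 1 r + 5).
    by apply; computable.
  by move=> hc; computable.
move=> n m; pose C := Comp c (Pair (iter n (Comp Succ) Zero) (Pair Fst Snd)).
have -> : 4 * npair e (4 * npair (cst n) I + 4) + 5 = godel C.
  by rewrite /C /= he -cstE.
have runs_arg : runs (Pair (iter n (Comp Succ) Zero) (Pair Fst Snd)) m (npair n m).
  exists n, m; split; [exact: runs_cst| |by []].
  by exists (unpair m).1, (unpair m).2; rewrite unpairK.
split=> [[c' /esym e' [b r]]|[c' /esym e' [b r]]].
  have [t ht] := (WP (godel c') m).1 (ex_intro2 _ _ c' erefl (ex_intro _ b r)).
  rewrite -e' in ht; have [b' [_ [_ _ [u ru rc]]]] := halts_runs ht.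
  exists c => //; exists b'.
  by rewrite (runs_inj erefl runs_arg ru).
have [t ht] := (WP e (npair n m)).1 (ex_intro2 _ _ c' (esym e') (ex_intro _ b r)).
rewrite -he in ht; have [b' [_ [_ _ rc]]] := halts_runs ht.
by exists C => //; exists b'; exists (npair n m).
Qed.

(** [Mu] searches for a pair of a value and a witness for it. All rates of approximation below are
    extracted this way, once the approximation condition is known to be c.e. and satisfiable. *)
Lemma sig_choice (P : nat -> nat -> Prop) :
  sig (fun n => P (unpair n).1 (unpair n).2) -> (forall n, exists m, P n m) ->
  exists2 f, computable f & forall n, P n (f n).
Proof.
move=> [f [c hc] h] hP.
have h2 n i : P n i <-> exists m, f (npair (npair n i) m) = 0.
  by have := h (npair n i); rewrite npairK.
pose F n m := f (npair (npair n (unpair m).1) (unpair m).2).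
have Fex n : exists m, F n m == 0.
  have [m /h2[w hw]] := hP n; exists (npair m w).
  by rewrite /F npairK hw.
have [d hd] : computable2 F.
  have hf : computable f by exists c.
  by rewrite /F; computable.
exists (fun n => (unpair (ex_minn (Fex n))).1).
  apply: computable_fst; exists (Mu d) => n /=.
  case: ex_minnP => m /eqP Fm mmin; split.
    by have := hd (npair n m); rewrite npairK Fm.
  move=> k km; exists (F n k).-1; rewrite prednK.
    by have := hd (npair n k); rewrite npairK.
  by rewrite lt0n; apply: contraL km => /mmin; rewrite -leqNgt.
move=> n; case: ex_minnP => m /eqP Fm _; apply/h2.
by exists (unpair m).2.
Qed.

(** * Rational numbers *)

(** A rational is a difference of naturals over a positive denominator, so the operations below are
    polynomial in the codes, with neither signs nor reduced fractions. *)
Definition mkq (x y b : nat) : nat := npair (npair x y) b.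
Definition qx (k : nat) : nat := (unpair (unpair k).1).1.
Definition qy (k : nat) : nat := (unpair (unpair k).1).2.
Definition qd (k : nat) : nat := (unpair k).2.+1.

Definition qnat (n : nat) : nat := mkq n 0 0.
Definition qinv (n : nat) : nat := mkq 1 0 n.
Definition qpow2 (n : nat) : nat := mkq 1 0 (2 ^ n).-1.
Definition qopp (k : nat) : nat := mkq (qy k) (qx k) (unpair k).2.
Definition qadd (k l : nat) : nat :=
  mkq (qx k * qd l + qx l * qd k) (qy k * qd l + qy l * qd k) (qd k * qd l).-1.
Definition qmul (k l : nat) : nat :=
  mkq (qx k * qx l + qy k * qy l) (qx k * qy l + qy k * qx l) (qd k * qd l).-1.
Definition qle (k l : nat) : bool :=
  qx k * qd l + qy l * qd k <= qx l * qd k + qy k * qd l.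
Definition qlt (k l : nat) : bool := ~~ qle l k.

(* A rational as an index for posqnum, correct if it is positive, and back. *)
Definition qpos (k : nat) : nat := npair (qx k - qy k).-1 (unpair k).2.
Definition posq (p : nat) : nat := mkq (unpair p).1.+1 0 (unpair p).2.

Lemma computable_qle2 f g : computable f -> computable g ->
  computable (fun n => qle (f n) (g n)).
Proof. by rewrite /qle /qx /qy /qd => hf hg; computable. Qed.

Lemma computable_qlt2 f g : computable f -> computable g ->
  computable (fun n => qlt (f n) (g n)).
Proof. by rewrite /qlt /qle /qx /qy /qd => hf hg; computable. Qed.

Lemma computable_qnat : computable qnat.
Proof. by rewrite /qnat /mkq; computable. Qed.
Lemma computable_qinv : computable qinv.
Proof. by rewrite /qinv /mkq; computable. Qed.
Lemma computable_qpow2 : computable qpow2.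
Proof. by rewrite /qpow2 /mkq; computable. Qed.
Lemma computable_qopp : computable qopp.
Proof. by rewrite /qopp /mkq /qx /qy; computable. Qed.
Lemma computable_qadd : computable2 qadd.
Proof. by rewrite /qadd /mkq /qx /qy /qd; computable. Qed.
Lemma computable_qmul : computable2 qmul.
Proof. by rewrite /qmul /mkq /qx /qy /qd; computable. Qed.
Lemma computable_qpos : computable qpos.
Proof. by rewrite /qpos /qx /qy; computable. Qed.
Lemma computable_posq : computable posq.
Proof. by rewrite /posq /mkq; computable. Qed.
#[export] Hint Resolve computable_qnat computable_qinv computable_qpow2
  computable_qopp computable_qadd computable_qmul computable_qpos
  computable_posq : computable.

Local Open Scope ring_scope.

Section qnum.
Variable R : realType.
Local Notation qnum := (qnum R).

Lemma qnumE k : qnum k = ((qx k)%:R - (qy k)%:R) / (qd k)%:R.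
Proof. by rewrite /Defs.qnum /qx /qy /qd; case: (unpair k). Qed.

Lemma qnum_mkq x y b : qnum (mkq x y b) = (x%:R - y%:R) / b.+1%:R.
Proof. by rewrite qnumE /qx /qy /qd /mkq !npairK. Qed.

Lemma qnum_nat n : qnum (qnat n) = n%:R.
Proof. by rewrite qnum_mkq subr0 divr1. Qed.

Lemma qnum_inv n : qnum (qinv n) = n.+1%:R^-1.
Proof. by rewrite qnum_mkq subr0 mul1r. Qed.

Lemma qnum_pow2 n : qnum (qpow2 n) = 2 ^- n.
Proof. by rewrite qnum_mkq subr0 mul1r prednK ?expn_gt0// natrX. Qed.

Lemma qnum_opp k : qnum (qopp k) = - qnum k.
Proof. by rewrite qnum_mkq qnumE -mulNr opprB. Qed.

Let qd0 k : (qd k)%:R != 0 :> R.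
Proof. by rewrite pnatr_eq0. Qed.

Lemma qnum_add k l : qnum (qadd k l) = qnum k + qnum l.
Proof.
rewrite qnum_mkq !qnumE prednK ?muln_gt0// !natrD !natrM.
by field; rewrite !qd0.
Qed.

Lemma qnum_mul k l : qnum (qmul k l) = qnum k * qnum l.
Proof.
rewrite qnum_mkq !qnumE prednK ?muln_gt0// !natrD !natrM.
by field; rewrite !qd0.
Qed.

Lemma qleE k l : qle k l = (qnum k <= qnum l).
Proof.
rewrite !qnumE ler_pdivrMr ?ltr0n// mulrAC ler_pdivlMr ?ltr0n//.
rewrite !mulrBl lerBlDr addrAC lerBrDr -!natrM -!natrD ler_nat.
by rewrite /qle.
Qed.

Lemma qltE k l : qlt k l = (qnum k < qnum l).
Proof. by rewrite /qlt qleE ltNge. Qed.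

Lemma qnum_posq p : qnum (posq p) = posqnum R p.
Proof. by rewrite qnum_mkq subr0. Qed.

Lemma posqnum_pos k : 0 < qnum k -> posqnum R (qpos k) = qnum k.
Proof.
move=> k0; rewrite /posqnum /qpos !npairK qnumE.
have yx : (qy k < qx k)%N.
  by move: k0; rewrite qnumE pmulr_lgt0 ?invr_gt0 ?ltr0n// subr_gt0 ltr_nat.
by rewrite prednK ?subn_gt0// natrB// ltnW.
Qed.

Lemma qnum_ratr (q : rat) : exists k, qnum k = ratr q.
Proof.
have hd : (0 < `|denq q|)%N by rewrite absz_gt0 denq_neq0.
have qE : ratr q = (numq q)%:~R / (`|denq q|%N)%:R :> R.
  by rewrite [in RHS]pmulrn absz_denq.
rewrite qE; case: (numq q) => n.
  by exists (mkq n 0 `|denq q|.-1); rewrite qnum_mkq subr0 prednK.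
exists (mkq 0 n.+1 `|denq q|.-1); rewrite qnum_mkq prednK// sub0r.
by rewrite NegzE mulrNz.
Qed.

Lemma qnum_dense (a b : R) : a < b -> exists k, a < qnum k < b.
Proof.
move=> /rat_in_itvoo[q]; have [k <-] := qnum_ratr q.
by rewrite in_itv/= => ?; exists k.
Qed.

Lemma qnum_lt (a : R) : exists k, qnum k < a.
Proof.
have [k /andP[_]] := @qnum_dense (a - 1) a ltac:(by rewrite ltrBlDr ltrDl).
by exists k.
Qed.

Lemma qnum_gt (a : R) : exists k, a < qnum k.
Proof.
have [k /andP[+ _]] := @qnum_dense a (a + 1) ltac:(by rewrite ltrDl).
by exists k.
Qed.

Lemma lte_qnum (a b : \bar R) : (a < b)%E ->
  exists k, (a < (qnum k)%:E)%E /\ ((qnum k)%:E < b)%E.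
Proof.
case: a b => [a||] [b||]//.
- by rewrite lte_fin => /qnum_dense[k /andP[? ?]]; exists k; rewrite !lte_fin.
- by move=> _; have [k ak] := qnum_gt a; exists k; rewrite lte_fin ltry.
- by move=> _; have [k ak] := qnum_lt b; exists k; rewrite lte_fin ltNyr.
- by move=> _; exists 0%N; rewrite ltNyr ltry.
Qed.

(** Crude, but it turns the index of a rational above a real into an integer above that real. *)
Lemma qnum_le (k : nat) : qnum k <= k%:R.
Proof.
have h1 : (qx k <= k)%N.
  by rewrite /qx (leq_trans (leq_unpair1 _))// leq_unpair1.
rewrite qnumE ler_pdivrMr ?ltr0n//.
rewrite (@le_trans _ _ (k%:R - 0))// ?lerB ?ler_nat//.
by rewrite subr0 -natrM ler_nat leq_pmulr.
Qed.

Lemma qnum_ext (a b : \bar R) :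
  (forall k, ((qnum k)%:E < a)%E <-> ((qnum k)%:E < b)%E) -> a = b.
Proof.
move=> h; apply/eqP; rewrite eq_le !leNgt; apply/andP; split; apply/negP.
  by move=> /lte_qnum[k [k1 k2]]; have /h := k2; rewrite ltNge (ltW k1).
by move=> /lte_qnum[k [k1 k2]]; have /h := k2; rewrite ltNge (ltW k1).
Qed.

End qnum.

(** * Lower semicomputability over an effective base *)

(* Both the balls of a computable Polish space and the trivial base of a point
   are effective bases. Over the latter, the lower semicomputable functions are
   the left-c.e. reals. *)
Definition effective_base (T : Type) (B : nat -> set T) : Prop :=
  exists lt : nat -> nat -> Prop,
  [/\ sig (fun n => lt (unpair n).1 (unpair n).2),
      forall k l x, lt k l -> B k x -> B l x &
      forall x (m : nat -> nat) K, (forall i, (i < K)%N -> B (m i) x) ->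
        exists k, B k x /\ forall i, (i < K)%N -> lt k (m i)].

Section effective.
Variables (R : realType) (T : Type) (B : nat -> set T).
Local Notation qnum := (qnum R).

Definition eopen (U : nat -> T -> Prop) : Prop :=
  exists2 A, sig A & forall n x, U n x <-> exists m, A (npair n m) /\ B m x.

Definition lsc (f : nat -> T -> \bar R) : Prop := (forall n x, f n x != -oo%E) /\
  eopen (fun j x => ((qnum (unpair j).2)%:E < f (unpair j).1 x)%E).

(** Computable functions, as those that are both lower and upper semicomputable; over the base of a
    point, the computable reals ([computable_realsP]). *)
Definition bicomputable (g : nat -> T -> R) : Prop :=
  lsc (fun n x => (g n x)%:E) /\ lsc (fun n x => (- g n x)%:E).

Hypothesis hB : effective_base B.

Lemma eopen_ext U V : (forall n x, U n x <-> V n x) -> eopen U -> eopen V.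
Proof. by move=> UV [A hA h]; exists A => // n x; rewrite -UV. Qed.

Lemma eopen_comp U g : computable g -> eopen U -> eopen (fun n => U (g n)).
Proof.
move=> hg [A hA h]; exists (fun n => A (npair (g (unpair n).1) (unpair n).2)).
  by apply: (sig_comp (P := A)) => //; computable.
by move=> n x; rewrite h; split=> -[m hm]; exists m; move: hm; rewrite !npairK.
Qed.

Lemma eopen_bigcup (U : nat -> nat -> T -> Prop) :
  eopen (fun n => U (unpair n).1 (unpair n).2) -> eopen (fun n x => exists m, U n m x).
Proof.
move=> [A hA h]; exists (fun n => exists m, A (npair (npair (unpair n).1 m) (unpair n).2)).
  by apply: sig_ex; apply: (sig_comp (P := A)) => //; computable.
move=> n x; split=> [[m]|[k []]].
  have := h (npair n m) x; rewrite npairK => -> [k [Ak Bk]].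
  by exists k; split=> //; exists m; rewrite npairK.
rewrite npairK => -[m /= Am] Bk; exists m.
by have := h (npair n m) x; rewrite npairK => ->; exists k.
Qed.

(** A point in finitely many basic sets has a basic neighbourhood that is formally included, in the
    sense of [lt], in all of them. Formal inclusion is c.e., whereas inclusion itself need not
    be. *)
Lemma eopen_forall (U : nat -> nat -> T -> Prop) g : computable g ->
  eopen (fun n => U (unpair n).1 (unpair n).2) ->
  eopen (fun n x => forall i, (i < g n)%N -> U n i x).
Proof.
have [lt [hlt ltB Bex]] := hB; move=> hg [A hA h].
pose A' n i k := exists m, A (npair (npair n i) m) /\ lt k m.
exists (fun n => forall i, (i < g (unpair n).1)%N -> A' (unpair n).1 i (unpair n).2).
  have hg' : computable (fun n => g (unpair n).1) by computable.
  apply: (@sig_forall (fun n i => A' (unpair n).1 i (unpair n).2) _ hg').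
  apply: sig_ex; apply: sig_and.
    by apply: (sig_comp (P := A)) => //; computable.
  have := @sig_comp _ (fun n => npair (unpair (unpair (unpair n).1).1).2 (unpair n).2) hlt.
  move=> /(_ ltac:(computable)).
  by apply: sig_ext => n; rewrite !npairK.
have h2 n i x : U n i x <-> exists m, A (npair (npair n i) m) /\ B m x.
  by have := h (npair n i) x; rewrite npairK.
move=> n x; split=> [hn|[k]].
  have /choice[m hm] : forall i, exists m,
      (i < g n)%N -> A (npair (npair n i) m) /\ B m x.
    move=> i; case: (ltnP i (g n)) => [/hn/h2[m hm]|_]; first by exists m.
    by exists 0%N.
  have [k [Bk ltk]] := Bex x m (g n) (fun i hi => (hm i hi).2).
  exists k; rewrite npairK; split=> // i hi.
  by exists (m i); split; [exact: (hm i hi).1|exact: ltk].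
rewrite npairK => -[hk Bk] i /hk[m [Am km]]; apply/h2.
by exists m; split=> //; exact: ltB Bk.
Qed.

Lemma eopen_sig P : sig P -> eopen (fun n _ => P n).
Proof.
move=> hP; exists (fun n => P (unpair n).1).
  by apply: (sig_comp (P := P)) => //; computable.
move=> n x; split=> [Pn|[m]]; last by rewrite npairK => -[].
(* The empty family: every point lies in some basic set. *)
have [lt [_ _ /(_ x (fun=> 0%N) 0%N)[//|k [Bk _]]]] := hB.
by exists k; rewrite npairK.
Qed.

Lemma eopen_or U V : eopen U -> eopen V -> eopen (fun n x => U n x \/ V n x).
Proof.
move=> [A hA h] [A' hA' h']; exists (fun n => A n \/ A' n); first exact: sig_or.
move=> n x; rewrite h h'; split.
  by move=> [[m [Am Bm]]|[m [Am Bm]]]; exists m; split=> //; [left|right].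
by move=> [m [[Am|Am] Bm]]; [left|right]; exists m.
Qed.

Lemma eopen_if (b : nat -> bool) U V : computable b -> eopen U -> eopen V ->
  eopen (fun n x => if b n then U n x else V n x).
Proof.
move=> hb [A hA h] [A' hA' h'].
exists (fun n => (b (unpair n).1 /\ A n) \/ (~~ b (unpair n).1 /\ A' n)).
  by apply: sig_or; apply: sig_and => //; apply: sig_dec; computable.
move=> n x; case: ifP => bn; rewrite ?h ?h'; split.
- by move=> [m [Am Bm]]; exists m; rewrite npairK bn; split=> //; left.
- by move=> [m]; rewrite npairK bn => -[[[_ Am]|[//]] Bm]; exists m.
- by move=> [m [Am Bm]]; exists m; rewrite npairK bn; split=> //; right.
- by move=> [m]; rewrite npairK bn => -[[[//]|[_ Am]] Bm]; exists m.
Qed.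

Lemma eopen_and U V : eopen U -> eopen V -> eopen (fun n x => U n x /\ V n x).
Proof.
move=> hU hV; pose W n i x := if i == 0%N then U n x else V n x.
have /(eopen_forall (computable_const 2)) :
    eopen (fun n => W (unpair n).1 (unpair n).2).
  have hU1 : eopen (fun n x => U (unpair n).1 x).
    by apply: (eopen_comp (U := U)) => //; computable.
  have hV1 : eopen (fun n x => V (unpair n).1 x).
    by apply: (eopen_comp (U := V)) => //; computable.
  by apply: (@eopen_if (fun n => (unpair n).2 == 0%N) _ _ _ hU1 hV1); computable.
apply: eopen_ext => n x; split=> [h|[Un Vn]].
  by split; [have := h 0%N; apply|have := h 1%N; apply].
by move=> [|[|i]].
Qed.

Lemma lsc_ext f g : (forall n x, f n x = g n x) -> lsc f -> lsc g.
Proof.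
by move=> fg; have -> // : f = g; apply/funext => n; apply/funext => x.
Qed.

Lemma lsc_comp f h : computable h -> lsc f -> lsc (fun n => f (h n)).
Proof.
move=> hh [f1 f2]; split=> [n x|]; first exact: f1.
have := eopen_comp (U := fun j x => ((qnum (unpair j).2)%:E < f (unpair j).1 x)%E)
  (g := fun j => npair (h (unpair j).1) (unpair j).2) ltac:(computable) f2.
by apply: eopen_ext => n x; rewrite npairK.
Qed.

Lemma lsc_gt f h k : computable h -> computable k -> lsc f ->
  eopen (fun n x => ((qnum (k n))%:E < f (h n) x)%E).
Proof.
move=> hh hk [f1 f2].
have := eopen_comp (g := fun j => npair (h j) (k j)) ltac:(computable) f2.
by apply: eopen_ext => n x; rewrite npairK.
Qed.

(* The test S is applied to the index n, the threshold q and rational lower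
   bounds p1, p2 of f and g. *)
Lemma lsc_binary (f g h : nat -> T -> \bar R) (S : nat -> nat -> nat -> nat -> Prop) :
  sig (fun j => S (unpair (unpair j).1).1 (unpair (unpair j).1).2
                  (unpair (unpair j).2).1 (unpair (unpair j).2).2) ->
  lsc f -> lsc g -> (forall n x, h n x != -oo%E) ->
  (forall n x q, ((qnum q)%:E < h n x)%E <-> exists p1 p2,
    [/\ S n q p1 p2, ((qnum p1)%:E < f n x)%E & ((qnum p2)%:E < g n x)%E]) ->
  lsc h.
Proof.
move=> hS hf hg h1 h2; split=> //.
pose U n q p x := S n q (unpair p).1 (unpair p).2 /\
  (((qnum (unpair p).1)%:E < f n x)%E /\ ((qnum (unpair p).2)%:E < g n x)%E).
have : eopen (fun j x => exists p, U (unpair j).1 (unpair j).2 p x).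
  apply: (@eopen_bigcup (fun j => U (unpair j).1 (unpair j).2)).
  by apply: eopen_and; [exact: eopen_sig|apply: eopen_and; apply: lsc_gt => //;
    computable].
apply: eopen_ext => n x; rewrite h2; split=> [[p [? [? ?]]]|[p1 [p2 [? ? ?]]]].
  by exists (unpair p).1, (unpair p).2.
by exists (npair p1 p2); rewrite /U npairK.
Qed.

Lemma lsc_unary (f h : nat -> T -> \bar R) (S : nat -> nat -> nat -> Prop) :
  sig (fun j => S (unpair (unpair j).1).1 (unpair (unpair j).1).2 (unpair j).2) ->
  lsc f -> (forall n x, h n x != -oo%E) ->
  (forall n x q, ((qnum q)%:E < h n x)%E <-> exists p,
    S n q p /\ ((qnum p)%:E < f n x)%E) ->
  lsc h.
Proof.
move=> hS hf h1 h2; apply: (@lsc_binary f f h (fun n q p _ => S n q p)) => //.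
  have := sig_comp hS (g := fun j => npair (unpair j).1 (unpair (unpair j).2).1).
  by move=> /(_ ltac:(computable)); apply: sig_ext => j; rewrite !npairK.
move=> n x q; rewrite h2; split=> [[p [? ?]]|[p [_ [? ? _]]]]; last by exists p.
by exists p, p.
Qed.

Lemma lsc_cst c : computable c -> lsc (fun n _ => (qnum (c n))%:E).
Proof.
move=> hc; split=> //; have : eopen (fun j (_ : T) => qlt (unpair j).2 (c (unpair j).1)).
  by apply: eopen_sig; apply: sig_dec; apply: computable_qlt2; computable.
by apply: eopen_ext => j x; rewrite (qltE R) lte_fin.
Qed.

Lemma lsc_sup (f : nat -> nat -> T -> \bar R) :
  lsc (fun n => f (unpair n).1 (unpair n).2) ->
  lsc (fun n x => ereal_sup (range (fun m => f n m x))).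
Proof.
move=> [f1 f2]; split=> [n x|].
  have := f1 (npair n 0) x; rewrite npairK /= -!ltNye => /lt_le_trans; apply.
  by apply: ereal_sup_ubound; exists 0%N.
pose U j m x := ((qnum (unpair j).2)%:E < f (unpair j).1 m x)%E.
have : eopen (fun j x => exists m, U j m x).
  apply: eopen_bigcup.
  have := lsc_gt (h := fun j => npair (unpair (unpair j).1).1 (unpair j).2)
    (k := fun j => (unpair (unpair j).1).2) ltac:(computable) ltac:(computable)
    (conj f1 f2).
  by apply: eopen_ext => j x; rewrite npairK.
apply: eopen_ext => j x; split=> [[m hm]|/ereal_sup_gt[_ [m _ <-]]]; last by exists m.
by apply: (lt_le_trans hm); apply: ereal_sup_ubound; exists m.
Qed.

Lemma lsc_max f g : lsc f -> lsc g -> lsc (fun n x => maxe (f n x) (g n x)).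
Proof.
move=> [f1 f2] [g1 g2]; split=> [n x|]; first by rewrite /maxe; case: ifP.
by have := eopen_or f2 g2; apply: eopen_ext => j x; rewrite lt_max; split=> /orP.
Qed.

Lemma lsc_min f g : lsc f -> lsc g -> lsc (fun n x => mine (f n x) (g n x)).
Proof.
move=> [f1 f2] [g1 g2]; split=> [n x|]; first by rewrite /mine; case: ifP.
by have := eopen_and f2 g2; apply: eopen_ext => j x; rewrite lt_min; split=> /andP.
Qed.

Lemma lsc_bigmin (f : nat -> nat -> T -> \bar R) g : computable g ->
  lsc (fun n => f (unpair n).1 (unpair n).2) ->
  lsc (fun n x => \big[mine/+oo%E]_(i < g n) f n i x).
Proof.
move=> hg [f1 f2]; have lt_big N (u : nat -> \bar R) a : (a < +oo)%E ->
    (a < \big[mine/+oo]_(i < N) u i)%E <-> forall i, (i < N)%N -> (a < u i)%E.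
  move=> aoo; elim: N => [|N IH]; first by rewrite big_ord0.
  rewrite big_ord_recr /= lt_min; split=> [/andP[/IH h1 h2] i|h].
    by rewrite ltnS leq_eqVlt => /orP[/eqP->//|/h1].
  by rewrite h// andbT; apply/IH => i iN; rewrite h// ltnW.
split=> [n x|].
  rewrite -ltNye; apply/(lt_big _ (fun i => f n i x)) => // i _.
  by have := f1 (npair n i) x; rewrite npairK ltNye.
pose U j i x := ((qnum (unpair j).2)%:E < f (unpair j).1 i x)%E.
have : eopen (fun j x => forall i, (i < g (unpair j).1)%N -> U j i x).
  apply: eopen_forall; first by computable.
  have := lsc_gt (h := fun j => npair (unpair (unpair j).1).1 (unpair j).2)
    (k := fun j => (unpair (unpair j).1).2) ltac:(computable) ltac:(computable)
    (conj f1 f2).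
  by apply: eopen_ext => j x; rewrite npairK.
by apply: eopen_ext => j x; rewrite (lt_big _ (f (unpair j).1 ^~ x)) ?ltry.
Qed.

Lemma lsc_if (b : nat -> bool) f g : computable b -> lsc f -> lsc g ->
  lsc (fun n x => if b n then f n x else g n x).
Proof.
move=> hb [f1 f2] [g1 g2]; split=> [n x|]; first by case: ifP.
have hb' : computable (fun j => b (unpair j).1) by computable.
have := @eopen_if (fun j => b (unpair j).1) _ _ hb' f2 g2.
by apply: eopen_ext => j x; case: ifP.
Qed.

(** With a finite summand, [main] subtracts it twice to place [p1] and then [p2]. If both summands
    are infinite, a rational above [c] and zero will do. *)
Lemma lte_add_split (a b c : \bar R) : a != -oo%E -> b != -oo%E -> (c < a + b)%E ->
  exists p1 p2, [/\ ((qnum p1)%:E < a)%E, ((qnum p2)%:E < b)%E &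
    (c < (qnum p1 + qnum p2)%:E)%E].
Proof.
have main (a' b' : \bar R) : a' != -oo%E -> b' \is a fin_num -> (c < a' + b')%E ->
    exists p1 p2, [/\ ((qnum p1)%:E < a')%E, ((qnum p2)%:E < b')%E &
    (c < (qnum p1 + qnum p2)%:E)%E].
  move=> a0 bf; rewrite -lteBlDr// => /lte_qnum[p1 [h1 h1']].
  move: h1; rewrite lteBlDr// addeC -lteBlDr// => /lte_qnum[p2 [h2 h2']].
  exists p1, p2; split=> //.
  by move: h2; rewrite lteBlDr// -EFinD addrC.
case: b => [b||] a0 b0 hc //; first exact: main.
case: a a0 hc => [a||] a0 hc //.
  have [|p2 [p1 [h2 h1 h]]] := @main +oo%E a%:E isT isT; first by rewrite addeC.
  by exists p1, p2; rewrite addrC.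
have [p1 [hp1 _]] : exists p1, (c < (qnum p1)%:E /\ (qnum p1)%:E < +oo)%E.
  exact: lte_qnum.
by exists p1, (qnat 0); rewrite !ltry qnum_nat addr0.
Qed.

Lemma lsc_add f g : lsc f -> lsc g -> lsc (fun n x => (f n x + g n x)%E).
Proof.
move=> hf hg; have [f1 _] := hf; have [g1 _] := hg.
apply: (@lsc_binary f g _ (fun n q p1 p2 => qle q (qadd p1 p2))) => //.
- by apply: sig_dec; apply: computable_qle2; computable.
- by move=> n x; rewrite adde_eq_ninfty negb_or f1 g1.
move=> n x q; split=> [/(lte_add_split (f1 n x) (g1 n x))[p1 [p2 [h1 h2 h]]]|].
  by exists p1, p2; split=> //; rewrite (qleE R) qnum_add ltW// -lte_fin.
move=> [p1 [p2 []]]; rewrite (qleE R) qnum_add -lee_fin => h h1 h2.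
by apply: (le_lt_trans h); rewrite EFinD lteD.
Qed.

Definition qsum (l N : nat) : nat :=
  nat_rect (fun=> nat) (qnat 0) (fun i r => qadd r (elt l i)) N.

Lemma qnum_sum l N : qnum (qsum l N) = \sum_(i < N) qnum (elt l i).
Proof.
elim: N => [|N IH]; first by rewrite big_ord0 qnum_nat.
by rewrite big_ord_recr /= -IH qnum_add.
Qed.

Lemma lte_sum_split (u : nat -> \bar R) N (c : \bar R) : (forall i, u i != -oo%E) ->
  (c < \sum_(i < N) u i)%E -> exists p : nat -> nat,
    (forall i, (i < N)%N -> ((qnum (p i))%:E < u i)%E) /\
    (c < (\sum_(i < N) qnum (p i))%:E)%E.
Proof.
move=> u0; elim: N c => [|N IH] c; first by rewrite big_ord0 => c0; exists (fun=> 0%N); rewrite big_ord0.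
rewrite big_ord_recr /=; move=> /lte_add_split[||p1 [p2 [h1 h2 h]]] //.
  by elim/big_ind: _ => // a b a0 b0; rewrite adde_eq_ninfty negb_or a0.
have [p [hp hc]] := IH _ h1.
exists (fun i => if (i < N)%N then p i else p2); split=> [i|].
  by rewrite ltnS leq_eqVlt => /orP[/eqP->|iN]; rewrite ?ltnn ?iN//; exact: hp.
apply: (lt_trans h); rewrite big_ord_recr /= ltnn lte_fin ltrD2r -lte_fin.
by rewrite (eq_bigr (fun i : 'I_N => qnum (p i))) // => i _; rewrite ltn_ord.
Qed.

(** The number of summands varies with [n], so the rational lower bounds of the summands are
    quantified together as one sequence code. *)
Lemma lsc_sum (f : nat -> nat -> T -> \bar R) g : computable g ->
  lsc (fun n => f (unpair n).1 (unpair n).2) ->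
  lsc (fun n x => (\sum_(i < g n) f n i x)%E).
Proof.
move=> hg hf; have f1 n i x : f n i x != -oo%E.
  by have := hf.1 (npair n i) x; rewrite npairK.
split=> [n x|].
  by elim/big_ind: _ => // a b a0 b0; rewrite adde_eq_ninfty negb_or a0.
pose U j l x := qlt (unpair j).2 (qsum l (g (unpair j).1)) /\
  forall i, (i < g (unpair j).1)%N -> ((qnum (elt l i))%:E < f (unpair j).1 i x)%E.
have : eopen (fun j x => exists l, U j l x).
  apply: eopen_bigcup; apply: eopen_and.
    apply: eopen_sig; apply: sig_dec; apply: computable_qlt2; first by computable.
    have := @computable_rec (fun=> qnat 0) (fun j => g (unpair (unpair j).1).1)
      (fun j i r => qadd r (elt (unpair j).2 i)).
    by apply; computable.
  have hg' : computable (fun j => g (unpair (unpair j).1).1) by computable.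
  apply: (@eopen_forall (fun j i x =>
    ((qnum (elt (unpair j).2 i))%:E < f (unpair (unpair j).1).1 i x)%E) _ hg').
  have := lsc_gt (h := fun k => npair (unpair (unpair (unpair k).1).1).1 (unpair k).2)
    (k := fun k => elt (unpair (unpair k).1).2 (unpair k).2)
    ltac:(computable) ltac:(computable) hf.
  by apply: eopen_ext => k x; rewrite npairK.
apply: eopen_ext => j x; split=> [[l []]|].
  rewrite (qltE R) qnum_sum -lte_fin => h hl; apply: (lt_le_trans h).
  rewrite -sumEFin; apply: lee_sum => i _; exact/ltW/hl.
move=> /(@lte_sum_split (f (unpair j).1 ^~ x))[//|p [hp h]]; have [l hl] := eltP p (g (unpair j).1).
exists l; split=> [|i ig]; last by rewrite hl// hp.
by rewrite (qltE R) qnum_sum -lte_fin (eq_bigr (fun i : 'I__ => qnum (p i)))// => i _;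
  rewrite hl.
Qed.

Lemma lsc_scale c f : computable c -> (forall n, 0 < qnum (c n)) -> lsc f ->
  lsc (fun n x => ((qnum (c n))%:E * f n x)%E).
Proof.
move=> hc c0 hf.
apply: (@lsc_unary f _ (fun n q p => qle q (qmul (c n) p))) => //.
- by apply: sig_dec; apply: computable_qle2; computable.
- move=> n x; have := hf.1 n x; case: (f n x) => // _.
  by rewrite gt0_muley ?lte_fin.
move=> n x q; split.
  have -> : (qnum q)%:E = ((qnum (c n))%:E * (qnum q / qnum (c n))%:E)%E.
    by rewrite -EFinM mulrC divfK// gt_eqF.
  rewrite lte_pmul2l ?lte_fin// => /lte_qnum[p [/ltW qp pf]]; exists p; split=> //.
  by rewrite (qleE R) qnum_mul mulrC -ler_pdivrMr// -lee_fin.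
move=> [p []]; rewrite (qleE R) qnum_mul -lee_fin EFinM => qp pf.
by apply: (le_lt_trans qp); rewrite lte_pmul2l ?lte_fin.
Qed.

(** Squaring is monotone on nonnegative rationals only, hence the two cases of the test; a negative
    threshold is always exceeded. *)
Lemma lsc_sq f : (forall n x, (0 <= f n x)%E) -> lsc f ->
  lsc (fun n x => (f n x * f n x)%E).
Proof.
move=> f0 hf.
apply: (@lsc_unary f _ (fun n q p => qlt q (qnat 0) \/
  (qle (qnat 0) p && qle q (qmul p p)))) => //.
- apply: sig_or; apply: sig_dec; first by apply: computable_qlt2; computable.
  by apply: computable_and; apply: computable_qle2; computable.
- by move=> n x; rewrite -ltNye (lt_le_trans ltNy0)// mule_ge0.
move=> n x q; have [q0|q0] := ltP (qnum q) 0; split.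
- move=> _; have [p hp] := qnum_lt (0 : R); exists p; split.
    by left; rewrite (qltE R) qnum_nat.
  by rewrite (lt_le_trans _ (f0 n x))// lte_fin.
- by move=> _; rewrite (@lt_le_trans _ _ 0%E)// ?lte_fin// mule_ge0.
- move=> qf; have : ((Num.sqrt (qnum q))%:E < f n x)%E.
    rewrite ltNge; apply/negP => fq; move: qf; rewrite ltNge => /negP; apply.
    by rewrite -[in leRHS](sqr_sqrtr q0) expr2 EFinM lee_pmul.
  move=> /lte_qnum[p [h1 h2]]; exists p; split=> //; right.
  rewrite !(qleE R) qnum_nat qnum_mul; move: h1; rewrite lte_fin => h1.
  rewrite (ltW (le_lt_trans (sqrtr_ge0 _) h1)) /=.
  by rewrite -(sqr_sqrtr q0) expr2 ler_pM// ?sqrtr_ge0// ltW.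
- move=> [p [[|/andP[]]]]; first by rewrite (qltE R) qnum_nat ltNge q0.
  rewrite !(qleE R) qnum_nat qnum_mul -2!lee_fin => p0 qp pf; apply: (le_lt_trans qp).
  rewrite EFinM; have f1 : (0 < f n x)%E by exact: le_lt_trans pf.
  case: (f n x) f1 pf => [r||] //= r0 pf; last by rewrite mulyy ltry.
  rewrite -EFinM lte_fin ltr_pM// -?lte_fin// -?lee_fin//.
Qed.

(** The root is described by its square, which covers the value [+oo] and also L2 norms, known
    through the integral of a square. *)
Lemma lsc_sqrt f h : (forall n x, (0 <= h n x)%E) ->
  (forall n x, f n x = (h n x * h n x)%E) -> lsc f -> lsc h.
Proof.
move=> h0 fh hf.
apply: (@lsc_unary f _ (fun n q p => qlt q (qnat 0) && qlt p (qnat 0) \/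
  (qle (qnat 0) q && qle (qmul q q) p))) => //.
- by apply: sig_or; apply: sig_dec; apply: computable_and;
    by [apply: computable_qlt2; computable|apply: computable_qle2; computable].
- by move=> n x; rewrite -ltNye (lt_le_trans ltNy0).
move=> n x q; rewrite !(qltE R) qnum_nat; have [q0|q0] := ltP (qnum q) 0; split.
- move=> _; have [p hp] := qnum_lt (0 : R); exists p; split.
    by left; rewrite (qltE R) qnum_nat.
  by rewrite fh (@lt_le_trans _ _ 0%E)// ?lte_fin// mule_ge0.
- by move=> _; rewrite (lt_le_trans _ (h0 n x))// lte_fin.
- move=> qh; have : ((qnum q * qnum q)%:E < f n x)%E.
    rewrite fh; case: (h n x) qh => [r||] //= qh; last by rewrite mulyy ltry.
    by rewrite -EFinM lte_fin ltr_pM// -lte_fin.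
  move=> /lte_qnum[p [/ltW h1 h2]]; exists p; split=> //; right.
  by rewrite !(qleE R) qnum_nat qnum_mul q0 -lee_fin.
- move=> [p [[|/andP[_]]]]; first by rewrite /=.
  rewrite (qleE R) qnum_mul -lee_fin fh => qp ph; rewrite ltNge; apply/negP => hq.
  have := lt_le_trans (le_lt_trans qp ph) (lee_pmul (h0 n x) (h0 n x) hq hq).
  by rewrite -EFinM ltxx.
Qed.

Lemma lsc_sqN (g : nat -> T -> R) : (forall n x, 0 <= g n x) ->
  lsc (fun n x => (- g n x)%:E) -> lsc (fun n x => (- (g n x * g n x))%:E).
Proof.
move=> g0 hg.
apply: (@lsc_unary _ _ (fun n q p => qle p (qnat 0) && qle q (qopp (qmul p p))) _ hg) => //.
  by apply: sig_dec; apply: computable_and; apply: computable_qle2; computable.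
move=> n x q; split.
  rewrite lte_fin ltrNr => gq.
  have q0 : 0 <= - qnum q by rewrite (le_trans _ (ltW gq))// mulr_ge0.
  have : g n x < Num.sqrt (- qnum q).
    rewrite ltNge; apply/negP => /(fun h => ler_pM (sqrtr_ge0 _) (sqrtr_ge0 _) h h).
    by rewrite -expr2 sqr_sqrtr// leNgt gq.
  rewrite -ltrN2 => /qnum_dense[p /andP[h1 h2]]; exists p; split=> //.
  rewrite !(qleE R) qnum_nat qnum_opp qnum_mul.
  have p0 : qnum p <= 0 by rewrite ltW// (lt_le_trans h2)// oppr_le0.
  rewrite p0 /= lerNr -(sqr_sqrtr q0) expr2 -mulrNN.
  by rewrite ler_pM// ?oppr_ge0// lerNl ltW.
move=> [p []]; rewrite !(qleE R) qnum_nat qnum_opp qnum_mul !lte_fin => /andP[p0 qp] pg.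
apply: (le_lt_trans qp); rewrite ltrN2 -[ltRHS]mulrNN.
by rewrite ltr_pM// ltrNr.
Qed.

Lemma lsc_indic (U : nat -> set T) : eopen U -> lsc (fun n x => (\1_(U n) x)%:E).
Proof.
move=> hU; split=> //.
have : eopen (fun j x => qlt (unpair j).2 (qnat 0) \/
    (qlt (unpair j).2 (qnat 1) /\ U (unpair j).1 x)).
  apply: eopen_or; first by apply: eopen_sig; apply: sig_dec;
    apply: computable_qlt2; computable.
  apply: eopen_and; first by apply: eopen_sig; apply: sig_dec;
    apply: computable_qlt2; computable.
  by apply: (eopen_comp (U := U)) => //; computable.
apply: eopen_ext => j x; rewrite !(qltE R) !qnum_nat indicE lte_fin.
case: (boolP (x \in _)) => xU /=; split.
- by move=> [/lt_trans|[]//]; apply.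
- by move=> ?; right; split=> //; rewrite inE in xU.
- by move=> [//|[_]]; rewrite notin_setE in xU.
- by left.
Qed.

Lemma bicomputable_cst c : computable c -> bicomputable (fun n _ => qnum (c n)).
Proof.
move=> hc; split; first exact: lsc_cst.
have := @lsc_cst (fun n => qopp (c n)) ltac:(computable).
by apply: lsc_ext => n x; rewrite qnum_opp.
Qed.

Lemma bicomputable_ext f g : (forall n x, f n x = g n x) ->
  bicomputable f -> bicomputable g.
Proof.
by move=> fg; have -> // : f = g; apply/funext => n; apply/funext => x.
Qed.

Lemma bicomputable_comp f h : computable h -> bicomputable f ->
  bicomputable (fun n => f (h n)).
Proof. by move=> hh [f1 f2]; split; [exact: lsc_comp f1|exact: lsc_comp f2]. Qed.

Lemma bicomputable_opp f : bicomputable f -> bicomputable (fun n x => - f n x).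
Proof.
by move=> [f1 f2]; split=> //; apply: lsc_ext f1 => n x; rewrite opprK.
Qed.

Lemma bicomputable_add f g : bicomputable f -> bicomputable g ->
  bicomputable (fun n x => f n x + g n x).
Proof.
move=> [f1 f2] [g1 g2]; split; first exact: lsc_add f1 g1.
by apply: lsc_ext (lsc_add f2 g2) => n x; rewrite -EFinD opprD.
Qed.

Lemma bicomputable_max f g : bicomputable f -> bicomputable g ->
  bicomputable (fun n x => Num.max (f n x) (g n x)).
Proof.
move=> [f1 f2] [g1 g2]; split.
  by apply: lsc_ext (lsc_max f1 g1) => n x; rewrite EFin_max.
by apply: lsc_ext (lsc_min f2 g2) => n x; rewrite oppr_max EFin_min.
Qed.

Lemma bicomputable_min f g : bicomputable f -> bicomputable g ->
  bicomputable (fun n x => Num.min (f n x) (g n x)).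
Proof.
move=> [f1 f2] [g1 g2]; split.
  by apply: lsc_ext (lsc_min f1 g1) => n x; rewrite EFin_min.
by apply: lsc_ext (lsc_max f2 g2) => n x; rewrite oppr_min EFin_max.
Qed.

Lemma bicomputable_if (b : nat -> bool) f g : computable b ->
  bicomputable f -> bicomputable g ->
  bicomputable (fun n x => if b n then f n x else g n x).
Proof.
move=> hb [f1 f2] [g1 g2]; split.
  by apply: lsc_ext (lsc_if hb f1 g1) => n x; case: ifP.
by apply: lsc_ext (lsc_if hb f2 g2) => n x; case: ifP.
Qed.

Lemma bicomputable_scale c f : computable c -> (forall n, 0 < qnum (c n)) ->
  bicomputable f -> bicomputable (fun n x => qnum (c n) * f n x).
Proof.
move=> hc c0 [f1 f2]; split.
  by apply: lsc_ext (lsc_scale hc c0 f1) => n x.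
by apply: lsc_ext (lsc_scale hc c0 f2) => n x; rewrite -EFinM mulrN.
Qed.

(** Through the absolute value [max f (- f)], because monotonicity of squares requires a nonnegative
    base. *)
Lemma bicomputable_sq f : bicomputable f -> bicomputable (fun n x => f n x * f n x).
Proof.
move=> hf; have [a1 a2] := bicomputable_max hf (bicomputable_opp hf).
have a0 n x : 0 <= Num.max (f n x) (- f n x) by rewrite le_max oppr_ge0 le_total.
have aE n x : Num.max (f n x) (- f n x) * Num.max (f n x) (- f n x) = f n x * f n x.
  by rewrite /Num.max; case: ifP => //; rewrite mulrNN.
split.
  have a0' n x : (0 <= (Num.max (f n x) (- f n x))%:E)%E by rewrite lee_fin.
  have := lsc_sq a0' a1.
  by apply: lsc_ext => n x; rewrite -EFinM aE.
by have := lsc_sqN a0 a2; apply: lsc_ext => n x; rewrite aE.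
Qed.

Lemma bicomputable_bigmax (f : nat -> nat -> T -> R) g : computable g ->
  bicomputable (fun n => f (unpair n).1 (unpair n).2) ->
  bicomputable (fun n x => \big[Num.max/0]_(i < g n) f n i x).
Proof.
move=> hg [f1 f2].
have lt_big N (u : nat -> R) a :
    (a < \big[Num.max/0]_(i < N) u i) <-> a < 0 \/ exists i, (i < N)%N /\ a < u i.
  split=> [/bigmax_gtP[h|[i _ h]]|[h|[i [iN h]]]]; first by left.
  - by right; exists i; rewrite ltn_ord.
  - by apply/bigmax_gtP; left.
  - by apply/bigmax_gtP; right; exists (Ordinal iN).
have big_lt N (u : nat -> R) a : (\big[Num.max/0]_(i < N) u i < a) <->
    0 < a /\ forall i, (i < N)%N -> u i < a.
  split=> [/bigmax_ltP[a0 h]|[a0 h]]; last by apply/bigmax_ltP; split=> // i _; exact: h.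
  by split=> // i iN; exact: (h (Ordinal iN)).
have hg' : computable (fun j => g (unpair j).1) by computable.
split; split=> //.
  have : eopen (fun j x => qlt (unpair j).2 (qnat 0) \/
     exists i, (i < g (unpair j).1)%N /\
       ((qnum (unpair j).2)%:E < (f (unpair j).1 i x)%:E)%E).
    apply: eopen_or; first by apply: eopen_sig; apply: sig_dec;
      apply: computable_qlt2; computable.
    apply: (@eopen_bigcup (fun j i x => (i < g (unpair j).1)%N /\
       ((qnum (unpair j).2)%:E < (f (unpair j).1 i x)%:E)%E)).
    apply: eopen_and; first by apply: eopen_sig; apply: sig_dec; computable.
    have := lsc_gt (h := fun j => npair (unpair (unpair j).1).1 (unpair j).2)
      (k := fun j => (unpair (unpair j).1).2) ltac:(computable) ltac:(computable) f1.
    by apply: eopen_ext => j x; rewrite npairK.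
  by apply: eopen_ext => j x; rewrite (qltE R) qnum_nat lte_fin
    (lt_big _ (f (unpair j).1 ^~ x)).
have : eopen (fun j x => qlt (unpair j).2 (qnat 0) /\
   forall i, (i < g (unpair j).1)%N ->
     ((qnum (unpair j).2)%:E < (- f (unpair j).1 i x)%:E)%E).
  apply: eopen_and; first by apply: eopen_sig; apply: sig_dec;
    apply: computable_qlt2; computable.
  apply: (@eopen_forall (fun j i x =>
    ((qnum (unpair j).2)%:E < (- f (unpair j).1 i x)%:E)%E) _ hg').
  have := lsc_gt (h := fun j => npair (unpair (unpair j).1).1 (unpair j).2)
    (k := fun j => (unpair (unpair j).1).2) ltac:(computable) ltac:(computable) f2.
  by apply: eopen_ext => j x; rewrite npairK.
apply: eopen_ext => j x; rewrite (qltE R) qnum_nat lte_fin ltrNr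
  (big_lt _ (f (unpair j).1 ^~ x)) oppr_gt0.
by split=> -[q0 h]; split=> // i /h; rewrite ?lte_fin ltrNr.
Qed.

End effective.

(** * Points and balls *)

Definition point_base (n : nat) : set unit := setT.

Lemma effective_point_base : effective_base point_base.
Proof.
exists (fun _ _ => True); split=> //; last by exists 0%N.
by apply: (sig_ext (P := fun n => true)) => //; apply: sig_dec; computable.
Qed.

Section reals.
Variable R : realType.
Local Notation qnum := (qnum R).

Lemma left_ceP (u : nat -> \bar R) : (forall n, u n != -oo%E) ->
  left_ce u <-> lsc point_base (fun n _ => u n).
Proof.
move=> u0; rewrite /left_ce -sigE; split=> [h|[_ [A hA h]]].
  split=> //; exists (fun n => ((qnum (unpair (unpair n).1).2)%:E < u (unpair (unpair n).1).1)%E).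
    by apply: (sig_comp (P := fun n => is_true ((qnum (unpair n).2)%:E < u (unpair n).1)%E)) h _;
      computable.
  move=> n x; split=> [hn|[m]]; last by rewrite npairK => -[].
  by exists 0%N; rewrite npairK.
apply: (sig_ext (P := fun n => exists m, A (npair n m))).
  move=> n; have := h n tt => /= ->; split=> [[m]|[m []]]; last by exists m.
  by exists m.
apply: sig_ex; apply: (sig_comp (P := A)) => //; computable.
Qed.

Lemma computable_reals_fin (u : nat -> \bar R) : computable_reals u ->
  forall n, u n \is a fin_num.
Proof.
move=> [a ha h] n; have := h n 0%N.
by case: (u n) => //=; rewrite ?addNye ?addye.
Qed.

Lemma exp2V_gt0 k : 0 < (2 ^- k : R).
Proof. by rewrite invr_gt0 exprn_gt0. Qed.

Lemma exp2V_lt (e : R) : 0 < e -> exists k, 2 ^- k < e.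
Proof.
move=> e0; have := near_infty_natSinv_expn_lt (PosNum e0) => -[n _ /(_ n (leqnn n))].
by rewrite /= mul1r => h; exists n.
Qed.

(** From a fast approximation, membership in a cut is confirmed at some precision [k]. From the two
    cuts, a rational within [2 ^- k] is found by search. *)
Lemma computable_realsP (u : nat -> R) :
  computable_reals (fun n => (u n)%:E) <-> bicomputable point_base (fun n _ => u n).
Proof.
split=> [[a ha h]|[h1 h2]].
  have {}h n k : `|u n - qnum (a n k)| <= 2 ^- k.
    by have := h n k; rewrite -EFinB abse_EFin lee_fin.
  have hS : sig (fun j => exists k, qlt (qadd (unpair j).2 (qpow2 k)) (a (unpair j).1 k)).
    by apply: sig_ex; apply: sig_dec; apply: computable_qlt2; computable.
  have hS' : sig (fun j => exists k,
      qlt (qadd (unpair j).2 (qpow2 k)) (qopp (a (unpair j).1 k))).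
    by apply: sig_ex; apply: sig_dec; apply: computable_qlt2; computable.
  split; split=> //.
    apply: eopen_ext (eopen_sig effective_point_base hS) => j _.
    rewrite lte_fin; split=> [[k]|].
      rewrite (qltE R) qnum_add qnum_pow2 -ltrBrDr => /lt_le_trans; apply.
      by have := h (unpair j).1 k; rewrite ler_norml lerBlDr => /andP[]; lra.
    rewrite -subr_gt0 => q0; have [k hk] := @exp2V_lt ((u (unpair j).1 - qnum (unpair j).2) / 2)
      ltac:(by rewrite divr_gt0).
    exists k; rewrite (qltE R) qnum_add qnum_pow2.
    by have := h (unpair j).1 k; rewrite ler_norml => /andP[]; lra.
  apply: eopen_ext (eopen_sig effective_point_base hS') => j _.
  rewrite lte_fin; split=> [[k]|].
    rewrite (qltE R) qnum_add qnum_opp qnum_pow2.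
    by have := h (unpair j).1 k; rewrite ler_norml => /andP[]; lra.
  rewrite -subr_gt0 => q0; have [k hk] := @exp2V_lt ((- u (unpair j).1 - qnum (unpair j).2) / 2)
    ltac:(by rewrite divr_gt0).
  exists k; rewrite (qltE R) qnum_add qnum_pow2 qnum_opp.
  by have := h (unpair j).1 k; rewrite ler_norml => /andP[]; lra.
have lsc_sig (v : nat -> R) : lsc point_base (fun n _ => (v n)%:E) ->
    sig (fun n => qnum (unpair n).2 < v (unpair n).1).
  move=> hv; apply/sigE; have /left_ceP : forall n, (v n)%:E != -oo%E by [].
  by move=> /iffRL/(_ hv).
have := lsc_sig _ h1; have := lsc_sig (fun n => - u n) h2 => {h1 h2} h2 h1.
pose P j l := qnum (qadd l (qopp (qpow2 (unpair j).2))) < u (unpair j).1 /\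
  qnum (qopp (qadd l (qpow2 (unpair j).2))) < - u (unpair j).1.
have [|j|a ha h] := @sig_choice P.
- apply: sig_and.
    have := sig_comp h1 (g := fun n => npair (unpair (unpair n).1).1
      (qadd (unpair n).2 (qopp (qpow2 (unpair (unpair n).1).2)))).
    by move=> /(_ ltac:(computable)); apply: sig_ext => n; rewrite npairK.
  have := sig_comp h2 (g := fun n => npair (unpair (unpair n).1).1
    (qopp (qadd (unpair n).2 (qpow2 (unpair (unpair n).1).2)))).
  by move=> /(_ ltac:(computable)); apply: sig_ext => n; rewrite npairK.
- have e0 := exp2V_gt0 (unpair j).2.
  have [|l /andP[l1 l2]] := @qnum_dense R (u (unpair j).1 - 2 ^- (unpair j).2)
    (u (unpair j).1 + 2 ^- (unpair j).2); first by lra.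
  by exists l; rewrite /P !(qnum_add, qnum_opp) !qnum_pow2; split; lra.
exists (fun n k => a (npair n k)); first by computable.
move=> n k; have [] := h (npair n k); rewrite npairK /= !(qnum_add, qnum_opp) !qnum_pow2.
by move=> h1' h2'; rewrite lee_fin ler_norml; apply/andP; split; lra.
Qed.

(** Upper cuts as lower cuts of the negative, so that the closure properties of [lsc] apply. The
    condition excludes the value [+oo]. *)
Definition right_ce (u : nat -> \bar R) : Prop := lsc point_base (fun n _ => (- u n)%E).

Lemma right_ce_comp u h : computable h -> right_ce u -> right_ce (fun n => u (h n)).
Proof. by move=> hh; apply: (lsc_comp (f := fun n _ => (- u n)%E)). Qed.

Lemma right_ce_inf (u : nat -> \bar R) (v : nat -> nat -> \bar R) :
  (forall n m, (u n <= v n m)%E) -> (forall n, u n != +oo%E) ->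
  (forall n (r : R), (u n < r%:E)%E -> exists m, (v n m < r%:E)%E) ->
  right_ce (fun n => v (unpair n).1 (unpair n).2) -> right_ce u.
Proof.
move=> uv u0 vu [_ hv]; split=> [n _|]; first by case: (u n) (u0 n).
pose U j m (x : unit) := ((qnum (unpair j).2)%:E < - v (unpair j).1 m)%E.
have : eopen point_base (fun j x => exists m, U j m x).
  apply: eopen_bigcup.
  have := eopen_comp (g := fun j => npair (npair (unpair (unpair j).1).1 (unpair j).2)
    (unpair (unpair j).1).2) ltac:(computable) hv.
  by apply: eopen_ext => j x; rewrite !npairK.
apply: eopen_ext => j x; rewrite /U; split=> [[m]|].
  by rewrite lteNr => /(le_lt_trans (uv _ _)) h; rewrite lteNr.
by rewrite lteNr => /vu[m hm]; exists m; rewrite lteNr.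
Qed.

End reals.

(** * Fatou's lemma as a source of approximations, and integrals through level sets *)

Section fatou.
Context d (T : measurableType d) (R : realType) (mu : {measure set T -> \bar R}).

(** Fatou's lemma for the lower limit of [F n], which is at least [f] almost everywhere by the last
    assumption on [F]. It shows that good approximations exist before [sig_choice] searches for
    one. *)
Lemma fatou_gt (f : T -> \bar R) (F : nat -> T -> \bar R) (q : \bar R) :
  measurable_fun setT f -> (forall x, 0 <= f x)%E ->
  (forall n, measurable_fun setT (F n)) -> (forall n x, 0 <= F n x)%E ->
  {ae mu, forall x, forall c : R, (c%:E < f x)%E ->
    exists n0, forall n, (n0 <= n)%N -> (c%:E <= F n x)%E} ->
  (q < \int[mu]_x f x)%E ->
  exists n0, forall n, (n0 <= n)%N -> (q < \int[mu]_x F n x)%E.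
Proof.
move=> mf f0 mF F0 fF qf.
have : (q < limn_einf (fun n => \int[mu]_x F n x))%E.
  apply: (lt_le_trans qf); apply: le_trans (fatou _ _ _ _) => //.
  apply: ae_ge0_le_integral => //.
  - move=> x _; rewrite limn_einf_lim; apply: lime_ge; first exact: is_cvg_einfs.
    by apply: nearW => n; apply: le_ereal_inf_tmp => _ [k _ <-].
  - under eq_fun do rewrite limn_einf_lim.
    apply: (emeasurable_fun_cvg (fun n x => einfs (F ^~ x) n)).
      exact: measurable_fun_einfs.
    by move=> x _; exact: is_cvg_einfs.
  apply: filterS fF => x h _; rewrite leNgt; apply/negP => /lte_qnum[k [k1 k2]].
  have [n0 hn] := h _ k2; move: k1; rewrite ltNge => /negP; apply.
  rewrite limn_einf_lim (cvg_lim _ (@cvg_einfs_sup R (F ^~ x)))//.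
  apply: (@le_trans _ _ (einfs (F ^~ x) n0)); last by apply: ereal_sup_ubound; exists n0.
  by apply: le_ereal_inf_tmp => _ [n /= n0n <-]; exact: hn.
rewrite limn_einf_lim (cvg_lim _ (@cvg_einfs_sup R (fun n => \int[mu]_x F n x)%E))//.
move=> /ereal_sup_gt[_ [n0 _ <-] qn]; exists n0 => n n0n; apply: (lt_le_trans qn).
by apply: ereal_inf_lbound; exists n.
Qed.

Local Notation mesh N := ((N.+1%:R^-1 : R)%:E).
Local Notation grid i N := ((i%:R / N.+1%:R : R)%:E).

Definition layer (f : T -> \bar R) (N i : nat) (x : T) : \bar R :=
  ((mesh N) * (\1_[set y | ((grid i.+1 N) < f y)%E] x)%:E)%E.

(** A layer-cake sum: [f] rounded down to mesh [1 / (N + 1)] and cut off at height [N + 1], which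
    takes the square of [N + 1] layers. Its integral is a positive combination of measures of
    superlevel sets, which are open for lower semicomputable [f]. *)
Definition layers (f : T -> \bar R) (N : nat) (x : T) : \bar R :=
  (\sum_(i < N.+1 * N.+1) layer f N i x)%E.

Lemma layerE (f : T -> \bar R) N i x : layer f N i x =
  (if (grid i.+1 N) < f x then (mesh N) else 0)%E.
Proof.
rewrite /layer indicE; case: ifPn => h.
  by rewrite mem_set ?mule1.
by rewrite memNset ?mule0//=; exact/negP.
Qed.

Let grid0 N : (0 <= (mesh N) )%E.
Proof. by rewrite lee_fin invr_ge0. Qed.

Let grid_le N i j : (i <= j)%N ->
  ((grid i N) <= (grid j N) )%E.
Proof. by move=> ij; rewrite lee_fin ler_pM2r ?invr_gt0// ler_nat. Qed.

Let gridS N i : (grid i.+1 N) = ((grid i N) + (mesh N) )%E.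
Proof. by rewrite -addn1 natrD mulrDl mul1r EFinD. Qed.

Lemma layers_ge0 f N x : (0 <= layers f N x)%E.
Proof. by apply: sume_ge0 => i _; rewrite layerE; case: ifP. Qed.

Lemma layers_le (f : T -> \bar R) N x : (0 <= f x)%E -> (layers f N x <= f x)%E.
Proof.
move=> f0; rewrite /layers.
suff main K : (\sum_(i < K) layer f N i x <= mine (f x) (grid K N))%E.
  by have := main (N.+1 * N.+1)%N; rewrite le_min => /andP[].
elim: K => [|K IH]; first by rewrite big_ord0 mul0r le_min f0 lexx.
move: IH; rewrite big_ord_recr /= layerE !le_min => /andP[h1 h2].
case: ifP => [fK|_]; last by rewrite adde0 h1 (le_trans h2)// grid_le.
have h : (\sum_(i < K) layer f N i x + (mesh N) <= (grid K.+1 N))%E.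
  by rewrite gridS leeD2r.
by rewrite h (le_trans h)// ltW.
Qed.

(** Rounding loses at most one mesh; the second alternative is the cut-off at height [N + 1]. *)
Lemma layers_ge (f : T -> \bar R) N x :
  (f x <= layers f N x + (mesh N))%E \/ (N.+1%:R%:E <= layers f N x + (mesh N))%E.
Proof.
rewrite /layers; have all1 K : ((grid K N) < f x)%E ->
    (\sum_(i < K) layer f N i x = (grid K N))%E.
  elim: K => [_|K IH hK]; first by rewrite big_ord0 mul0r.
  by rewrite big_ord_recr /= IH ?(le_lt_trans _ hK) ?grid_le// layerE hK gridS.
suff main K : (f x <= \sum_(i < K) layer f N i x + (mesh N))%E \/
    (grid K N <= \sum_(i < K) layer f N i x + (mesh N))%E.
  by have := main (N.+1 * N.+1)%N; rewrite natrM mulfK// pnatr_eq0.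
elim: K => [|K IH].
  by right; rewrite big_ord0 mul0r add0e grid0.
have [hK|hK] := ltP (grid K.+1 N) (f x).
  by right; rewrite all1// leeDl.
rewrite big_ord_recr /= layerE ltNge hK /= adde0; left.
have [hK'|hK'] := ltP (grid K N) (f x); first by rewrite all1// -gridS hK.
by case: IH => // h; exact: le_trans h.
Qed.

Lemma measurable_layer (f : T -> \bar R) N i :
  measurable_fun setT f -> measurable_fun setT (layer f N i).
Proof.
move=> mf; apply: measurable_funeM.
apply/measurable_EFinP; apply: measurable_indic.
by rewrite -[X in measurable X]setTI; exact: emeasurable_fun_o_infty.
Qed.

Lemma measurable_layers (f : T -> \bar R) N :
  measurable_fun setT f -> measurable_fun setT (layers f N).
Proof. by move=> mf; apply: emeasurable_sum => i; exact: measurable_layer. Qed.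

Lemma integral_layers (f : T -> \bar R) N : measurable_fun setT f ->
  (\int[mu]_x layers f N x = \sum_(i < N.+1 * N.+1) (mesh N) *
     mu [set y | ((grid i.+1 N) < f y)%E])%E.
Proof.
move=> mf; have mU c : measurable [set y | (c < f y)%E].
  by rewrite -[X in measurable X]setTI; exact: emeasurable_fun_o_infty.
rewrite ge0_integral_sum//; last 2 first.
- by move=> i; exact: measurable_layer.
- by move=> i x _; rewrite layerE; case: ifP.
apply: eq_bigr => i _; rewrite ge0_integralZl//.
  by rewrite integral_indic// setIT.
by apply/measurable_EFinP; exact: measurable_indic.
Qed.

Lemma integral_gt_layers f (q : \bar R) : measurable_fun setT f -> (forall x, 0 <= f x)%E ->
  (q < \int[mu]_x f x)%E <-> exists N, (q < \int[mu]_x layers f N x)%E.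
Proof.
move=> mf f0; split=> [qf|[N]]; last first.
  move=> /lt_le_trans; apply; apply: ge0_le_integral => // [x _||x _].
  - exact: layers_ge0.
  - exact: measurable_layers.
  - exact: layers_le.
have [|||n0 /(_ n0 (leqnn _)) h] := @fatou_gt f (layers f) q mf f0 _ _ _ qf.
- by move=> n; exact: measurable_layers.
- by move=> n x; exact: layers_ge0.
- apply: aeW => x c cf; have [e e0 he] : exists2 e : R, 0 < e & ((c + e)%:E < f x)%E.
    move/lte_qnum: cf => [k [k1 k2]]; exists (qnum R k - c); last by rewrite addrC subrK.
    by rewrite subr_gt0 -lte_fin.
  have [m _ hm] := near_infty_natSinv_lt (PosNum e0).
  have [p hp] : exists p, c + e <= p%:R.
    by have [k hk] := qnum_gt (c + e); exists k; rewrite (le_trans (ltW hk)) ?qnum_le.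
  exists (maxn m p) => N; rewrite geq_max => /andP[mN pN].
  have [] := layers_ge f N x; rewrite -leeBlDr//; apply: le_trans; rewrite leeBrDr//.
    by rewrite (le_trans _ (ltW he))// lee_fin lerD2l ltW//; exact: hm.
  rewrite lee_fin (@le_trans _ _ (c + e))//; first by rewrite lerD2l ltW//; exact: hm.
  by rewrite (le_trans hp)// ler_nat ltnW.
by exists n0.
Qed.

End fatou.

(** * Open sets, distances and integrals on a computable Polish space *)

Section polish.
Variables (R : realType) (X : completeMetricType R) (s : nat -> X).
Local Notation qnum := (qnum R).
Local Notation posqnum := (posqnum R).

Definition ball_base (n : nat) : set X := ball (s (unpair n).1) (posqnum (unpair n).2).

Lemma ball_baseE n x : ball_base n x = (mdist (s (unpair n).1) x < posqnum (unpair n).2) :> Prop.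
Proof. by rewrite /ball_base ballEmdist. Qed.

Lemma ceopenE e x : ceopen s e x <-> exists m, W e m /\ ball_base m x.
Proof. by split=> [[m]|[m []]]; exists m. Qed.

Lemma eopen_ceopen : eopen ball_base (ceopen s).
Proof.
exists (fun n => W (unpair n).1 (unpair n).2); first exact: sig_W.
by move=> n x; rewrite ceopenE; split=> -[m h]; exists m; move: h; rewrite npairK.
Qed.

Lemma eopen_index U : eopen ball_base U ->
  exists2 h, computable h & forall n, U n = ceopen s (h n).
Proof.
move=> [A /smn[h hh hA] hU]; exists h => // n; apply/seteqP; split=> x.
  by rewrite hU => -[m [Am Bm]]; apply/ceopenE; exists m; rewrite hA.
by move=> /ceopenE[m []]; rewrite hA hU => Am Bm; exists m.
Qed.

Lemma lsc_seqP (f : nat -> X -> \bar R) : lsc_seq s f <-> lsc ball_base f.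
Proof.
split=> [[f0 [h hh fh]]|[f0 hf]]; split=> //.
  have := eopen_comp (g := fun j => h (unpair j).1 (unpair j).2) hh eopen_ceopen.
  by apply: eopen_ext => j x; rewrite -fh.
have [h hh hE] := eopen_index hf.
exists (fun n k => h (npair n k)); first by computable.
by move=> n k; rewrite -hE; apply/seteqP; split=> x /=; rewrite npairK.
Qed.

Lemma metric_ball_open (x : X) (e : R) : open (ball x e).
Proof.
rewrite openE => y; rewrite ballEmdist /= => xy; apply/nbhs_ballP.
exists (e - mdist x y) => [|z]; first by rewrite /= subr_gt0.
rewrite !ballEmdist /= => yz; rewrite (le_lt_trans (metric_triangle _ y _))//.
by rewrite addrC -ltrBrDr.
Qed.

Lemma eopen_open U n : eopen ball_base U -> open [set x | U n x].
Proof.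
move=> [A hA hU]; rewrite (_ : mkset _ = \bigcup_(m in [set m | A (npair n m)]) ball_base m).
  by apply: bigcup_open => m _; exact: metric_ball_open.
by apply/seteqP; split=> x; [move=> /hU[m [? ?]]; exists m|move=> [m ? ?]; apply/hU; exists m].
Qed.

Lemma open_measurable_borel (U : set X) : open U -> measurable (U : set (Borel X)).
Proof. by move=> oU; exact: sub_sigma_algebra. Qed.

Lemma measurable_ceopen e : measurable (ceopen s e : set (Borel X)).
Proof. by apply: open_measurable_borel; exact: eopen_open eopen_ceopen. Qed.

Lemma lsc_measurable (f : nat -> X -> \bar R) n : lsc ball_base f ->
  measurable_fun setT (f n : Borel X -> \bar R).
Proof.
move=> [f0 hf]; apply: (measurability _ (ErealGenOInfty.measurableE R)) => //.
move=> _ [_ [r ->] <-]; rewrite setTI.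
rewrite (_ : _ @^-1` _ = \bigcup_(k in [set k | r <= qnum k]) [set x | ((qnum k)%:E < f n x)%E]).
  apply: bigcup_measurable => k _; apply: open_measurable_borel.
  by have := eopen_open (npair n k) hf; rewrite npairK.
apply/seteqP; split=> x /=.
  rewrite in_itv /= andbT => /lte_qnum[k [/ltW k1 k2]]; exists k.
  by move: k1; rewrite lee_fin.
  exact: k2.
move=> [k /= rk kf]; rewrite in_itv /= andbT; apply: le_lt_trans kf.
by rewrite lee_fin.
Qed.

Lemma bicomputable_measurable (g : nat -> X -> R) n : bicomputable ball_base g ->
  measurable_fun setT (fun x : Borel X => (g n x)%:E).
Proof. by move=> [h _]; exact: lsc_measurable h. Qed.

Hypothesis hX : computable_polish s.

Lemma sig_dist_lt : sig (fun j => mdist (s (unpair (unpair j).1).1) (s (unpair (unpair j).1).2)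
  < qnum (unpair j).2) /\
  sig (fun j => qnum (unpair j).2 <
  mdist (s (unpair (unpair j).1).1) (s (unpair (unpair j).1).2)).
Proof.
have [_ /computable_realsP[h1 h2]] := hX.
have /(left_ceP (u := fun n => (- mdist (s (unpair n).1) (s (unpair n).2))%:E)) := h2.
move=> /(_ (fun=> isT)); have /left_ceP := h1.
move=> /(_ (fun=> isT)); rewrite /left_ce -!sigE => {}h1 {}h2; split=> //.
have := sig_comp h2 (g := fun j => npair (unpair j).1 (qopp (unpair j).2)).
move=> /(_ ltac:(computable)); apply: sig_ext => j.
by rewrite /= npairK /= qnum_opp lte_fin ltrN2.
Qed.

Lemma dense_near (x : X) (e : R) : 0 < e -> exists i, mdist (s i) x < e.
Proof.
move=> e0; have [hd _] := hX.
have [y [xy [i _ iy]]] := hd (ball x e) (ex_intro _ x (ballxx x e0)) (metric_ball_open x e).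
by exists i; move: xy; rewrite -iy ballEmdist /= metric_sym.
Qed.

(** Formal inclusion of balls: the distance of the centres plus the inner radius is less than the
    outer radius. The rationals [a] and [b] separate the c.e. part of this condition from the
    decidable ones. *)
Lemma effective_ball_base : effective_base ball_base.
Proof.
exists (fun k l => exists a b, [/\ mdist (s (unpair k).1) (s (unpair l).1) < qnum a,
  qle b (posq (unpair l).2) & qlt (qadd a (posq (unpair k).2)) b]).
split.
- apply: sig_ex; apply: sig_ex.
  apply: (sig_ext (P := fun n =>
    mdist (s (unpair (unpair (unpair (unpair n).1).1).1).1)
          (s (unpair (unpair (unpair (unpair n).1).1).2).1)
      < qnum (unpair (unpair n).1).2 /\
    (qle (unpair n).2 (posq (unpair (unpair (unpair (unpair n).1).1).2).2) /\
    qlt (qadd (unpair (unpair n).1).2 (posq (unpair (unpair (unpair (unpair n).1).1).1).2))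
      (unpair n).2))).
    by move=> n; split=> [[? [? ?]]|[? ? ?]].
  apply: sig_and.
    have := sig_comp sig_dist_lt.1 (g := fun n => npair (npair
      (unpair (unpair (unpair (unpair n).1).1).1).1
      (unpair (unpair (unpair (unpair n).1).1).2).1) (unpair (unpair n).1).2).
    by move=> /(_ ltac:(computable)); apply: sig_ext => n; rewrite !npairK.
  by apply: sig_and; apply: sig_dec; [apply: computable_qle2|apply: computable_qlt2];
    computable.
- move=> k l x [a [b [h1 h2 h3]]]; rewrite !ball_baseE => kx.
  move: h2 h3; rewrite (qleE R) (qltE R) qnum_add !qnum_posq => h2 h3.
  rewrite (le_lt_trans (metric_triangle _ (s (unpair k).1) _))// metric_sym; lra.
move=> x m K hm.
(* A margin common to all the balls. It has to pay twice for the new ball of radius [p < e]: for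
   moving the centre away from [x], and for the radius. *)
have [e e0 he] : exists2 e : R, 0 < e & forall i, (i < K)%N ->
    mdist (s (unpair (m i)).1) x + 2 * e < posqnum (unpair (m i)).2.
  elim: K hm => [|K IH] hm; first by exists 1.
  have [|e e0 he] := IH; first by move=> i iK; apply: hm; rewrite ltnW.
  have := hm K (ltnSn K); rewrite ball_baseE => hK.
  pose d := posqnum (unpair (m K)).2 - mdist (s (unpair (m K)).1) x.
  have d0 : 0 < d by rewrite subr_gt0.
  exists (Num.min e (d / 3)); first by rewrite lt_min e0 divr_gt0.
  move=> i; rewrite ltnS leq_eqVlt => /orP[/eqP->|iK].
    have : Num.min e (d / 3) <= d / 3 by rewrite ge_min lexx orbT.
    by rewrite /d; lra.
  apply: le_lt_trans (he _ iK); rewrite lerD2l ler_pM2l//.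
  by rewrite ge_min lexx.
have [p /andP[p0 pe]] := qnum_dense e0.
have [j hj] := @dense_near x (qnum p) p0.
exists (npair j (qpos p)); split; first by rewrite ball_baseE npairK posqnum_pos.
move=> i iK; rewrite npairK /=.
have h1 : mdist (s j) (s (unpair (m i)).1) < qnum p + mdist (s (unpair (m i)).1) x.
  rewrite (le_lt_trans (metric_triangle _ x _))// [mdist x _]metric_sym.
  by rewrite ltrD2r.
have /qnum_dense[a /andP[a1 a2]] : mdist (s j) (s (unpair (m i)).1) <
  posqnum (unpair (m i)).2 - qnum p by have := he i iK; lra.
exists a, (posq (unpair (m i)).2); split=> //; first by rewrite (qleE R).
by rewrite (qltE R) qnum_add !qnum_posq posqnum_pos//; lra.
Qed.
#[local] Hint Resolve effective_ball_base : core.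

(** A sublevel set is a single ball. A superlevel set is the union of the balls whose centre is
    farther than the threshold by more than their radius. *)
Lemma bicomputable_dist : bicomputable ball_base (fun i x => mdist (s i) x).
Proof.
split; split=> //.
  pose A j m := exists a, qlt (unpair j).2 (qadd a (qopp (posq (unpair m).2))) /\
    qnum a < mdist (s (unpair j).1) (s (unpair m).1).
  exists (fun n => A (unpair n).1 (unpair n).2).
    apply: sig_ex; apply: sig_and; first by apply: sig_dec; apply: computable_qlt2; computable.
    have := sig_comp sig_dist_lt.2 (g := fun n => npair (npair
      (unpair (unpair (unpair n).1).1).1
      (unpair (unpair (unpair n).1).2).1) (unpair n).2).
    by move=> /(_ ltac:(computable)); apply: sig_ext => n; rewrite !npairK.
  move=> j x; rewrite lte_fin; split=> [h|[m]].
    have /qnum_dense[p /andP[p0 hp]] :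
      0 < (mdist (s (unpair j).1) x - qnum (unpair j).2) / 3.
      by rewrite divr_gt0// subr_gt0.
    have [i hi] := @dense_near x (qnum p) p0.
    exists (npair i (qpos p)); split; last by rewrite ball_baseE npairK posqnum_pos.
    have := metric_triangle (s (unpair j).1) (s i) x => tr.
    have /qnum_dense[a /andP[a1 a2]] : qnum (unpair j).2 + qnum p <
      mdist (s (unpair j).1) (s i) by lra.
    rewrite npairK; exists a; rewrite npairK; split=> //.
    by rewrite (qltE R) qnum_add qnum_opp qnum_posq posqnum_pos//=; lra.
  rewrite npairK ball_baseE => -[[a []]].
  rewrite (qltE R) qnum_add qnum_opp qnum_posq /= => h1 h2 h3.
  have := metric_triangle (s (unpair j).1) x (s (unpair m).1).
  by rewrite [mdist x _]metric_sym; lra.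
pose A j m := qlt (unpair j).2 (qnat 0) && (m == npair (unpair j).1 (qpos (qopp (unpair j).2))).
exists (fun n => A (unpair n).1 (unpair n).2).
  by apply: sig_dec; apply: computable_and; first (by apply: computable_qlt2; computable);
    computable.
move=> j x; rewrite lte_fin ltrNr; split=> [h|[m]].
  have q0 : 0 < - qnum (unpair j).2 by rewrite (le_lt_trans _ h)// mdist_ge0.
  exists (npair (unpair j).1 (qpos (qopp (unpair j).2))); rewrite npairK /A.
  by rewrite ball_baseE npairK posqnum_pos ?qnum_opp// eqxx (qltE R) qnum_nat -oppr_gt0 q0.
rewrite npairK /A /= (qltE R) qnum_nat => -[/andP[q0 /eqP->]].
by rewrite ball_baseE npairK posqnum_pos ?qnum_opp ?oppr_gt0.
Qed.

(* Over the trivial base this is about the measure nu, over the ball base about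
   the kernels rho n. *)
Lemma lsc_integral (T : Type) (B : nat -> set T) (hB : effective_base B)
  (mu : nat -> T -> {measure set (Borel X) -> \bar R}) (f : nat -> X -> \bar R) :
  lsc B (fun j t => mu (unpair j).1 t (ceopen s (unpair j).2)) ->
  lsc ball_base f -> (forall n x, 0 <= f n x)%E ->
  lsc B (fun n t => \int[mu n t]_x f n x)%E.
Proof.
move=> hmu hf f0.
(* The superlevel sets that enter [layers], with [k] coding [((n, N), i)]. *)
pose U k (x : X) : Prop := ((qnum (qmul (qnat (unpair k).2.+1) (qinv (unpair (unpair k).1).2)))%:E <
  f (unpair (unpair k).1).1 x)%E.
have [h hh hU] : exists2 h, computable h & forall k, U k = ceopen s (h k).
  by apply: eopen_index; apply: lsc_gt => //; computable.
pose term n N i t := ((qnum (qinv N))%:E * mu n t (ceopen s (h (npair (npair n N) i))))%E.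
have hterm : lsc B (fun n t =>
    (\sum_(i < (unpair n).2.+1 * (unpair n).2.+1) term (unpair n).1 (unpair n).2 i t)%E).
  apply: (@lsc_sum _ _ _ hB (fun n i t => term (unpair n).1 (unpair n).2 i t)); first by computable.
  apply: (@lsc_scale _ _ _ hB (fun n => qinv (unpair (unpair n).1).2)); first by computable.
    by move=> n; rewrite qnum_inv invr_gt0.
  have := lsc_comp (h := fun n => npair (unpair (unpair n).1).1
    (h (npair (npair (unpair (unpair n).1).1 (unpair (unpair n).1).2) (unpair n).2))) _ hmu.
  by move=> /(_ ltac:(computable)); apply: lsc_ext => n t; rewrite !npairK.
have := @lsc_sup _ _ _ (fun n N t =>
  (\sum_(i < N.+1 * N.+1) term n N i t)%E) hterm.
apply: lsc_ext => n t; apply: qnum_ext => k.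
have mf : measurable_fun setT (f n : Borel X -> \bar R) by exact: lsc_measurable.
rewrite integral_gt_layers//.
have termE N : (\sum_(i < N.+1 * N.+1) term n N i t = \int[mu n t]_x @layers _ (Borel X) R (f n) N x)%E.
  rewrite integral_layers//; apply: eq_bigr => i _; rewrite /term qnum_inv -hU /U.
  congr (_ * mu n t _)%E; apply/seteqP.
  by split=> x /=; rewrite !npairK /= qnum_mul qnum_nat qnum_inv.
split=> [/ereal_sup_gt[_ [N _ <-]] /=|[N]]; first by rewrite termE; exists N.
by move=> /lt_le_trans; apply; apply: ereal_sup_ubound; exists N => //=; rewrite termE.
Qed.

End polish.

Section approximation.
Variables (R : realType) (X : completeMetricType R) (s : nat -> X).
Hypothesis hX : computable_polish s.
Local Notation qnum := (qnum R).

(* Maxima of finitely many Lipschitz bumps below f. *)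
Lemma lsc_approx (f : nat -> X -> \bar R) :
  lsc (ball_base s) f -> (forall n x, 0 <= f n x)%E ->
  exists g : nat -> nat -> X -> R,
  [/\ bicomputable (ball_base s) (fun n => g (unpair n).1 (unpair n).2),
      forall n j x, 0 <= g n j x <= j%:R,
      forall n i j x, (i <= j)%N -> g n i x <= g n j x,
      forall n j x, ((g n j x)%:E <= f n x)%E &
      forall n x (c : R), (c%:E < f n x)%E -> exists j, c < g n j x].
Proof.
move=> [_ [A [D hD hAD] hA]] f0; have hB := effective_ball_base hX.
(* An index [w] codes [((k, m), (t, p))]: at stage [t] the ball [m] is recognized as part of the set
   where [f n] exceeds [qnum k], and [p.+1] is the slope of the bump supported on this ball. *)
pose center v := (unpair (unpair (unpair v).1).2).1.
pose bump (v : nat) (x : X) : R :=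
  (qnum (qnat (unpair (unpair v).2).2.+1)) *
    Num.max (qnum (posq (unpair (unpair (unpair v).1).2).2) - mdist (s (center v)) x)
            (qnum (qnat 0)).
(* The cap by the index [w] itself yields the bound [g n j x <= j]. *)
pose theta n w (x : X) : R :=
  if D (npair (npair (npair n (unpair (unpair w).1).1) (unpair (unpair w).1).2)
          (unpair (unpair w).2).1) == 0%N
  then Num.min (Num.min (Num.max (qnum (unpair (unpair w).1).1) (qnum (qnat 0)))
                        (qnum (qnat w))) (bump w x)
  else qnum (qnat 0).
pose g n j x := \big[Num.max/0]_(w < j) theta n w x.
have bump0 v x : 0 <= bump v x.
  by rewrite /bump !qnum_nat mulr_ge0// le_max lexx orbT.
have theta0 n w x : 0 <= theta n w x.
  rewrite /theta !qnum_nat; case: ifP => // _.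
  by rewrite !le_min bump0 le_max lexx orbT ler0n.
have theta_f n w x : ((theta n w x)%:E <= f n x)%E.
  rewrite /theta !qnum_nat; case: ifP => [/eqP Dw|_]; last exact: f0.
  set k := (unpair _).1 in Dw *; set m := (unpair _).2 in Dw *.
  have [xm|xm] := ltP (mdist (s (unpair m).1) x) (posqnum R (unpair m).2).
    have : ((qnum k)%:E < f n x)%E.
      have := hA (npair n k) x; rewrite npairK /= => ->; exists m; split.
        by apply/hAD; exists (unpair (unpair w).2).1.
      by rewrite ball_baseE.
    move=> kf; apply: (@le_trans _ _ (Num.max (qnum k) 0)%:E).
      by rewrite lee_fin !ge_min lexx.
    by rewrite EFin_max ge_max f0 ltW.
  apply: (@le_trans _ _ 0%E) => //; rewrite lee_fin ge_min; apply/orP; right.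
  rewrite /bump qnum_posq /center -/m max_r ?mulr0 ?qnum_nat//.
  by rewrite ?mulr0 // subr_le0.
exists g; split.
- apply: (@bicomputable_bigmax _ _ _ hB (fun n w => theta (unpair n).1 w)); first by computable.
  apply: bicomputable_if => //; [by computable| |]; last first.
    by apply: bicomputable_cst => //; computable.
  apply: bicomputable_min => //.
    apply: bicomputable_min => //; last by apply: bicomputable_cst => //; computable.
    apply: bicomputable_max => //; apply: bicomputable_cst => //; computable.
  rewrite /bump; apply: bicomputable_scale => //; first by computable.
    by move=> n; rewrite qnum_nat.
  apply: bicomputable_max => //; last by apply: bicomputable_cst => //; computable.
  apply: bicomputable_add => //; first by apply: bicomputable_cst => //; computable.
  apply: bicomputable_opp.
  apply: (@bicomputable_comp _ _ _ (fun i x => mdist (s i) x)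
    (fun v => center (unpair v).2)) (bicomputable_dist hX).
  by rewrite /center; computable.
- move=> n j x; rewrite bigmax_ge_id /=; apply: bigmax_le => // w _.
  rewrite /theta !qnum_nat; case: ifP => // _.
  by rewrite !ge_min ler_nat ltnW ?orbT.
- move=> n i j x ij; exact: (@le_bigmax_ord _ _ 0 i j xpredT (fun w => theta n w x) ij).
- move=> n j x; rewrite /g; elim/big_ind: _ => //.
  by move=> a b ha hb; rewrite EFin_max ge_max ha.
move=> n x c cf; have [c0|c0] := ltP c 0; first by exists 0%N; rewrite /g big_ord0.
have [k [ck kf]] := lte_qnum cf.
have := hA (npair n k) x; rewrite npairK /= => /iffLR/(_ kf)[m [/hAD[t Dt]]].
rewrite ball_baseE => xm.
have d0 : 0 < posqnum R (unpair m).2 - mdist (s (unpair m).1) x by rewrite subr_gt0.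
(* A slope steep enough for the bump to exceed [qnum k] at [x]. *)
have [p hp] := qnum_gt (qnum k / (posqnum R (unpair m).2 - mdist (s (unpair m).1) x)).
pose w := npair (npair k m) (npair t p).
exists w.+1; rewrite lte_fin in ck.
apply: (@lt_le_trans _ _ (theta n w x)); last first.
  exact: (le_bigmax _ (fun i : 'I_w.+1 => theta n i x) ord_max).
rewrite /theta /bump /center /w !npairK Dt eqxx !qnum_nat qnum_posq -/w.
rewrite !lt_min !lt_max ck /=; apply/andP; split.
  rewrite (lt_le_trans ck)// (le_trans (qnum_le _ _))// ler_nat /w.
  by rewrite (leq_trans (leq_npair1 k m))// leq_npair1.
rewrite max_l ?ltW// (lt_le_trans ck)// -ler_pdivrMr//.
rewrite (le_trans (ltW hp))// (le_trans (qnum_le _ _))// ler_nat.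
exact: leqnSn.
Qed.

End approximation.

(** * Square-integrable functions and Doob's inequality *)

Local Notation dist a b := (`|a - b|%E).

Section ereal_ineq.
Variable R : realType.
Implicit Types a b c : \bar R.
Local Open Scope ereal_scope.

Lemma le_1_sqe a : 0 <= a -> a <= 1 + a * a.
Proof.
case: a => [a||]// a0.
by rewrite -EFinM -?EFinD lee_fin; nra.
Qed.

Lemma mule_le_sq a b : 0 <= a -> 0 <= b -> a * b <= a * a + b * b.
Proof.
case: a b => [a||]// [b||]// a0 b0; rewrite ?mulyy ?addey ?addye ?leey//.
by rewrite -?EFinM -?EFinD lee_fin; nra.
Qed.

Lemma sqe_max a b : 0 <= a -> 0 <= b -> maxe a b * maxe a b <= a * a + b * b.
Proof.
move=> a0 b0; rewrite /maxe; case: ifP => _.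
  by rewrite leeDr// mule_ge0.
by rewrite leeDl// mule_ge0.
Qed.

Lemma sqe_dist a b : 0 <= a -> 0 <= b -> dist a b * dist a b <= a * a + b * b.
Proof.
case: a b => [a||]// [b||]// a0 b0; rewrite /= ?mulyy ?addey ?addye ?leey//.
rewrite -?EFinM -?EFinD lee_fin -expr2 real_normK ?num_real//.
by rewrite !lee_fin in a0 b0; nra.
Qed.

Lemma lee_dist a b : 0 <= a -> 0 <= b -> a <= dist a b + b.
Proof.
case: a b => [a||]// [b||]// a0 b0; rewrite /= ?addey ?addye ?leey//.
by rewrite -?EFinD lee_fin -lerBlDr ler_norm.
Qed.

Lemma diste_sym a b : 0 <= a -> 0 <= b -> dist a b = dist b a.
Proof. by case: a b => [a||]// [b||]// a0 b0; rewrite -!EFinB !abse_EFin distrC. Qed.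

Lemma dist_le a b c : a \is a fin_num -> b \is a fin_num ->
  a <= c + b -> b <= c + a -> dist a b <= c.
Proof.
case: a b c => [a||]// [b||]// [c||]// _ _; rewrite ?leey// -?EFinB ?abse_EFin -?EFinD !lee_fin.
by move=> h1 h2; rewrite ler_norml; lra.
Qed.

Lemma sqe_dist_eq a b : 0 <= a -> 0 <= b -> a \is a fin_num -> b \is a fin_num ->
  dist a b * dist a b + (a * b + a * b) = a * a + b * b.
Proof.
case: a b => [a||]// [b||]// _ _ _ _.
rewrite -EFinB abse_EFin -?EFinM -?EFinD -expr2 real_normK ?num_real//; congr (_%:E); ring.
Qed.

(** Young's inequality with a factor close to 1 on the main term [a], paid for by a large factor on
    the error [b]. The difference of the two sides is a square divided by [p.+1]. *)
Lemma sqeD_le a b (p : nat) : 0 <= a -> 0 <= b -> (a + b) * (a + b) <=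
  (1 + p.+1%:R^-1)%:E * (a * a) + (1 + p.+1%:R)%:E * (b * b).
Proof.
have p0 : (0 < p.+1%:R :> R)%R by rewrite ltr0n.
have q0 : (0 < 1 + p.+1%:R :> R)%R by rewrite addr_gt0.
have r0 : (0 < 1 + p.+1%:R^-1 :> R)%R by rewrite addr_gt0 ?invr_gt0.
case: a b => [a||]// [b||]// a0 b0.
- rewrite -?EFinD -?EFinM lee_fin.
  have -> : ((1 + p.+1%:R^-1) * (a * a) + (1 + p.+1%:R) * (b * b) = (a + b) * (a + b) +
    (p.+1%:R * b - a) * (p.+1%:R * b - a) / p.+1%:R)%R by field; rewrite gt_eqF.
  by rewrite lerDl; apply: divr_ge0; [rewrite -expr2 sqr_ge0|exact: ltW].
- by rewrite mulyy [X in _ <= _ + X]gt0_muley ?lte_fin// addey ?leey// gt_eqF ?ltNyr.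
- by rewrite mulyy [X in _ <= X + _]gt0_muley ?lte_fin// addye ?leey// gt_eqF ?ltNyr.
- by rewrite !mulyy !gt0_muley ?lte_fin// leey.
Qed.

Lemma mule4_le a b : 0 <= a -> 0 <= b ->
  (a * b + a * b) + (a * b + a * b) <= a * a + ((b * b + b * b) + (b * b + b * b)).
Proof.
case: a b => [a||]// [b||]// a0 b0; rewrite ?mulyy ?addey ?addye ?leey//.
by rewrite -?EFinM -?EFinD lee_fin; have := sqr_ge0 (a - (b + b))%R; rewrite expr2; nra.
Qed.

Definition runmax (y : nat -> \bar R) (n : nat) : \bar R :=
  nat_rect (fun=> \bar R) (y 0%N) (fun i r => maxe r (y i.+1)) n.

Lemma runmax_ge0 y n : (forall i, 0 <= y i) -> 0 <= runmax y n.
Proof. by move=> y0; elim: n => //= n IH; rewrite le_max IH. Qed.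

Lemma runmax_ub y n i : (i <= n)%N -> y i <= runmax y n.
Proof.
elim: n => [|n IH] /=; first by rewrite leqn0 => /eqP->.
rewrite leq_eqVlt => /orP[/eqP->|]; first by rewrite le_max lexx orbT.
by rewrite ltnS => /IH h; rewrite le_max h.
Qed.

Lemma runmax_lub y n c : (forall i, (i <= n)%N -> y i <= c) -> runmax y n <= c.
Proof.
elim: n => [|n IH] h /=; first exact: h.
by rewrite ge_max h// andbT IH// => i ni; rewrite h// ltnW.
Qed.

(* Summation by parts, with both sides arranged so that no subtraction occurs. *)
Lemma doob_pathwise y N : (forall i, 0 <= y i) ->
  runmax y N * runmax y N + \sum_(n < N) (runmax y n * y n.+1 + runmax y n * y n.+1)
  <= (runmax y N * y N + runmax y N * y N) +
     \sum_(n < N) (runmax y n * y n + runmax y n * y n).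
Proof.
move=> y0; have s0 n : 0 <= runmax y n by exact: runmax_ge0.
(* An infinite [y i] makes the right-hand side infinite, through its own term or through the sum. *)
have [yfin|] := pselect (forall i, (i <= N)%N -> y i \is a fin_num); last first.
  move=> /existsNP[i /not_implyP[iN yi]].
  have {}yi : y i = +oo by move: yi (y0 i); case: (y i).
  have si : runmax y i = +oo by apply/eqP; rewrite -leye_eq -yi runmax_ub.
  have ti n : 0 <= runmax y n * y n + runmax y n * y n by rewrite adde_ge0// mule_ge0.
  have S0 : 0 <= \sum_(n < N) (runmax y n * y n + runmax y n * y n).
    by apply: sume_ge0 => n _.
  rewrite [leRHS](_ : _ = +oo) ?leey//; apply/eqP; rewrite -leye_eq.
  have sy : runmax y i * y i + runmax y i * y i = +oo by rewrite si yi mulyy addey.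
  move: iN; rewrite leq_eqVlt => /orP[/eqP iN|iN].
    by rewrite iN in sy; rewrite sy addye// -ltNye (lt_le_trans _ S0).
  rewrite (bigD1 (Ordinal iN)) //= sy addye ?addey//.
    by rewrite -ltNye (lt_le_trans ltNy0)// ti.
  by rewrite -ltNye (lt_le_trans ltNy0)// sume_ge0.
have {yfin} [z hz] : exists z : nat -> R, forall i, (i <= N)%N -> y i = (z i)%:E.
  by exists (fine \o y) => i iN /=; rewrite fineK ?yfin.
pose r n : R := nat_rect (fun=> R) (z 0%N) (fun i t => Num.max t (z i.+1)) n.
have hr n : (n <= N)%N -> runmax y n = (r n)%:E.
  elim: n => [|n IH] nN /=; first exact: hz.
  by rewrite IH ?hz// 1?ltnW// /r /= EFin_max.
suff main n : (n <= N)%N -> runmax y n * runmax y n +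
   \sum_(i < n) (runmax y i * y i.+1 + runmax y i * y i.+1)
  <= (runmax y n * y n + runmax y n * y n) +
     \sum_(i < n) (runmax y i * y i + runmax y i * y i) by exact: main.
move=> nN; rewrite !hr// !hz//.
under eq_bigr => i _.
  have iN : (i < N)%N by rewrite (leq_trans (ltn_ord i)).
  rewrite hr 1?ltnW// hz// -EFinM -EFinD; over.
under [X in _ <= _ + X]eq_bigr => i _.
  have iN : (i <= N)%N by rewrite ltnW// (leq_trans (ltn_ord i)).
  rewrite hr// hz// -EFinM -EFinD; over.
rewrite !sumEFin -?EFinM -?EFinD lee_fin; elim: n nN => [|n IH] nN.
  by rewrite !big_ord0 /r /=; nra.
have := IH (ltnW nN); rewrite !big_ord_recr /=.
set S := (\sum_(i < n) _)%R; set S' := (\sum_(i < n) _)%R.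
(* If the maximum rises from [r n] to [z n.+1], the slack is the square of the rise; otherwise the
   goal is the induction hypothesis. *)
rewrite -/(r n) /Num.max; case: ifP => [rz|_]; last by lra.
by have := ltW rz; nra.
Qed.

End ereal_ineq.

(* Restated so that they also apply when the measurable type is displayed as a
   reverse coercion, where the class Filter is not found. *)
Lemma ae_mono d (T : measurableType d) (R : realType) (mu : {measure set T -> \bar R})
  (P Q : T -> Prop) : (forall x, P x -> Q x) ->
  {ae mu, forall x, P x} -> {ae mu, forall x, Q x}.
Proof. by move=> PQ; apply: filterS. Qed.

Lemma ae_and d (T : measurableType d) (R : realType) (mu : {measure set T -> \bar R})
  (P Q : T -> Prop) : {ae mu, forall x, P x} -> {ae mu, forall x, Q x} ->
  {ae mu, forall x, P x /\ Q x}.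
Proof. by move=> hP hQ; apply: filterI. Qed.

(** * Nonnegative square-integrable functions *)

Section l2.
Context d (T : measurableType d) (R : realType) (mu : probability T R).
Local Open Scope ereal_scope.
Implicit Types f g : T -> \bar R.

Definition sq f (x : T) : \bar R := f x * f x.

Definition l2 f : Prop :=
  [/\ measurable_fun setT f, forall x, 0 <= f x & \int[mu]_x sq f x < +oo].

Lemma sq_ge0 f x : (forall x, 0 <= f x) -> 0 <= sq f x.
Proof. by move=> f0; rewrite /sq mule_ge0. Qed.

Lemma measurable_sq f : measurable_fun setT f -> measurable_fun setT (sq f).
Proof. by move=> mf; apply: emeasurable_funM. Qed.

Lemma ge0_le_int f g : measurable_fun setT f -> measurable_fun setT g ->
  (forall x, 0 <= f x) -> (forall x, f x <= g x) -> \int[mu]_x f x <= \int[mu]_x g x.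
Proof. by move=> mf mg f0 fg; apply: ge0_le_integral. Qed.

Lemma ge0_integrable f : measurable_fun setT f -> (forall x, 0 <= f x) ->
  \int[mu]_x f x < +oo -> mu.-integrable setT f.
Proof.
move=> mf f0 foo; apply/integrableP; split=> //.
by rewrite (eq_integral f)// => x _; rewrite gee0_abs.
Qed.

Lemma integral_cst1 : \int[mu]_x (1 : \bar R) = 1.
Proof. by rewrite (integral_cst mu measurableT 1) mul1e; exact: probability_setT. Qed.

Lemma l2_int f : l2 f -> \int[mu]_x f x <= 1 + \int[mu]_x sq f x.
Proof.
move=> [mf f0 foo]; rewrite -integral_cst1 -ge0_integralD//; last 2 first.
- by move=> x _; exact: sq_ge0.
- exact: measurable_sq.
apply: ge0_le_int => //; last by move=> x; exact: le_1_sqe.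
by apply: emeasurable_funD => //; exact: measurable_sq.
Qed.

Lemma l2_integrable f : l2 f -> mu.-integrable setT f.
Proof.
move=> hf; have [mf f0 foo] := hf; apply: ge0_integrable => //.
by rewrite (le_lt_trans (l2_int hf))// lte_add_pinfty// ltry.
Qed.

Lemma l2_le f g h : l2 f -> l2 g -> measurable_fun setT h -> (forall x, 0 <= h x) ->
  (forall x, h x <= sq f x + sq g x) -> \int[mu]_x h x < +oo.
Proof.
move=> [mf f0 foo] [mg g0 goo] mh h0 hfg.
apply: (@le_lt_trans _ _ (\int[mu]_x (sq f x + sq g x))).
  by apply: ge0_le_int => //; apply: emeasurable_funD; exact: measurable_sq.
rewrite ge0_integralD//; first exact: lte_add_pinfty.
- by move=> x _; exact: sq_ge0.
- exact: measurable_sq.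
- by move=> x _; exact: sq_ge0.
- exact: measurable_sq.
Qed.

Lemma l2_mul f g : l2 f -> l2 g -> \int[mu]_x (f x * g x) < +oo.
Proof.
move=> hf hg; have [mf f0 foo] := hf; have [mg g0 goo] := hg.
apply: (l2_le hf hg) => //.
- exact: emeasurable_funM.
- by move=> x; rewrite mule_ge0.
- by move=> x; exact: mule_le_sq.
Qed.

Lemma l2_max f g : l2 f -> l2 g -> l2 (fun x => maxe (f x) (g x)).
Proof.
move=> hf hg; have [mf f0 foo] := hf; have [mg g0 goo] := hg.
have mm : measurable_fun setT (fun x => maxe (f x) (g x)) by exact: measurable_maxe.
have m0 x : 0 <= maxe (f x) (g x) by rewrite le_max f0.
split=> //; apply: (l2_le hf hg); first exact: measurable_sq.
  by move=> x; exact: sq_ge0.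
by move=> x; exact: sqe_max.
Qed.

Lemma measurable_dist f g : measurable_fun setT f -> measurable_fun setT g ->
  measurable_fun setT (fun x => dist (f x) (g x)).
Proof. by move=> mf mg; apply: measurableT_comp => //; exact: emeasurable_funB. Qed.

Lemma l2_dist f g : l2 f -> l2 g -> l2 (fun x => dist (f x) (g x)).
Proof.
move=> hf hg; have [mf f0 foo] := hf; have [mg g0 goo] := hg.
have md := measurable_dist mf mg.
split=> //; apply: (l2_le hf hg); first exact: measurable_sq.
  by move=> x; rewrite /sq mule_ge0.
by move=> x; exact: sqe_dist.
Qed.

Lemma l2_runmax (y : nat -> T -> \bar R) n : (forall i, l2 (y i)) ->
  l2 (fun x => runmax (y ^~ x) n).
Proof. by move=> hy; elim: n => [|n IH] /=; [exact: hy|exact: l2_max]. Qed.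

Lemma l2_ae_fin f : l2 f -> {ae mu, forall x, f x \is a fin_num}.
Proof.
move=> /l2_integrable hf; apply: filterS (integrable_ae measurableT hf).
by move=> x; exact.
Qed.

Lemma l2_fin f : l2 f -> \int[mu]_x sq f x \is a fin_num.
Proof.
move=> [mf f0 foo]; rewrite ge0_fin_numE//; apply: integral_ge0 => x _.
exact: sq_ge0.
Qed.

Ltac ge0_meas := solve [intros; repeat first [done | assumption | exact: sq_ge0 |
  apply: measurable_sq | apply: adde_ge0 | apply: mule_ge0 | (apply: sume_ge0; intros) |
  apply: emeasurable_funD | (apply: emeasurable_sum; intros) | apply: emeasurable_funM]].

(** * Martingales for an abstract family of conditional expectations *)

Section doob.
(** [E n] stands for integration against [rho n], and [ad n] for measurability with respect to
    [F n]. [E_add] and [E_sub] are the two halves of the bound of the distance between [E n Z] and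
    an adapted [Y] by [E n W], when [W] bounds the distance between [Z] and [Y]; they avoid
    subtraction of infinite values. *)
Variables (E : nat -> (T -> \bar R) -> T -> \bar R) (ad : nat -> (T -> \bar R) -> Prop).
Hypothesis adS : forall n Y, ad n Y -> ad n.+1 Y.
Hypothesis ad_max : forall n Y Z, ad n Y -> ad n Z -> ad n (fun x => maxe (Y x) (Z x)).
Hypothesis ad_dist : forall n Y Z, ad n Y -> ad n Z -> ad n (fun x => dist (Y x) (Z x)).
Hypothesis E_meas : forall n Z, l2 Z -> measurable_fun setT (E n Z).
Hypothesis E_ge0 : forall n Z x, l2 Z -> 0 <= E n Z x.
Hypothesis pull_out : forall n Y Z, ad n Y -> l2 Y -> l2 Z ->
  \int[mu]_x (Y x * Z x) = \int[mu]_x (Y x * E n Z x).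
Hypothesis E_add : forall n Y Z W, ad n Y -> l2 Y -> l2 Z -> l2 W ->
  (forall x, Z x <= W x + Y x) -> {ae mu, forall x, E n Z x <= E n W x + Y x}.
Hypothesis E_sub : forall n Y Z W, ad n Y -> l2 Y -> l2 Z -> l2 W ->
  (forall x, Y x <= W x + Z x) -> {ae mu, forall x, Y x <= E n W x + E n Z x}.

Lemma ad_leq n m Y : (n <= m)%N -> ad n Y -> ad m Y.
Proof.
move=> /subnK <-; elim: (m - n)%N => // k IH h.
by rewrite addSn; apply: adS; exact: IH.
Qed.

Lemma integral_dbl f : measurable_fun setT f -> (forall x, 0 <= f x) ->
  \int[mu]_x (f x + f x) = \int[mu]_x f x + \int[mu]_x f x.
Proof. by move=> mf f0; rewrite ge0_integralD. Qed.

(** Integrate [doob_pathwise]. By [pull_out] and the submartingale property the two sums compare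
    term by term, and being finite they cancel, which leaves twice the integral of [S N * y N]. Then
    [mule4_le] absorbs half and produces the constant 4. The shift [k] serves for increments of a
    martingale after time [k]. *)
Lemma doob k (y : nat -> T -> \bar R) N :
  (forall n, ad (k + n)%N (y n)) -> (forall n, l2 (y n)) ->
  (forall n, {ae mu, forall x, y n x <= E (k + n)%N (y n.+1) x}) ->
  \int[mu]_x sq (fun x => runmax (y ^~ x) N) x <=
  (\int[mu]_x sq (y N) x + \int[mu]_x sq (y N) x) +
  (\int[mu]_x sq (y N) x + \int[mu]_x sq (y N) x).
Proof.
move=> ady ly suby; have y0 n x : 0 <= y n x by case: (ly n).
have my n : measurable_fun setT (y n) by case: (ly n).
pose S n x := runmax (y ^~ x) n.
have lS n : l2 (S n) by exact: l2_runmax.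
have S0 n x : 0 <= S n x by case: (lS n).
have mS n : measurable_fun setT (S n) by case: (lS n).
have adSm n : ad (k + n)%N (S n).
  elim: n => [|n IH]; first exact: (ady 0%N).
  by apply: ad_max (ady n.+1); rewrite addnS; apply: adS.
have mSy n m : measurable_fun setT (fun x => S n x * y m x) by exact: emeasurable_funM.
have Sy0 n m x : 0 <= S n x * y m x by rewrite mule_ge0.
have le_Sy n : \int[mu]_x (S n x * y n x) <= \int[mu]_x (S n x * y n.+1 x).
  rewrite (pull_out (adSm n) (lS n) (ly n.+1)); apply: ae_ge0_le_integral => //.
  - by move=> x _; rewrite mule_ge0 ?E_ge0.
  - by apply: emeasurable_funM => //; exact: E_meas.
  - by apply: filterS (suby n) => x h _; exact: lee_wpmul2l.
have fin_Sy n m : \int[mu]_x (S n x * y m x) \is a fin_num.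
  by rewrite ge0_fin_numE ?integral_ge0//; exact: l2_mul.
have main : \int[mu]_x sq (S N) x +
     \sum_(n < N) (\int[mu]_x (S n x * y n.+1 x) + \int[mu]_x (S n x * y n.+1 x)) <=
   (\int[mu]_x (S N x * y N x) + \int[mu]_x (S N x * y N x)) +
     \sum_(n < N) (\int[mu]_x (S n x * y n x) + \int[mu]_x (S n x * y n x)).
  under eq_bigr do rewrite -integral_dbl//.
  under [X in _ <= _ + X]eq_bigr do rewrite -integral_dbl//.
  rewrite -integral_dbl// -!ge0_integral_sum//; try ge0_meas.
  rewrite -!ge0_integralD//; try ge0_meas.
  apply: ge0_le_int; try ge0_meas.
  by move=> x; apply: doob_pathwise.
have a2b : \int[mu]_x sq (S N) x <=
    \int[mu]_x (S N x * y N x) + \int[mu]_x (S N x * y N x).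
  rewrite -(@leeD2rE _ (\sum_(n < N)
    (\int[mu]_x (S n x * y n.+1 x) + \int[mu]_x (S n x * y n.+1 x)))); last first.
    by apply/sum_fin_numP => n _ _; rewrite fin_numD !fin_Sy.
  apply: (le_trans main); rewrite leeD2l//; apply: lee_sum => n _.
  by rewrite leeD.
have b4 : (\int[mu]_x (S N x * y N x) + \int[mu]_x (S N x * y N x)) +
   (\int[mu]_x (S N x * y N x) + \int[mu]_x (S N x * y N x)) <=
   \int[mu]_x sq (S N) x + ((\int[mu]_x sq (y N) x + \int[mu]_x sq (y N) x) +
  (\int[mu]_x sq (y N) x + \int[mu]_x sq (y N) x)).
  have msy := measurable_sq (my N); have sy0 x := sq_ge0 x (y0 N).
  rewrite -!integral_dbl//; try ge0_meas.
  rewrite -ge0_integralD//; try ge0_meas.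
  apply: ge0_le_int; try ge0_meas.
  by move=> x; exact: mule4_le.
have := le_trans (leeD a2b a2b) b4.
by rewrite leeD2lE// l2_fin.
Qed.

Section martingale.
Variable M : nat -> T -> \bar R.
Hypothesis adM : forall n, ad n (M n).
Hypothesis l2M : forall n, l2 (M n).
Hypothesis martM : forall n, {ae mu, forall x, M n x = E n (M n.+1) x}.

Let M0 n x : 0 <= M n x. Proof. by case: (l2M n). Qed.
Let mM n : measurable_fun setT (M n). Proof. by case: (l2M n). Qed.

Lemma martingale_orth n m : (n <= m)%N ->
  \int[mu]_x (M n x * M m x) = \int[mu]_x sq (M n) x.
Proof.
move=> /subnK <-; elim: (m - n)%N => // k IH; rewrite addSn -IH.
have adn : ad (k + n) (M n) by apply: ad_leq (adM n); rewrite leq_addl.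
rewrite (pull_out adn (l2M n) (l2M _)); apply: ge0_ae_eq_integral => //.
- by apply: emeasurable_funM => //; exact: E_meas.
- exact: emeasurable_funM.
- by move=> x _; rewrite mule_ge0 ?E_ge0.
- by move=> x _; rewrite mule_ge0.
- by apply: filterS (martM (k + n)) => x <-.
Qed.

(** Pythagoras for martingales: the cross term is evaluated by [martingale_orth] and cancelled as a
    finite number. *)
Lemma martingale_dist n m : (n <= m)%N ->
  \int[mu]_x sq (fun x => dist (M m x) (M n x)) x + \int[mu]_x sq (M n) x =
  \int[mu]_x sq (M m) x.
Proof.
move=> nm; have fn := l2_fin (l2M n); have fm := l2_fin (l2M m).
have md := measurable_dist (mM m) (mM n).
have mMM : measurable_fun setT (fun x => M m x * M n x) by exact: emeasurable_funM.
have : \int[mu]_x (sq (fun x => dist (M m x) (M n x)) x + (M m x * M n x + M m x * M n x)) =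
    \int[mu]_x (sq (M m) x + sq (M n) x).
  apply: ge0_ae_eq_integral => //.
  - by apply: emeasurable_funD; [exact: measurable_sq|exact: emeasurable_funD].
  - by apply: emeasurable_funD; exact: measurable_sq.
  - by move=> x _; rewrite !adde_ge0 ?mule_ge0.
  - by move=> x _; rewrite adde_ge0 ?sq_ge0.
  - apply: filterS2 (l2_ae_fin (l2M m)) (l2_ae_fin (l2M n)) => x h1 h2 _.
    exact: sqe_dist_eq.
rewrite !ge0_integralD//; try ge0_meas.
under [X in _ + (X + _)]eq_integral do rewrite muleC.
under [X in _ + (_ + X)]eq_integral do rewrite muleC.
rewrite martingale_orth// addeA => h.
by rewrite -[LHS](addeK _ fn) h addeK.
Qed.

(** Doob's inequality for the submartingale of distances to [M n]; by [martingale_dist] its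
    right-hand side is four times the growth of the squared norm. *)
Lemma martingale_maximal n N :
  \int[mu]_x sq (fun x => runmax (fun i => dist (M (n + i)%N x) (M n x)) N) x +
  (\int[mu]_x sq (M n) x + \int[mu]_x sq (M n) x +
   (\int[mu]_x sq (M n) x + \int[mu]_x sq (M n) x)) <=
  \int[mu]_x sq (M (n + N)%N) x + \int[mu]_x sq (M (n + N)%N) x +
   (\int[mu]_x sq (M (n + N)%N) x + \int[mu]_x sq (M (n + N)%N) x).
Proof.
rewrite -(@martingale_dist n (n + N)) ?leq_addr//.
set D := \int[mu]_x sq (fun x => dist (M (n + N)%N x) (M n x)) x; set A := \int[mu]_x sq (M n) x.
rewrite [leRHS](_ : _ = D + D + (D + D) + (A + A + (A + A))); last first.
  by rewrite [D + A + _]addeACA [D + D + _ + _]addeACA.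
rewrite leeD2r//; apply: (@doob n (fun i x => dist (M (n + i)%N x) (M n x))).
- by move=> i; apply: ad_dist => //; apply: ad_leq (adM n); rewrite leq_addr.
- by move=> i; exact: l2_dist.
move=> i; have adn : ad (n + i) (M n) by apply: ad_leq (adM n); rewrite leq_addr.
have ld := l2_dist (l2M (n + i.+1)) (l2M n).
have h1 := E_add adn (l2M n) (l2M (n + i.+1)) ld
  (fun x => lee_dist (M0 (n + i.+1) x) (M0 n x)).
have h2' x : M n x <= dist (M (n + i.+1)%N x) (M n x) + M (n + i.+1)%N x.
  by rewrite diste_sym//; exact: lee_dist.
have h2 := E_sub adn (l2M n) (l2M (n + i.+1)) ld h2'.
have hm := martM (n + i).
have f1 := l2_ae_fin (l2M (n + i)); have f2 := l2_ae_fin (l2M n).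
apply: filterS2 (filterI h1 h2) (filterI hm (filterI f1 f2)).
move=> x [x1 x2] [xm [xf1 xf2]]; rewrite addnS in x1 x2 *.
by apply: dist_le => //; rewrite xm.
Qed.

End martingale.
End doob.
End l2.

(** * Disintegrations as conditional expectations *)

Section disintegration.
Variables (R : realType) (X : completeMetricType R) (s : nat -> X).
Variable nu : probability (Borel X) R.
Variables (F : nat -> set (set X)) (rho : nat -> R.-ftker Borel X ~> Borel X).
Hypothesis hF : almost_full_filtration s nu F.
Hypothesis hrho : disintegrations s nu (KR s nu) F rho.
Local Open Scope ereal_scope.

Lemma measurable_bexpr (b : nat -> nat) t :
  measurable (bexpr_set (fun i => ceopen s (b i)) t : set (Borel X)).
Proof.
elim: t => [i|t IH|t IHt u IHu] /=; first exact: measurable_ceopen.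
- exact: measurableC.
- exact: measurableU.
Qed.

Lemma filtration_gen : exists A : nat -> nat -> set X,
  [/\ forall n m, measurable (A n m : set (Borel X)),
      forall n, F n = <<s range (A n) >> &
      forall e x, KR s nu x -> ceopen s e x -> exists n m, A n m x /\
        forall y, KR s nu y -> A n m y -> ceopen s e y].
Proof.
have [_ [b [a [A [_ [_ hA] FA [h _ hh]]]]]] := hF.
exists A; split=> //.
  by move=> n m; have [t _ ->] := hA n m; exact: measurable_bexpr.
move=> e x Kx ex; have /seteqP[/(_ x (conj ex Kx))] := hh e.
move=> [[k Wk Ax] _] sub; exists (unpair k).1, (unpair k).2; split=> // y Ky Ay.
by have [] := sub y; [split=> //; exists k|].
Qed.

Lemma sigma_filtration n : <<s F n >> = F n.
Proof. by have [A [_ -> _]] := filtration_gen; exact: sigma_algebra_id. Qed.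

Lemma filtration_measurable n (A : set X) : F n A -> measurable (A : set (Borel X)).
Proof.
have [B [mB -> _]] := filtration_gen; apply: smallest_sub.
  by split=> [|C|C]; [exact: measurable0|rewrite setTD; exact: measurableC|
    exact: bigcupT_measurable].
by move=> _ [m _ <-].
Qed.

Lemma filtrationT n : F n setT.
Proof.
rewrite -sigma_filtration; have := @measurableT _ (g_sigma_algebraType (F n)).
exact.
Qed.

Lemma filtration_leq n m : (n <= m)%N -> F n `<=` F m.
Proof.
move=> /subnK <-; elim: (m - n)%N => // k IH A /IH.
by have [h _] := hF; rewrite addSn; exact: h.
Qed.

Lemma adapted_preimage n (Y : X -> \bar R) (C : set (\bar R)) :
  measurable_wrt (F n) Y -> measurable C -> F n (Y @^-1` C).
Proof.
move=> mY mC; have := mY measurableT C mC; rewrite setTI => h.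
by rewrite -sigma_filtration; exact: h.
Qed.

Lemma adapted_measurable n (Y : X -> \bar R) : measurable_wrt (F n) Y ->
  measurable_fun setT (Y : Borel X -> \bar R).
Proof.
move=> mY _ C mC; rewrite setTI; apply: (@filtration_measurable n).
exact: adapted_preimage.
Qed.

Lemma adapted_leq n m (Y : X -> \bar R) : (n <= m)%N ->
  measurable_wrt (F n) Y -> measurable_wrt (F m) Y.
Proof.
move=> nm mY _ C mC; rewrite setTI; apply: sub_sigma_algebra.
by apply: (filtration_leq nm); exact: adapted_preimage.
Qed.

Lemma adapted_max n (Y Z : X -> \bar R) : measurable_wrt (F n) Y ->
  measurable_wrt (F n) Z -> measurable_wrt (F n) (fun x => maxe (Y x) (Z x)).
Proof. exact: measurable_maxe. Qed.

Lemma adapted_dist n (Y Z : X -> \bar R) : measurable_wrt (F n) Y ->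
  measurable_wrt (F n) Z -> measurable_wrt (F n) (fun x => dist (Y x) (Z x)).
Proof. exact: measurable_dist. Qed.

Lemma measurable_KR : measurable (KR s nu : set (Borel X)).
Proof.
rewrite (_ : KR s nu = \bigcap_(e in [set e | nu (ceopen s e) = 1]) ceopen s e).
  by apply: bigcap_measurableType => e _; exact: measurable_ceopen.
by apply/seteqP; split=> x h e e1; exact: h.
Qed.

Lemma KR_ae : {ae nu, forall x : Borel X, KR s nu x}.
Proof.
rewrite /almost_everywhere /=; apply: negligibleS (_ : nu.-negligible
  (\bigcup_e (if nu (ceopen s e) == 1 then ~` ceopen s e else set0))).
  move=> x /= /existsNP[e /not_implyP[e1 ex]]; exists e => //.
  by rewrite e1 eqxx.
apply: negligible_bigcup => e; case: ifPn => [/eqP e1|_]; last exact: negligible_set0.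
have mC := measurable_ceopen s e.
exists (~` ceopen s e); split => //; first exact: measurableC.
by have := probability_setC nu mC; rewrite e1 subee.
Qed.

(** Points that no generator separates are separated by no member of the sigma-algebra. Atoms are
    thus countable intersections, hence measurable. *)
Lemma atomE (A : nat -> set X) x : atom <<s range A >> x =
  \bigcap_m (if pselect (A m x) then A m else ~` A m).
Proof.
apply/seteqP; split=> y.
  move=> h m _; have hA : <<s range A >> (A m) by apply: sub_sigma_algebra; exists m.
  by have [yx xy] := h _ hA; case: pselect => /= Ax; [exact: xy|move=> /yx].
move=> h B; pose G := [set B : set X | B y <-> B x].
suff : <<s range A >> `<=` G by exact.
apply: smallest_sub.
  split=> [//|C /= CG|C CG]; first by rewrite setTD; split=> hC /CG.
  by split=> -[i _ Ci]; exists i => //; apply/CG.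
move=> _ [m _ <-]; have := h m I; case: pselect => /= Ax Ay; first by split.
by split=> // /Ay.
Qed.

Lemma measurable_atom n x : measurable (atom (F n) x : set (Borel X)).
Proof.
have [A [mA -> _]] := filtration_gen; rewrite atomE.
apply: bigcapT_measurable => m; case: pselect => _ //=; exact: measurableC.
Qed.

Lemma rho_setT n x : KR s nu x -> rho n x setT = 1.
Proof. by have [_ h _] := hrho => /(h n)[]. Qed.

Lemma rho_atom n x (P : set (Borel X)) : KR s nu x -> (forall y, atom (F n) x y -> KR s nu y -> P y) ->
  {ae rho n x, forall y : Borel X, P y}.
Proof.
move=> Kx hP; have [_ /(_ n x Kx)[r1 r2] _] := hrho.
have mA : measurable (atom (F n) x `&` KR s nu : set (Borel X)).
  by apply: measurableI; [exact: measurable_atom|exact: measurable_KR].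
exists (~` (atom (F n) x `&` KR s nu)); split; first exact: measurableC.
  have fin : rho n x [set: Borel X] < +oo by rewrite r1 ltry.
  have := @measureD _ _ _ (rho n x) [set: Borel X] _ measurableT mA fin.
  by rewrite setTD setTI => ->; rewrite [X in X - _]r1 [X in _ - X]r2 subee.
by move=> y nPy [ya yK]; apply: nPy; exact: hP.
Qed.

(** An adapted function is constant on atoms, and [rho n x] is carried by the atom of [x]. *)
Lemma rho_adapted n x (Y : Borel X -> \bar R) : KR s nu x -> measurable_wrt (F n) Y ->
  {ae rho n x, forall y : Borel X, Y y = Y x}.
Proof.
move=> Kx mY; apply: rho_atom => // y xy _.
have FY : F n (Y @^-1` [set Y x]).
  by apply: adapted_preimage => //; exact: emeasurable_set1.
by have [_ h] := xy _ FY; exact: h.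
Qed.

Definition cond (n : nat) (f : Borel X -> \bar R) (x : Borel X) : \bar R := \int[rho n x]_y f y.

Lemma cond_ge0 n (f : Borel X -> \bar R) x : (forall y, 0 <= f y) -> 0 <= cond n f x.
Proof. by move=> f0; apply: integral_ge0. Qed.

Lemma cond_adapted n (f : Borel X -> \bar R) : nu.-integrable setT f ->
  measurable_wrt (F n) (cond n f).
Proof. by move=> hf; have [/(_ n f hf)[]] := hrho. Qed.

Lemma cond_integrable n (f : Borel X -> \bar R) : nu.-integrable setT f ->
  nu.-integrable setT (cond n f : Borel X -> \bar R).
Proof. by move=> hf; have [/(_ n f hf)[]] := hrho. Qed.

Lemma integral_cond_in n (f : Borel X -> \bar R) A : nu.-integrable setT f -> F n A ->
  \int[nu]_(x in A) cond n f x = \int[nu]_(x in A) f x.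
Proof. by move=> hf FA; have [/(_ n f hf)[_ _ /(_ A FA)]] := hrho. Qed.

Lemma integral_cond n (f : Borel X -> \bar R) : nu.-integrable setT f ->
  \int[nu]_x cond n f x = \int[nu]_x f x.
Proof. by move=> hf; have := integral_cond_in hf (filtrationT n). Qed.

Lemma cond_measurable n (f : Borel X -> \bar R) : nu.-integrable setT f ->
  measurable_fun setT (cond n f : Borel X -> \bar R).
Proof. by move=> hf; exact: (adapted_measurable (@cond_adapted n f hf)). Qed.

Lemma cond_le n (f g : Borel X -> \bar R) x : measurable_fun setT f -> measurable_fun setT g ->
  (forall y, 0 <= f y) -> (forall y, f y <= g y) -> cond n f x <= cond n g x.
Proof. by move=> mf mg f0 fg; apply: ge0_le_integral. Qed.

Lemma cond_cst n x (c : \bar R) : KR s nu x -> cond n (fun=> c) x = c.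
Proof. by move=> Kx; rewrite /cond integral_cst// rho_setT// mule1. Qed.

Lemma condD n (f g : Borel X -> \bar R) x : measurable_fun setT f -> measurable_fun setT g ->
  (forall y, 0 <= f y) -> (forall y, 0 <= g y) ->
  cond n (fun y => f y + g y) x = cond n f x + cond n g x.
Proof. by move=> mf mg f0 g0; rewrite /cond ge0_integralD. Qed.

Lemma cond_eq n x (f g : Borel X -> \bar R) : measurable_fun setT f -> measurable_fun setT g ->
  (forall y, 0 <= f y) -> (forall y, 0 <= g y) ->
  {ae rho n x, forall y, f y = g y} -> cond n f x = cond n g x.
Proof.
move=> mf mg f0 g0 fg; apply: ge0_ae_eq_integral => //.
by apply: (ae_mono _ fg) => y ->.
Qed.

(** Valid at each Kurtz random point and not just almost everywhere, since [Y] is constant up to a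
    null set of [rho n x]. *)
Lemma cond_pull n x (Y : Borel X -> \bar R) (Z : Borel X -> \bar R) : KR s nu x ->
  measurable_wrt (F n) Y -> (forall y, 0 <= Y y) ->
  measurable_fun setT Z -> (forall y, 0 <= Z y) ->
  cond n (fun y => Y y * Z y) x = Y x * cond n Z x.
Proof.
move=> Kx mY Y0 mZ Z0; have mY' := adapted_measurable mY.
rewrite (@cond_eq n x _ (fun y => Y x * Z y)).
- by rewrite /cond ge0_integralZl.
- exact: emeasurable_funM.
- exact: measurable_funeM.
- by move=> y; rewrite mule_ge0.
- by move=> y; rewrite mule_ge0.
- by apply: (ae_mono _ (rho_adapted Kx mY)) => y ->.
Qed.

(** Integrate [2 c Z <= Z^2 + c^2], with [c] the conditional expectation itself. If [c] is infinite,
    [Z <= 1 + Z^2] shows that the right-hand side is infinite too. *)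
Lemma cond_jensen n x (Z : Borel X -> \bar R) : KR s nu x ->
  measurable_fun setT Z -> (forall y, 0 <= Z y) ->
  sq (cond n Z) x <= cond n (sq Z) x.
Proof.
move=> Kx mZ Z0; have c0 := cond_ge0 n x Z0; have msq := measurable_sq mZ.
have sq0 y : 0 <= sq Z y by rewrite mule_ge0.
case hc : (cond n Z x) c0 => [c||]// c0; last first.
  rewrite /sq hc mulyy; have : cond n Z x <= 1 + cond n (sq Z) x.
    rewrite -{1}(cond_cst n 1 Kx) -condD//.
    apply: cond_le => //; first exact: emeasurable_funD.
    by move=> y; exact: le_1_sqe.
  by rewrite hc; case: (cond n (sq Z) x).
have : cond n (fun y => c%:E * Z y + c%:E * Z y) x <= cond n (fun y => sq Z y + c%:E * c%:E) x.
  have mcZ : measurable_fun setT (fun y => c%:E * Z y) by exact: measurable_funeM.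
  apply: cond_le; [exact: emeasurable_funD|exact: emeasurable_funD|..].
    by move=> y; rewrite adde_ge0// mule_ge0.
  move=> y; have := Z0 y; rewrite /sq; case: (Z y) => [z||]// _; last first.
    by rewrite mulyy addye ?leey.
  rewrite -?EFinM -?EFinD lee_fin; have := sqr_ge0 (z - c)%R; rewrite expr2; nra.
have cZ0 y : 0 <= c%:E * Z y by rewrite mule_ge0.
rewrite !condD//; try exact: measurable_funeM; last by move=> _; rewrite mule_ge0.
have cZ : cond n (fun y => c%:E * Z y) x = c%:E * cond n Z x.
  by rewrite /cond ge0_integralZl.
by rewrite cond_cst// cZ /sq hc leeD2rE.
Qed.

Lemma l2_sq_integrable (Z : Borel X -> \bar R) : l2 nu Z -> nu.-integrable setT (sq Z).
Proof.
move=> [mZ Z0 Zoo]; apply: ge0_integrable => //; first exact: measurable_sq.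
by move=> x; exact: sq_ge0.
Qed.

Lemma integral_sq_cond n (Z : Borel X -> \bar R) : l2 nu Z ->
  \int[nu]_x sq (cond n Z) x <= \int[nu]_x sq Z x.
Proof.
move=> hZ; have [mZ Z0 _] := hZ; rewrite -(integral_cond n (l2_sq_integrable hZ)).
have mc := cond_measurable n (l2_integrable hZ).
apply: ae_ge0_le_integral => //.
- by move=> x _; rewrite /sq mule_ge0 ?cond_ge0.
- exact: measurable_sq.
- by move=> x _; apply: cond_ge0 => y; exact: sq_ge0.
- by apply: cond_measurable; exact: l2_sq_integrable.
- by apply: (ae_mono _ KR_ae) => x Kx _; exact: cond_jensen.
Qed.

Lemma l2_cond n (Z : Borel X -> \bar R) : l2 nu Z -> l2 nu (cond n Z).
Proof.
move=> hZ; have [mZ Z0 Zoo] := hZ; split.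
- by apply: cond_measurable; exact: l2_integrable.
- by move=> x; exact: cond_ge0.
- exact: le_lt_trans (integral_sq_cond n hZ) Zoo.
Qed.

Lemma cond_pull_out n (Y Z : Borel X -> \bar R) : measurable_wrt (F n) Y ->
  l2 nu Y -> l2 nu Z -> \int[nu]_x (Y x * Z x) = \int[nu]_x (Y x * cond n Z x).
Proof.
move=> aY hY hZ; have [mY Y0 _] := hY; have [mZ Z0 _] := hZ.
have YZ : nu.-integrable setT (fun x => Y x * Z x).
  apply: ge0_integrable; [exact: emeasurable_funM| |exact: l2_mul].
  by move=> x; rewrite mule_ge0.
rewrite -(integral_cond n YZ); apply: ge0_ae_eq_integral => //.
- exact: cond_measurable.
- apply: emeasurable_funM => //; by apply: cond_measurable; exact: l2_integrable.
- by move=> x _; apply: cond_ge0 => y; rewrite mule_ge0.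
- by move=> x _; rewrite mule_ge0 ?cond_ge0.
- by apply: (ae_mono _ KR_ae) => x Kx _; exact: cond_pull.
Qed.

Lemma cond_adapted_id n x (Y : Borel X -> \bar R) : KR s nu x -> measurable_wrt (F n) Y ->
  (forall y, 0 <= Y y) -> cond n Y x = Y x.
Proof.
move=> Kx aY Y0; rewrite -[RHS](cond_cst n (Y x) Kx); apply: cond_eq => //.
- exact: adapted_measurable aY.
- exact: rho_adapted.
Qed.

Lemma cond_add n (Y Z W : Borel X -> \bar R) : measurable_wrt (F n) Y ->
  l2 nu Y -> l2 nu Z -> l2 nu W -> (forall x, Z x <= W x + Y x) ->
  {ae nu, forall x, cond n Z x <= cond n W x + Y x}.
Proof.
move=> aY [mY Y0 _] [mZ Z0 _] [mW W0 _] h; apply: (ae_mono _ KR_ae) => x Kx.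
rewrite -[X in _ + X](@cond_adapted_id n x Y)// -condD//; apply: cond_le => //.
exact: emeasurable_funD.
Qed.

Lemma cond_sub n (Y Z W : Borel X -> \bar R) : measurable_wrt (F n) Y ->
  l2 nu Y -> l2 nu Z -> l2 nu W -> (forall x, Y x <= W x + Z x) ->
  {ae nu, forall x, Y x <= cond n W x + cond n Z x}.
Proof.
move=> aY [mY Y0 _] [mZ Z0 _] [mW W0 _] h; apply: (ae_mono _ KR_ae) => x Kx.
rewrite -[X in X <= _](@cond_adapted_id n x Y)// -condD//; apply: cond_le => //.
exact: emeasurable_funD.
Qed.

(** On the set [A] where [f < g] the difference is positive but has integral zero. The comparison is
    one-sided, so that subtraction takes place only where [f] is finite. *)
Lemma ae_le_of_integral n (f g : Borel X -> \bar R) :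
  measurable_wrt (F n) f -> measurable_wrt (F n) g ->
  (forall x, 0 <= f x) -> (forall x, 0 <= g x) -> nu.-integrable setT g ->
  (forall A, F n A -> \int[nu]_(x in A) f x = \int[nu]_(x in A) g x) ->
  {ae nu, forall x, g x <= f x}.
Proof.
move=> af ag f0 g0 ig fg; pose A := [set x | f x < g x].
have mf := adapted_measurable af; have mg := adapted_measurable ag.
have FA : F n A.
  have : measurable_fun setT (fun x : g_sigma_algebraType (F n) => f x < g x).
    exact: measurable_fun_lte.
  move=> /(_ measurableT [set true] I); rewrite setTI => h.
  by rewrite -sigma_filtration; apply: h.
have mA := filtration_measurable FA.
have md : measurable_fun A (fun x : Borel X => g x - f x).
  by apply: measurable_funTS; exact: emeasurable_funB.
have d0 x : A x -> 0 < g x - f x by rewrite sube_gt0.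
have ffin x : A x -> f x \is a fin_num.
  by move=> Ax; rewrite ge0_fin_numE// (lt_le_trans Ax)// leey.
have dE : \int[nu]_(x in A) g x =
    \int[nu]_(x in A) f x + \int[nu]_(x in A) (g x - f x).
  rewrite -ge0_integralD//; last 2 first.
  - exact: measurable_funTS.
  - by move=> x Ax; rewrite ltW// d0.
  by apply: eq_integral => x /set_mem Ax; rewrite addeC subeK// ffin.
have igA : \int[nu]_(x in A) g x \is a fin_num.
  by apply: integrable_fin_num => //; exact: integrableS ig.
have [+ _] := ae_eq_integral_abs nu mA md.
have -> : \int[nu]_(x in A) `|g x - f x| = \int[nu]_(x in A) (g x - f x).
  by apply: eq_integral => x /set_mem Ax; rewrite gee0_abs// ltW// d0.
have d00 : \int[nu]_(x in A) (g x - f x) = 0.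
  move: dE; rewrite (fg _ FA) => /(congr1 (fun t => t - \int[nu]_(x in A) g x)).
  by rewrite subee// [X in X - _]addeC addeK.
move=> /(_ d00); apply: ae_mono => x h; rewrite leNgt; apply/negP => Ax.
by have := d0 x Ax; rewrite h// ltxx.
Qed.

(** Both sides have the same integrals over members of [F n], which are members of [F n.+1].
    [potential_martingale] extends the identity to every Schnorr random point. *)
Lemma cond_tower n (Z : Borel X -> \bar R) : l2 nu Z ->
  {ae nu, forall x, cond n Z x = cond n (cond n.+1 Z) x}.
Proof.
move=> hZ; have hZ' := l2_cond n.+1 hZ; have [mZ Z0 _] := hZ.
have iZ := l2_integrable hZ; have iZ' := l2_integrable hZ'.
have a1 := @cond_adapted n _ iZ; have a2 := @cond_adapted n _ iZ'.
have c0 y : 0 <= cond n Z y by exact: cond_ge0.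
have c0' y : 0 <= cond n (cond n.+1 Z) y by apply: cond_ge0 => z; exact: cond_ge0.
have hA A : F n A -> \int[nu]_(x in A) cond n Z x =
    \int[nu]_(x in A) cond n (cond n.+1 Z) x.
  move=> FA; rewrite (integral_cond_in iZ FA) (integral_cond_in iZ' FA).
  by rewrite (integral_cond_in iZ)//; apply: (filtration_leq (leqnSn n)).
have h1 := ae_le_of_integral a1 a2 c0 c0' (cond_integrable n iZ') hA.
have h2 := ae_le_of_integral a2 a1 c0' c0 (cond_integrable n iZ)
  (fun A FA => esym (hA A FA)).
apply: (ae_mono _ (ae_and h1 h2)) => x [le1 le2]; apply/eqP.
by rewrite eq_le le2 le1.
Qed.

Section martingales.
Variable M : nat -> Borel X -> \bar R.
Hypothesis aM : forall n, measurable_wrt (F n) (M n).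
Hypothesis lM : forall n, l2 nu (M n).
Hypothesis mM : forall n, {ae nu, forall x : Borel X, M n x = cond n (M n.+1) x}.

Let ad n (Y : Borel X -> \bar R) := measurable_wrt (F n) Y.

Lemma adapted_dist_le n m : (n <= m)%N ->
  \int[nu]_x sq (fun x : Borel X => dist (M m x) (M n x)) x + \int[nu]_x sq (M n) x =
  \int[nu]_x sq (M m) x.
Proof.
apply: (@martingale_dist _ _ _ _ cond ad) => //.
- by move=> k Y; exact: adapted_leq.
- by move=> k Z hZ; apply: cond_measurable; exact: l2_integrable.
- by move=> k Z x [_ Z0 _]; exact: cond_ge0.
- by move=> k Y Z; exact: cond_pull_out.
Qed.

Lemma adapted_maximal n N :
  \int[nu]_x sq (fun x : Borel X => runmax (fun i => dist (M (n + i)%N x) (M n x)) N) x +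
  (\int[nu]_x sq (M n) x + \int[nu]_x sq (M n) x +
   (\int[nu]_x sq (M n) x + \int[nu]_x sq (M n) x)) <=
  \int[nu]_x sq (M (n + N)%N) x + \int[nu]_x sq (M (n + N)%N) x +
   (\int[nu]_x sq (M (n + N)%N) x + \int[nu]_x sq (M (n + N)%N) x).
Proof.
apply: (@martingale_maximal _ _ _ _ cond ad) => //.
- by move=> k Y; exact: adapted_leq.
- by move=> k Y Z; exact: adapted_max.
- by move=> k Y Z; exact: adapted_dist.
- by move=> k Z hZ; apply: cond_measurable; exact: l2_integrable.
- by move=> k Z x [_ Z0 _]; exact: cond_ge0.
- by move=> k Y Z; exact: cond_pull_out.
- by move=> k Y Z W; exact: cond_add.
- by move=> k Y Z W; exact: cond_sub.
Qed.

Lemma adapted_doob N :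
  \int[nu]_x sq (fun x : Borel X => runmax (M ^~ x) N) x <=
  (\int[nu]_x sq (M N) x + \int[nu]_x sq (M N) x) +
  (\int[nu]_x sq (M N) x + \int[nu]_x sq (M N) x).
Proof.
apply: (@doob _ _ _ _ cond ad _ _ _ _ _ 0%N (fun n x => M n x)) => //.
- by move=> k Y; exact: adapted_leq.
- by move=> k Y Z; exact: adapted_max.
- by move=> k Z hZ; apply: cond_measurable; exact: l2_integrable.
- by move=> k Z x [_ Z0 _]; exact: cond_ge0.
- by move=> k Y Z; exact: cond_pull_out.
- by move=> k; apply: (ae_mono _ (mM k)) => x ->.
Qed.

End martingales.

End disintegration.

(** * Schnorr tests *)

Section real_sequences.
Variable R : realType.
Local Notation qnum := (qnum R).

Lemma computable_reals_ce (u : nat -> \bar R) : (forall n, u n \is a fin_num) ->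
  lsc point_base (fun n _ => u n) -> right_ce u -> computable_reals u.
Proof.
move=> ufin hl hr; have -> : u = fun n => (fine (u n))%:E.
  by apply/funext => n; rewrite fineK.
apply/computable_realsP; split.
  by apply: lsc_ext hl => n _; rewrite fineK.
by apply: lsc_ext hr => n _; rewrite EFinN fineK.
Qed.

Lemma ce_computable_reals (u : nat -> \bar R) : computable_reals u ->
  [/\ forall n, u n \is a fin_num, lsc point_base (fun n _ => u n) & right_ce u].
Proof.
move=> hu; have ufin := computable_reals_fin hu; split=> //.
  have uE : u = (fun n => (fine (u n))%:E) by apply/funext => n; rewrite fineK.
  move: hu; rewrite uE => /computable_realsP[+ _].
  by apply: lsc_ext.
have uE : u = (fun n => (fine (u n))%:E) by apply/funext => n; rewrite fineK.
move: hu; rewrite uE => /computable_realsP[_].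
by apply: lsc_ext.
Qed.

Lemma lsc_sig (u : nat -> \bar R) k : computable k ->
  lsc point_base (fun n _ => u n) -> sig (fun n => is_true ((qnum (k n))%:E < u n)%E).
Proof.
move=> hk hu; have u0 n : u n != -oo%E by case: hu => /(_ n tt).
have /sigE := (left_ceP u0).2 hu.
move=> /(sig_comp (g := fun n => npair n (k n)))/(_ ltac:(computable)).
by apply: sig_ext => n /=; rewrite npairK.
Qed.

Lemma lsc_opp_sqrt (h : nat -> \bar R) : (forall n, 0 <= h n)%E ->
  (forall n, h n \is a fin_num) ->
  right_ce (fun n => h n * h n)%E -> right_ce h.
Proof.
move=> h0 hfin hr.
apply: (@lsc_unary _ _ _ effective_point_base (fun n _ => (- (h n * h n))%E) _
  (fun n q p => qlt q (qnat 0) && qle (qopp p) (qmul q q))) => //.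
- by apply: sig_dec; apply: computable_and; [apply: computable_qlt2|apply: computable_qle2];
    computable.
- by move=> n _; rewrite -(fineK (hfin n)).
move=> n _ q; rewrite -(fineK (hfin n)); have r0 : 0 <= fine (h n) by exact: fine_ge0.
split.
  rewrite -EFinN lte_fin ltrNr => hq.
  have /qnum_dense[p /andP[p1 p2]] : - (qnum q * qnum q) < - (fine (h n) * fine (h n)).
    rewrite ltrN2; nra.
  exists p; rewrite -EFinM -EFinN lte_fin p2; split=> //.
  rewrite (qltE R) (qleE R) qnum_nat qnum_opp qnum_mul; apply/andP; split; first by lra.
  by rewrite lerNl ltW.
move=> [p []]; rewrite (qltE R) (qleE R) qnum_nat qnum_opp qnum_mul => /andP[q0 qp].
by rewrite -EFinM -!EFinN !lte_fin => ph; nra.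
Qed.

End real_sequences.

Section norms.
Context d (T : measurableType d) (R : realType) (mu : probability T R).
Local Open Scope ereal_scope.

Lemma Lnorm1_ge0 (f : T -> \bar R) : (forall x, 0 <= f x) ->
  'N[mu]_(1%:E)[f] = \int[mu]_x f x.
Proof. by move=> f0; rewrite Lnorm1; apply: eq_integral => x _; rewrite gee0_abs. Qed.

Lemma poweR2 (a : \bar R) : 0 <= a -> a `^ 2%:R = a * a.
Proof.
case: a => [a||]// a0; last by rewrite poweRyr// pnatr_eq0.
by rewrite poweR_EFin powR_mulrn// expr2.
Qed.

Lemma Lnorm2_sq (f : T -> \bar R) : (forall x, 0 <= f x) ->
  'N[mu]_(2%:E)[f] * 'N[mu]_(2%:E)[f] = \int[mu]_x sq f x.
Proof.
move=> f0; rewrite -poweR2 ?Lnorm_ge0// poweR_Lnorm ?pnatr_eq0//.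
by apply: eq_integral => x _; rewrite poweR2// gee0_abs.
Qed.

Lemma Lnorm2_fin (f : T -> \bar R) : (forall x, 0 <= f x) ->
  ('N[mu]_(2%:E)[f] \is a fin_num) = (\int[mu]_x sq f x \is a fin_num).
Proof.
move=> f0; rewrite -Lnorm2_sq//; have := Lnorm_ge0 mu 2%:E f.
case: ('N[mu]_(2%:E)[f]) => [r||]// _.
Qed.

End norms.

(** * Computability of integrals, and tests obtained as sums *)

Section tests.
Variables (R : realType) (X : completeMetricType R) (s : nat -> X).
Variable nu : probability (Borel X) R.
Hypothesis hX : computable_polish s.
Hypothesis hnu : computable_measure s nu.
Local Notation qnum := (qnum R).
Local Open Scope ereal_scope.

Let hB := effective_ball_base hX.
Let hP := effective_point_base.

Lemma ce_integral (f : nat -> X -> \bar R) : lsc (ball_base s) f ->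
  (forall n x, 0 <= f n x) -> lsc point_base (fun n _ => \int[nu]_x f n x).
Proof.
move=> hf f0; apply: (lsc_integral hP (mu := fun _ _ => nu)) => //.
have nu0 e : nu (ceopen s e) != -oo by rewrite -ltNye (lt_le_trans ltNy0).
have := (left_ceP (u := fun e => nu (ceopen s e)) nu0).1 hnu.
by apply: (lsc_comp (h := fun j => (unpair j).2)); computable.
exact: hf.
Qed.

(** As [nu] has mass 1, the integral of [g] is [c] minus that of [c - g], which is nonnegative and
    lower semicomputable. *)
Lemma right_ce_integral (g : nat -> X -> R) (c : nat -> nat) : computable c ->
  lsc (ball_base s) (fun n x => (- g n x)%:E) -> (forall n x, (0 <= g n x <= (c n)%:R)%R) ->
  right_ce (fun n => \int[nu]_x (g n x)%:E).
Proof.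
move=> hc hg gc.
have h1 : lsc (ball_base s) (fun n x => ((c n)%:R - g n x)%:E).
  have := lsc_add hB (lsc_cst R hB (c := fun n => qnat (c n)) ltac:(computable)) hg.
  by apply: lsc_ext => n x; rewrite qnum_nat.
have h10 n x : 0 <= ((c n)%:R - g n x)%:E by rewrite lee_fin subr_ge0; case/andP: (gc n x).
have hc' : lsc point_base (fun n (_ : unit) => (- (c n)%:R)%:E : \bar R).
  have := lsc_cst R hP (c := fun n => qopp (qnat (c n))) ltac:(computable).
  by apply: lsc_ext => n x; rewrite qnum_opp qnum_nat.
have := lsc_add hP (ce_integral h1 h10) hc'; apply: lsc_ext => n _.
have mg : measurable_fun setT (fun x : Borel X => (g n x)%:E).
  have -> : (fun x : Borel X => (g n x)%:E) = (fun x : Borel X => - (- g n x)%:E).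
    by apply/funext => x; rewrite -EFinN opprK.
  by apply: measurableT_comp => //; exact: lsc_measurable n hg.
have mg' := lsc_measurable n h1.
have e1 : \int[nu]_x ((c n)%:R - g n x)%:E + \int[nu]_x (g n x)%:E = (c n)%:R%:E.
  rewrite -ge0_integralD//; last first.
    by move=> x _; rewrite lee_fin; case/andP: (gc n x).
  rewrite (eq_integral (fun=> (c n)%:R%:E)) => [|x _]; last by rewrite -EFinD subrK.
  by rewrite integral_cst//= (probability_setT nu) mule1.
have i0 : 0 <= \int[nu]_x (g n x)%:E.
  by apply: integral_ge0 => x _; rewrite lee_fin; case/andP: (gc n x).
have j0 : 0 <= \int[nu]_x ((c n)%:R - g n x)%:E by exact: integral_ge0.
move: e1 i0 j0; case: (\int[nu]_x (g n x)%:E) => [i||]//;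
  case: (\int[nu]_x ((c n)%:R - g n x)%:E) => [j||]// => [[e1]] _ _.
by rewrite -EFinD -EFinN -e1; congr (_%:E); ring.
Qed.

Lemma right_ce_sum (u : nat -> nat -> \bar R) g : computable g ->
  (forall n k, u n k \is a fin_num) ->
  right_ce (fun j => u (unpair j).1 (unpair j).2) ->
  right_ce (fun n => \sum_(k < g n) u n k).
Proof.
move=> hg ufin hu.
have := @lsc_sum _ _ _ hP (fun n k (_ : unit) => - u n k) g hg hu.
apply: lsc_ext => n _.
by rewrite sumeN// => i j _ _; rewrite fin_num_adde_defl.
Qed.

(** An effective Borel-Cantelli argument: the integral of the sum of all [t k] is bounded above by
    partial sums plus the tails [2 C 2^-K], so it is computable, and the sum is a Schnorr test. *)
Lemma schnorr_sum (t : nat -> X -> \bar R) (C : nat) (x : X) :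
  lsc (ball_base s) t -> (forall k y, 0 <= t k y) ->
  right_ce (fun k => \int[nu]_y t k y) ->
  (forall k, \int[nu]_y t k y <= (C%:R * 2 ^- k)%:E) ->
  SR s nu x -> exists B : R, forall k, t k x <= B%:E.
Proof.
move=> ht t0 hrt tC Sx.
pose T (y : Borel X) := ereal_sup (range (fun K => \sum_(k < K) t k y)).
have lT : lsc (ball_base s) (fun _ : nat => T).
  have := @lsc_sup _ _ _ (fun (n : nat) K y => \sum_(k < K) t k y).
  apply; apply: (lsc_sum hB (f := fun _ k y => t k y) (g := fun n => (unpair n).2)).
    by computable.
  by apply: (lsc_comp (f := t)) ht; computable.
have T_ub K y : \sum_(k < K) t k y <= T y by apply: ereal_sup_ubound; exists K.
have T0 y : 0 <= T y by have := T_ub 0%N y; rewrite big_ord0.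
have it0 k : 0 <= \int[nu]_y t k y by apply: integral_ge0.
have itfin k : \int[nu]_y t k y \is a fin_num.
  by rewrite ge0_fin_numE// (le_lt_trans (tC k))// ltry.
have mt k : measurable_fun setT (t k : Borel X -> \bar R) by exact: (lsc_measurable k ht).
have geo K : \sum_(k < K) ((C%:R * 2 ^- k)%:E : \bar R) = (2 * C%:R - 2 * C%:R * 2 ^- K)%:E.
  elim: K => [|K IH]; first by rewrite big_ord0 expr0 invr1 mulr1 subrr.
  rewrite big_ord_recr /= IH -EFinD exprS invfM; congr (_%:E).
  by field; rewrite expf_neq0.
have intT : \int[nu]_y T y = ereal_sup (range (fun K => \sum_(k < K) \int[nu]_y t k y)).
  have -> : \int[nu]_y T y = \int[nu]_y (limn (fun K => \sum_(k < K) t k y)).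
    apply: eq_integral => y _; apply/esym/cvg_lim => //.
    apply: ereal_nondecreasing_cvgn; apply/nondecreasing_seqP => K.
    by rewrite big_ord_recr /= leeDl.
  rewrite monotone_convergence//; last first.
  - move=> y _; apply/nondecreasing_seqP => K.
    by rewrite big_ord_recr /= leeDl.
  - by move=> K y _; apply: sume_ge0.
  - by move=> K; apply: emeasurable_sum.
  apply/cvg_lim => //; rewrite (_ : (fun K => _) = fun K => \sum_(k < K) \int[nu]_y t k y).
    apply: ereal_nondecreasing_cvgn; apply/nondecreasing_seqP => K.
    by rewrite big_ord_recr /= leeDl.
  by apply/funext => K; rewrite ge0_integral_sum.
have intT_le K : \int[nu]_y T y <= \sum_(k < K) \int[nu]_y t k y + (2 * C%:R * 2 ^- K)%:E.
  rewrite intT; apply: ge_ereal_sup => _ [L _ <-].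
  have [LK|KL] := leqP L K.
    apply: (@le_trans _ _ (\sum_(k < K) \int[nu]_y t k y)).
      rewrite -!(big_mkord xpredT (fun k => \int[nu]_y t k y)).
      rewrite [leRHS](big_cat_nat (n := L))//= leeDl//.
      by apply: sume_ge0.
    by rewrite leeDl// lee_fin !mulr_ge0// invr_ge0 exprn_ge0.
  rewrite -!(big_mkord xpredT (fun k => \int[nu]_y t k y)).
  rewrite (big_cat_nat (n := K) (leq0n K) (ltnW KL))//= leeD2l//.
  apply: (@le_trans _ _ (\sum_(K <= k < L) (C%:R * 2 ^- k)%:E)); first exact: lee_sum.
  have := geo L; rewrite -(big_mkord xpredT (fun k => (C%:R * 2 ^- k)%:E)).
  rewrite (big_cat_nat (n := K) (leq0n K) (ltnW KL))//= big_mkord geo => /(congr1 (fun a =>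
    a - (2 * C%:R - 2 * C%:R * 2 ^- K)%:E)).
  rewrite addeAC subee// add0e => ->; rewrite -EFinB lee_fin.
  have : (0 <= 2 * C%:R * 2 ^- L :> R)%R by rewrite !mulr_ge0// invr_ge0 exprn_ge0.
  lra.
have Tfin : \int[nu]_y T y \is a fin_num.
  rewrite ge0_fin_numE ?integral_ge0//; apply: (le_lt_trans (intT_le 0%N)).
  by rewrite big_ord0 add0e ltry.
have test : schnorr_test s nu 1 T.
  split=> //; first exact/lsc_seqP.
  apply: computable_reals_ce => [n||].
  - by rewrite Lnorm1_ge0.
  - have := ce_integral lT (fun _ => T0).
    by apply: lsc_ext => n _; rewrite Lnorm1_ge0.
  have : right_ce (fun _ : nat => \int[nu]_y T y).
    pose v (n K : nat) := \sum_(k < K) \int[nu]_y t k y + (2 * C%:R * 2 ^- K)%:E.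
    apply: (@right_ce_inf _ _ v) => [n K|n|n r|].
    - exact: intT_le.
    - by move: Tfin; case: (\int[nu]_y T y).
    - move=> Tr; have [e e0 he] : exists2 e : R, (0 < e)%R & \int[nu]_y T y + e%:E < r%:E.
        move: Tr; rewrite -(fineK Tfin) lte_fin => Tr.
        exists ((r - fine (\int[nu]_y T y)) / 2)%R; first by rewrite divr_gt0// subr_gt0.
        by rewrite -EFinD lte_fin; lra.
      have [K hK] := @exp2V_lt R (e / (2 * C%:R + 1))
        ltac:(by rewrite divr_gt0// ltr_wpDl// mulr_ge0).
      exists K; apply: le_lt_trans he; rewrite /v leeD//.
        by rewrite intT; apply: ereal_sup_ubound; exists K.
      rewrite lee_fin; move: hK; rewrite ltr_pdivlMr ?ltr_wpDl// ?mulr_ge0// => hK.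
      have := exp2V_gt0 R K; nra.
    have h1 : right_ce (fun j => \sum_(k < (unpair j).2) \int[nu]_y t k y).
      apply: (@right_ce_sum (fun _ k => \int[nu]_y t k y) (fun j => (unpair j).2)) => //.
        by computable.
      by apply: right_ce_comp hrt; computable.
    have h2 := lsc_cst R hP (c := fun n => qopp (qmul (qnat (2 * C)) (qpow2 (unpair n).2)))
      ltac:(computable).
    have := lsc_add hP h1 h2; apply: lsc_ext => n _.
    rewrite qnum_opp qnum_mul qnum_nat qnum_pow2 natrM EFinN -fin_num_oppeD//.
  by apply: lsc_ext => n _; rewrite Lnorm1_ge0.
have := Sx _ test; have := T0 x; case Tx : (T x) => [B||]// _ _.
exists B => k; rewrite -Tx; apply: le_trans (T_ub k.+1 x).
by rewrite big_ord_recr /= leeDr// sume_ge0.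
Qed.

End tests.

(** * Tests in L2, comparison at Schnorr random points, and full measure *)

Section randomness.
Variables (R : realType) (X : completeMetricType R) (s : nat -> X).
Variable nu : probability (Borel X) R.
Hypothesis hX : computable_polish s.
Hypothesis hnu : computable_measure s nu.
Local Notation qnum := (qnum R).
Local Open Scope ereal_scope.

Let hB := effective_ball_base hX.
Let hP := effective_point_base.

(** Left-c.e. norms are automatic for lower semicomputable functions, so computability of the norms
    comes down to upper bounds for the integrals of the squares. *)
Lemma schnorr_tests2P (f : nat -> X -> \bar R) : schnorr_tests s nu 2 f <->
  [/\ lsc (ball_base s) f, forall n x, 0 <= f n x,
      forall n, \int[nu]_x sq (f n : Borel X -> \bar R) x \is a fin_num &
      right_ce (fun n => \int[nu]_x sq (f n : Borel X -> \bar R) x)].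
Proof.
split=> [[/lsc_seqP lf f0 /ce_computable_reals[Nfin _ Nr]]|[lf f0 ffin fr]].
  have N0 n : (0 <= fine ('N[nu]_(2%:E)[f n]))%R by rewrite fine_ge0// Lnorm_ge0.
  split=> // [n|]; first by rewrite -Lnorm2_fin// Nfin.
  have := lsc_sqN hP (g := fun n _ => fine ('N[nu]_(2%:E)[f n])) (fun n _ => N0 n) _.
  have h : lsc point_base (fun (n : nat) (_ : unit) => (- fine ('N[nu]_(2%:E)[f n]))%:E).
    by apply: lsc_ext Nr => n _; rewrite EFinN fineK.
  move=> /(_ h); apply: lsc_ext => n _.
  by rewrite -(@Lnorm2_sq _ (Borel X)) ?EFinN ?EFinM ?fineK.
split=> //; first exact/lsc_seqP.
have Nfin n : 'N[nu]_(2%:E)[f n] \is a fin_num by rewrite (@Lnorm2_fin _ (Borel X)).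
apply: computable_reals_ce => //.
  apply: (lsc_sqrt hP (f := fun n _ => \int[nu]_x sq (f n : Borel X -> \bar R) x)).
  - by move=> n _; exact: Lnorm_ge0.
  - by move=> n _; rewrite (@Lnorm2_sq _ (Borel X)).
  - exact: (ce_integral hnu (lsc_sq hB f0 lf) (fun n x => mule_ge0 (f0 n x) (f0 n x))).
apply: lsc_opp_sqrt => // [n|]; first exact: Lnorm_ge0.
by apply: lsc_ext fr => n _; rewrite (@Lnorm2_sq _ (Borel X)).
Qed.

(* The positive parts of psi - g for late minorants g of phi, scaled by powers
   of 2, have summable integrals. *)
Lemma schnorr_ae_le (phi psi : X -> \bar R) (x : X) :
  lsc (ball_base s) (fun _ => phi) -> lsc (ball_base s) (fun _ => psi) ->
  (forall y, 0 <= phi y) -> (forall y, 0 <= psi y) ->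
  {ae nu, forall y : Borel X, phi y = psi y} ->
  \int[nu]_y phi y \is a fin_num -> right_ce (fun _ => \int[nu]_y phi y) ->
  SR s nu x -> psi x <= phi x.
Proof.
move=> lphi lpsi phi0 psi0 eqae phifin phir Sx.
have [g [bg g_bd g_mono g_le g_sup]] := lsc_approx hX lphi (fun _ => phi0).
pose G j : X -> R := g 0%N j.
have bG : bicomputable (ball_base s) G.
  have := bicomputable_comp (h := fun j => npair 0 j) ltac:(computable) bg.
  by apply: bicomputable_ext => j y; rewrite npairK.
have G0 j y : 0 <= (G j y)%:E by rewrite lee_fin; case/andP: (g_bd 0%N j y).
have IGl := ce_integral hnu bG.1 G0.
have IGr := right_ce_integral hX hnu (c := fun n => n) ltac:(computable) bG.2 (g_bd 0%N).
have mG j : measurable_fun setT (fun y : Borel X => (G j y)%:E) by exact: (bicomputable_measurable j bG).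
have mphi : measurable_fun setT (phi : Borel X -> \bar R) by exact: (lsc_measurable 0 lphi).
have mpsi : measurable_fun setT (psi : Borel X -> \bar R) by exact: (lsc_measurable 0 lpsi).
have IG0 j : 0 <= \int[nu]_y (G j y)%:E by exact: integral_ge0.
have IG_le j : \int[nu]_y (G j y)%:E <= \int[nu]_y phi y.
  by apply: ge0_le_integral => // y _; exact: g_le.
have IGfin j : \int[nu]_y (G j y)%:E \is a fin_num.
  rewrite ge0_fin_numE// (le_lt_trans (IG_le j))//.
  by move: phifin; rewrite ge0_fin_numE// integral_ge0.
(* A positive gap says that the integral of [G j] is within [4^-k] of that of [phi]; after scaling
   by [2^k], the integral of [t k] is at most [2^-k]. *)
pose gap k j := (qnum (qpow2 (2 * k)))%:E + (- (\int[nu]_y phi y) + \int[nu]_y (G j y)%:E).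
have lgap : lsc point_base (fun n (_ : unit) => gap (unpair n).1 (unpair n).2).
  have h1 := lsc_cst R hP (c := fun n => qpow2 (2 * (unpair n).1)) ltac:(computable).
  have h2 := lsc_comp (f := fun _ _ => - \int[nu]_y phi y) (h := fun=> 0%N)
      (computable_const 0) phir.
  have h3 := lsc_comp (f := fun j _ => \int[nu]_y (G j y)%:E) (h := fun n => (unpair n).2)
    ltac:(computable) IGl.
  exact: (lsc_add hP h1 (lsc_add hP h2 h3)).
have [|k|J hJ JP] := @sig_choice (fun k j => is_true ((qnum (qnat 0))%:E < gap k j)).
- exact: (lsc_sig (k := fun=> qnat 0) (computable_const _) lgap).
- have e0 := exp2V_gt0 R (2 * k).
  have [|||j /(_ j (leqnn j)) hj] := @fatou_gt _ (Borel X) R nu phi (fun j y => (G j y)%:E)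
    (\int[nu]_y phi y - (2 ^- (2 * k))%:E) mphi phi0 mG.
  + exact: G0.
  + apply: aeW => y c cy; have [j hj] := g_sup 0%N y c cy; exists j => n jn.
    by rewrite lee_fin (le_trans (ltW hj))// g_mono.
  + by rewrite -(fineK phifin) -EFinB lte_fin; lra.
  exists j; rewrite /gap qnum_nat qnum_pow2; move: hj.
  rewrite -(fineK phifin) -(fineK (IGfin j)) -EFinB -EFinN -!EFinD !lte_fin; lra.
pose t k y := (qnum (qnat (2 ^ k)))%:E * maxe (psi y + (- G (J k) y)%:E) 0.
have pos2 k : (0 < qnum (qnat (2 ^ k)))%R by rewrite qnum_nat ltr0n expn_gt0.
have lt : lsc (ball_base s) t.
  apply: lsc_scale => //; first by computable.
  apply: lsc_max; last first.
    by apply: lsc_ext (lsc_cst R hB (c := fun=> qnat 0) (computable_const _)) => n y;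
      rewrite qnum_nat.
  have h2 := lsc_comp (f := fun j y => (- G j y)%:E) hJ bG.2.
  exact: (lsc_add hB lpsi h2).
have t0 k y : 0 <= t k y.
  by rewrite /t mule_ge0 ?qnum_nat ?lee_fin// le_max lexx orbT.
have int_t k : \int[nu]_y t k y =
   (2 ^+ k * (fine (\int[nu]_y phi y) - fine (\int[nu]_y (G (J k) y)%:E)))%:E.
  have mm : measurable_fun setT (fun y : Borel X => maxe (psi y + (- G (J k) y)%:E) 0).
    apply: measurable_maxe => //; apply: emeasurable_funD => //.
    exact: (lsc_measurable (J k) bG.2).
  rewrite /t ge0_integralZl//; last 2 first.
  - by move=> y _; rewrite le_max lexx orbT.
  - by rewrite qnum_nat lee_fin.
  rewrite qnum_nat natrX EFinM; congr (_ * _).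
  (* Almost everywhere [psi = phi >= G (J k)], so the positive part is the difference itself. *)
  have : \int[nu]_y maxe (psi y + (- G (J k) y)%:E) 0 + \int[nu]_y (G (J k) y)%:E =
    \int[nu]_y phi y.
    rewrite -ge0_integralD//; last by move=> y _; rewrite le_max lexx orbT.
    apply: ge0_ae_eq_integral => //.
    - exact: emeasurable_funD.
    - by move=> y _; rewrite adde_ge0// le_max lexx orbT.
    apply: (ae_mono _ eqae) => y <- _; have := g_le 0%N (J k) y; rewrite -/(G (J k)) => Gphi.
    have -> : maxe (phi y + (- G (J k) y)%:E) 0 = phi y + (- G (J k) y)%:E.
      by apply/max_idPl; rewrite EFinN sube_ge0// Gphi.
    by rewrite EFinN subeK.
  by move=> e; rewrite EFinB !fineK// -e addeK.
have rt : right_ce (fun k => \int[nu]_y t k y).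
  have h1 : lsc point_base (fun k (_ : unit) =>
      - (\int[nu]_y phi y) + \int[nu]_y (G (J k) y)%:E).
    have h2 := lsc_comp (f := fun _ _ => - \int[nu]_y phi y) (h := fun=> 0%N)
        (computable_const 0) phir.
    have h3 := lsc_comp (f := fun j _ => \int[nu]_y (G j y)%:E) hJ IGl.
    exact: (lsc_add hP h2 h3).
  have := lsc_scale hP (c := fun k => qnat (2 ^ k)) ltac:(computable)
    pos2 h1.
  apply: lsc_ext => k _; rewrite int_t qnum_nat natrX.
  rewrite -{1}(fineK phifin) -{1}(fineK (IGfin (J k))).
  by rewrite -EFinN -EFinD -EFinM -EFinN; congr (_%:E); ring.
have tC k : \int[nu]_y t k y <= (1%:R * 2 ^- k)%:E.
  have := JP k; rewrite /gap qnum_nat qnum_pow2 -(fineK phifin) -(fineK (IGfin (J k))).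
  rewrite int_t -EFinN -!EFinD lte_fin lee_fin mul1r => h.
  have p0 : (0 < 2 ^+ k :> R)%R by rewrite exprn_gt0.
  have -> : (2 ^- k = 2 ^+ k * 2 ^- (2 * k) :> R)%R.
    by rewrite mulnC exprM expr2 invfM mulrA divff ?mul1r// gt_eqF.
  by rewrite ler_pM2l// ltW//; lra.
have [B hBt] := schnorr_sum hX hnu lt t0 rt tC Sx.
case phix : (phi x) (phi0 x) => [p||] // _; last by rewrite leey.
(* As [G] stays below [phi], a rational [q] between [p = phi x] and [psi x] would make [t k x] at
   least [2^k * (q - p)], unbounded in [k]. *)
rewrite leNgt; apply/negP => /lte_qnum[q []]; rewrite lte_fin => pq qpsi.
have d0 : (0 < qnum q - p)%R by rewrite subr_gt0.
have b0 : (0 < `|B| + 1)%R by rewrite ltr_wpDl.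
have [k hk] := exp2V_lt (divr_gt0 d0 b0).
have : ((qnum (qnat (2 ^ k)))%:E * (qnum q - p)%:E <= B%:E).
  apply: le_trans (hBt k); apply: lee_wpmul2l; first by rewrite lee_fin ltW.
  rewrite le_max EFinB; apply/orP; left; rewrite leeD//; first exact: ltW.
  by rewrite EFinN leeN2 -phix; exact: g_le.
rewrite qnum_nat natrX -EFinM lee_fin.
move: hk; rewrite ltr_pdivlMr// => hk.
have p0 : (0 < 2 ^+ k :> R)%R by rewrite exprn_gt0.
have : (`|B| + 1 < 2 ^+ k * (qnum q - p))%R by rewrite -ltr_pdivrMl// mulrC.
have := ler_norm B; lra.
Qed.

(** [schnorr_ae_le] for the indicator of a c.e. open set of measure 1 against the constant 1. *)
Lemma SR_KR x : SR s nu x -> KR s nu x.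
Proof.
move=> Sx e e1; have mU := measurable_ceopen s e.
have lphi : lsc (ball_base s) (fun (_ : nat) y => (\1_(ceopen s e) y)%:E : \bar R).
  apply: (lsc_indic R hB (U := fun=> ceopen s e)).
  exact: (eopen_comp (U := ceopen s) (computable_const e) (eopen_ceopen s)).
have lpsi : lsc (ball_base s) (fun (_ : nat) (_ : X) => 1 : \bar R).
  have := lsc_cst R hB (c := fun=> qnat 1) (computable_const _).
  by apply: lsc_ext => n y; rewrite qnum_nat.
have int1 : \int[nu]_y (\1_(ceopen s e) y)%:E = 1.
  by rewrite (@integral_indic _ (Borel X))// setIT.
have : (1 <= (\1_(ceopen s e) x)%:E :> \bar R).
  apply: (@schnorr_ae_le (fun y => (\1_(ceopen s e) y)%:E) (fun=> 1)) => //.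
  - have : {ae nu, forall y : Borel X, (ceopen s e : set (Borel X)) y}.
      exists (~` ceopen s e); split => //; first exact: measurableC.
      by have := probability_setC nu mU; rewrite e1 subee.
    by apply: ae_mono => y ey; rewrite indicE mem_set.
  - by rewrite int1.
  - rewrite int1; have := lsc_cst R hP (c := fun=> qopp (qnat 1)) (computable_const _).
    by apply: lsc_ext => n y; rewrite qnum_opp qnum_nat.
rewrite lee_fin indicE; case: (boolP (x \in _)) => [/set_mem//|_].
by rewrite ler10.
Qed.

(* There are countably many tests: each is determined by the number of a program
   for its cuts. *)
Lemma SR_ae : {ae nu, forall x : Borel X, (SR s nu : set (Borel X)) x}.
Proof.
pose coded e (f : X -> \bar R) := exists c h, [/\ godel c = e, forall n, runs c n (h n) &
  forall k, [set x | (qnum k)%:E < f x] = ceopen s (h k)].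
have coded_inj e f f' : coded e f -> coded e f' -> f = f'.
  move=> [c [h [ce ch fh]]] [c' [h' [ce' ch' fh']]]; apply/funext => x.
  apply: qnum_ext => k; have hh' : h k = h' k.
    by apply: (runs_inj _ (ch k) (ch' k)); rewrite ce ce'.
  have /seteqP[h1 h2] : [set x | (qnum k)%:E < f x] = [set x | (qnum k)%:E < f' x].
    by rewrite fh fh' hh'.
  by split=> [/h1|/h2].
have test_fin f : schnorr_test s nu 1 f -> {ae nu, forall x : Borel X, f x < +oo}.
  move=> [/lsc_seqP lf f0 /computable_reals_fin/(_ 0%N)].
  rewrite (@Lnorm1_ge0 _ (Borel X))//; last exact: f0 0%N.
  move=> ffin; have mf : measurable_fun setT (f : Borel X -> \bar R).
    exact: (lsc_measurable 0 lf).
  have fi : nu.-integrable setT (f : Borel X -> \bar R).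
    apply: ge0_integrable => //; first exact: f0 0%N.
    by rewrite ltey_eq ffin.
  apply: (ae_mono _ (integrable_ae measurableT fi)) => x /(_ I).
  by rewrite ge0_fin_numE//; exact: f0 0%N x.
have test_coded f : schnorr_test s nu 1 f -> exists e, coded e f.
  (* The test is a constant sequence, so its cuts are read off at index 0; [Pair Fst Snd] is the
     identity program. *)
  move=> [[f0 [h [c hc] fh]] _ _]; exists (godel (Comp c (Pair Zero (Pair Fst Snd)))).
  exists (Comp c (Pair Zero (Pair Fst Snd))), (h 0%N); split=> // n.
  exists (npair 0 n); last by have := hc (npair 0 n); rewrite npairK.
  exists 0%N, n; split=> //; exists (unpair n).1, (unpair n).2; split=> //.
  by rewrite unpairK.
have null e : exists N : set (Borel X), nu.-negligible N /\
    forall f, schnorr_test s nu 1 f -> coded e f -> forall x, f x = +oo -> N x.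
  have [[f [tf cf]]|nof] := pselect (exists f, schnorr_test s nu 1 f /\ coded e f).
    exists [set x | ~ (f x < +oo)]; split; first exact: test_fin tf.
    by move=> f' tf' cf' x; rewrite (coded_inj _ _ _ cf' cf) /= => ->; rewrite ltxx.
  exists set0; split; first exact: negligible_set0.
  by move=> f tf cf; exfalso; apply: nof; exists f.
have [N hN] := choice null.
rewrite /almost_everywhere /=; apply: negligibleS (_ : nu.-negligible (\bigcup_e N e)).
  move=> x /= nSx; apply: contrapT => nN; apply: nSx => f tf.
  have [e ce] := test_coded f tf; rewrite ltNge leye_eq; apply/negP => /eqP fx.
  by apply: nN; exists e => //; exact: (hN e).2 f tf ce x fx.
by apply: negligible_bigcup => e; case: (hN e).
Qed.

End randomness.

(** * Convergence at Schnorr random points *)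

(** The deterministic core. The second bound keeps [g] within order [2^-k] of its value at the start
    of the [k]-th block, so that [g] is Cauchy. The first makes [u - g] small, because its square is
    at most the difference of the squares when [0 <= g <= u]. *)
Lemma cvg_of_blocks (R : realType) (u g : nat -> R) (nk : nat -> nat) (B1 B2 : R) :
  (forall k, (k <= nk k < nk k.+1)%N) ->
  (forall n, 0 <= g n <= u n) ->
  (forall n, 2 ^+ n * (u n * u n - g n * g n) <= B1) ->
  (forall k m, (nk k <= m <= nk k.+1)%N -> 4 ^+ k * ((g m - g (nk k)) * (g m - g (nk k))) <= B2) ->
  exists l : R, u n @[n --> \oo] --> l.
Proof.
move=> hnk gu h1 h2; pose b := `|B1| + `|B2| + 1.
have b0 : 0 < b by rewrite /b ltr_wpDl// addr_ge0.
have p2 n : 0 < 2 ^+ n :> R by rewrite exprn_gt0.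
(* Since [b >= 1], the square root of [b] can be replaced by [b]. *)
have sq_bound (c : R) k : 4 ^+ k * (c * c) <= b -> `|c| <= b * 2 ^- k.
  move=> h; have b1 : 1 <= b by rewrite /b; have := normr_ge0 B1; have := normr_ge0 B2; lra.
  rewrite ler_pdivlMr// leNgt; apply/negP => hc.
  have : b * b < (`|c| * 2 ^+ k) * (`|c| * 2 ^+ k) by rewrite ltr_pM// ltW.
  have -> : (`|c| * 2 ^+ k) * (`|c| * 2 ^+ k) = 4 ^+ k * (c * c).
    have -> : 4 = 2 * 2 :> R by rewrite -natrM.
    by rewrite exprMn -[c * c]expr2 -real_normK ?num_real// expr2; ring.
  move=> hlt; have hb : b <= b * b by rewrite -{1}[b]mul1r ler_pM2r.
  by have := le_lt_trans hb (lt_le_trans hlt h); rewrite ltxx.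
have nk_homo k l : (k <= l)%N -> (nk k <= nk l)%N.
  move=> /subnK <-; elim: (l - k)%N => // i IH; rewrite addSn (leq_trans IH)// ltnW//.
  by case/andP: (hnk (i + k)%N).
have block k m : (nk k <= m)%N -> exists l, (k <= l)%N /\ (nk l <= m <= nk l.+1)%N.
  move=> km; have hex : exists l, (m <= nk l.+1)%N.
    by exists m; case/andP: (hnk m.+1) => /ltnW.
  have [l0 lm lmin] := ex_minnP hex.
  have [kl|lk] := leqP k l0.
    exists l0; split=> //; rewrite lm andbT; case: l0 lm lmin kl => [|l0] lm lmin kl.
      by move: kl km; rewrite leqn0 => /eqP ->.
    rewrite leqNgt; apply/negP => ml; have := lmin l0 (ltnW ml).
    by rewrite ltnn.
  exists k; split=> //; rewrite km (leq_trans lm)// nk_homo// ltnS ltnW//.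
have hb2 k m : (nk k <= m <= nk k.+1)%N -> `|g m - g (nk k)| <= b * 2 ^- k.
  move=> /h2 h; apply: sq_bound; apply: (le_trans h); rewrite /b.
  have := ler_norm B2; have := normr_ge0 B1; lra.
have tele k i : `|g (nk (i + k)%N) - g (nk k)| <= 2 * b * 2 ^- k - 2 * b * 2 ^- (i + k).
  elim: i => [|i IH]; first by rewrite !subrr normr0.
  have := hb2 (i + k)%N (nk (i + k).+1); rewrite leqnn andbT ltnW; last first.
    by case/andP: (hnk (i + k)%N).
  move=> /(_ isT) h; rewrite addSn.
  have -> : g (nk (i + k).+1) - g (nk k) =
    (g (nk (i + k).+1) - g (nk (i + k)%N)) + (g (nk (i + k)%N) - g (nk k)) by ring.
  rewrite (le_trans (ler_normD _ _))// (le_trans (lerD h IH))//.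
  have -> : 2 ^- (i + k).+1 = 2 ^- (i + k) / 2 :> R by rewrite exprSr invfM.
  lra.
have cauchy_g k m : (nk k <= m)%N -> `|g m - g (nk k)| <= 2 * b * 2 ^- k.
  move=> /block[l [/subnK kl /hb2 h]]; have := tele k (l - k)%N; rewrite kl => t.
  have -> : g m - g (nk k) = (g m - g (nk l)) + (g (nk l) - g (nk k)) by ring.
  rewrite (le_trans (ler_normD _ _))// (le_trans (lerD h t))//.
  have : 0 <= b * 2 ^- l by rewrite mulr_ge0// ?ltW// exp2V_gt0.
  lra.
(* For [n >= 2 k] the weight [2^n] is at least [4^k]. *)
have ug n k : (k + k <= n)%N -> `|u n - g n| <= b * 2 ^- k.
  move=> kn; apply: sq_bound.
  have /andP[g0 gun] := gu n.
  have h3 : (u n - g n) * (u n - g n) <= u n * u n - g n * g n by nra.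
  apply: le_trans (_ : 2 ^+ n * (u n * u n - g n * g n) <= _); last first.
    apply: (le_trans (h1 n)); rewrite /b.
    have := ler_norm B1; have := normr_ge0 B2; lra.
  apply: ler_pM => //.
  - by rewrite -expr2 sqr_ge0.
  - have -> : 4 = 2 * 2 :> R by rewrite -natrM.
    by rewrite exprMn -exprD ler_weXn2l// ler1n.
suff /cvg_ex[l hl] : cvgn u by exists l.
apply/cauchy_cvgP; apply: cauchy_exP => e e0.
have [k hk] := @exp2V_lt R (e / (4 * b)) ltac:(by rewrite divr_gt0// mulr_gt0).
exists (g (nk k)); exists (maxn (nk k) (k + k)) => // n; rewrite /= geq_max => /andP[nkn kn].
rewrite /ball /= distrC; have h3 := cauchy_g k n nkn; have h4 := ug n k kn.
have -> : u n - g (nk k) = (u n - g n) + (g n - g (nk k)) by ring.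
rewrite (le_lt_trans (ler_normD _ _))// (le_lt_trans (lerD h4 h3))//.
move: hk; rewrite ltr_pdivlMr ?mulr_gt0// => hk.
have := exp2V_gt0 R k; nra.
Qed.

Section square_integrals.
Context d (T : measurableType d) (R : realType) (mu : probability T R).
Local Open Scope ereal_scope.

Lemma fatou_sq_gt (f : T -> \bar R) (F : nat -> T -> \bar R) (q : \bar R) :
  measurable_fun setT f -> (forall x, 0 <= f x) ->
  (forall n, measurable_fun setT (F n)) -> (forall n x, 0 <= F n x) ->
  {ae mu, forall x, forall c : R, c%:E < f x ->
    exists n0, forall n, (n0 <= n)%N -> c%:E <= F n x} ->
  q < \int[mu]_x sq f x ->
  exists n0, forall n, (n0 <= n)%N -> q < \int[mu]_x sq (F n) x.
Proof.
move=> mf f0 mF F0 fF; apply: fatou_gt.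
- exact: measurable_sq.
- by move=> x; exact: sq_ge0.
- by move=> n; exact: measurable_sq.
- by move=> n x; exact: sq_ge0.
- apply: filterS fF => x fF c cf; have [c0|c0] := ltP c 0%R.
    by exists 0%N => n _; apply: le_trans (sq_ge0 _ (F0 n)); rewrite lee_fin ltW.
  have /fF[n0 h] : (Num.sqrt c)%:E < f x.
    rewrite ltNge; apply/negP => fc; move: cf; rewrite ltNge => /negP; apply.
    by rewrite -[in leRHS](sqr_sqrtr c0) expr2 EFinM /sq lee_pmul.
  exists n0 => n /h cF; rewrite -(sqr_sqrtr c0) expr2 EFinM /sq.
  by rewrite lee_pmul// lee_fin sqrtr_ge0.
Qed.

Lemma integral_sq_sup (y : nat -> T -> \bar R) (C : \bar R) :
  (forall i, measurable_fun setT (y i)) -> (forall i x, 0 <= y i x) ->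
  (forall N, \int[mu]_x sq (fun x => runmax (y ^~ x) N) x <= C) ->
  \int[mu]_x sq (fun x => ereal_sup (range (y ^~ x))) x <= C.
Proof.
move=> my y0 yC; rewrite leNgt; apply/negP => hC.
have [|||||n /(_ n (leqnn n))] := @fatou_sq_gt (fun x => ereal_sup (range (y ^~ x)))
  (fun N x => runmax (y ^~ x) N) C _ _ _ _ _ hC; last by rewrite ltNge yC.
- rewrite (_ : (fun x => _) = (fun x => esups (y ^~ x) 0%N)); last first.
    apply/funext => x; rewrite /esups /sdrop; congr ereal_sup.
    by apply/seteqP; split=> _ [i _ <-]; exists i.
  exact: measurable_fun_esups.
- by move=> x; apply: (le_trans (y0 0%N x)); apply: ereal_sup_ubound; exists 0%N.
- by elim=> [|n IH] /=; [exact: my|exact: measurable_maxe].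
- by move=> n x; exact: runmax_ge0.
- apply: aeW => x c /ereal_sup_gt[_ [i _ <-]] ci; exists i => n ni.
  by rewrite (le_trans (ltW ci))// (runmax_ub (y ^~ x)).
Qed.

End square_integrals.

(** Transfers bounds on the increments of [M], which Doob's inequality controls, to increments of
    minorants, at the cost of the defects of the squares. *)
Lemma minorant_gap (R : realType) (u v : \bar R) (a b : R) : (0 <= a)%R -> (0 <= b)%R ->
  (a%:E <= u -> b%:E <= v -> ((a - b) * (a - b))%:E <=
  (dist u v * dist u v + dist u v * dist u v) +
  (((v * v + (- (b * b))%:E) + (v * v + (- (b * b))%:E)) +
   ((u * u + (- (a * a))%:E) + (u * u + (- (a * a))%:E))))%E.
Proof.
case: u v => [u||] // [v||] // a0 b0 au bv; rewrite ?leey//.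
- rewrite -EFinB abse_EFin -!EFinM -!EFinD lee_fin -normrM ger0_norm; last first.
    by rewrite -expr2 sqr_ge0.
  rewrite !lee_fin in au bv.
  (* Parallelogram law for [u - v] and [(v - b) - (u - a)]; the mixed term has the favourable sign
     because both defects are nonnegative. *)
  have h : (a - b) * (a - b) =
    2 * ((u - v) * (u - v)) + 2 * ((v - b) * (v - b)) + 2 * ((u - a) * (u - a))
    - 4 * ((v - b) * (u - a))
    - ((u - v) + (u - a) - (v - b)) * ((u - v) + (u - a) - (v - b)) by ring.
  have h1 : 0 <= ((u - v) + (u - a) - (v - b)) * ((u - v) + (u - a) - (v - b)).
    by rewrite -expr2 sqr_ge0.
  have h2 : 0 <= (v - b) * (u - a) by rewrite mulr_ge0// subr_ge0.
  have h3 : (v - b) * (v - b) <= v * v - b * b by nra.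
  have h4 : (u - a) * (u - a) <= u * u - a * a by nra.
  rewrite h; lra.
Qed.

(** * Convergence of a martingale whose norms have a computable supremum *)

Section forward.
Variables (R : realType) (X : completeMetricType R) (s : nat -> X).
Variable nu : probability (Borel X) R.
Variables (F : nat -> set (set X)) (rho : nat -> R.-ftker Borel X ~> Borel X).
Hypothesis hX : computable_polish s.
Hypothesis hnu : computable_measure s nu.
Hypothesis hF : almost_full_filtration s nu F.
Hypothesis hrho : disintegrations s nu (KR s nu) F rho.
Local Notation qnum := (qnum R).
Local Open Scope ereal_scope.

Let hB := effective_ball_base hX.
Let hP := effective_point_base.

Variable M : nat -> Borel X -> \bar R.
Hypothesis hM : schnorr_martingale s nu 2 F rho M.

Let lM : lsc (ball_base s) (M : nat -> X -> \bar R).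
Proof. by have [/(schnorr_tests2P hX hnu)[]] := hM. Qed.
Let M0 n x : 0 <= M n x.
Proof. by have [/(schnorr_tests2P hX hnu)[_ h _ _] _ _] := hM; exact: h. Qed.
Let mM n : measurable_fun setT (M n).
Proof. exact: (lsc_measurable n lM). Qed.
Let iMfin n : \int[nu]_y sq (M n) y \is a fin_num.
Proof. by have [/(schnorr_tests2P hX hnu)[]] := hM. Qed.
Let iMr : right_ce (fun n => \int[nu]_y sq (M n) y).
Proof. by have [/(schnorr_tests2P hX hnu)[]] := hM. Qed.
Let iMl : lsc point_base (fun n _ => \int[nu]_y sq (M n) y).
Proof. exact: (ce_integral hnu (lsc_sq hB M0 lM) (fun n x => mule_ge0 (M0 n x) (M0 n x))). Qed.
Let l2M n : l2 nu (M n).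
Proof. by split=> //; rewrite ltey_eq iMfin. Qed.
Let adM n : measurable_wrt (F n) (M n).
Proof. by have [_ + _] := hM; exact. Qed.
Let martM n : {ae nu, forall x : Borel X, M n x = cond rho n (M n.+1) x}.
Proof.
have [_ _ h] := hM; apply: (ae_mono _ (SR_ae s nu)) => x; exact: h.
Qed.

Let A n : R := fine (\int[nu]_y sq (M n) y).
Let AE n : \int[nu]_y sq (M n) y = (A n)%:E.
Proof. by rewrite /A fineK. Qed.

Lemma martingale_norm_homo n m : (n <= m)%N -> (A n <= A m)%R.
Proof.
move=> nm; rewrite -lee_fin -!AE -(adapted_dist_le hF hrho adM l2M martM nm).
by rewrite leeDr// integral_ge0// => x _; rewrite /sq mule_ge0.
Qed.

(** Fatou's lemma shows that a good stage of the approximation exists, and [sig_choice] finds one: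
    the condition is c.e. because the norm of [M n] is right-c.e. and that of a minorant left-c.e.
    The bound [J] later provides computable upper bounds for products of minorants. *)
Lemma martingale_minorants : exists (gam : nat -> X -> R) (J : nat -> nat),
  [/\ computable J, bicomputable (ball_base s) gam,
      forall n x, (0 <= gam n x <= (J n)%:R)%R,
      forall n x, (gam n x)%:E <= M n x &
      forall n, \int[nu]_x sq (M n) x - (2 ^- (2 * n))%:E < \int[nu]_x (gam n x * gam n x)%:E].
Proof.
have [g [bg g_bd g_mono g_le g_sup]] := lsc_approx hX lM M0.
have bg2 := bicomputable_sq hB bg.
have g20 j y : 0 <= (g (unpair j).1 (unpair j).2 y * g (unpair j).1 (unpair j).2 y)%:E.
  by rewrite lee_fin -expr2 sqr_ge0.
have IGl := ce_integral hnu bg2.1 g20.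
have h1 := lsc_cst R hP (c := fun n => qpow2 (2 * (unpair n).1)) ltac:(computable).
have h2 := right_ce_comp (h := fun n => (unpair n).1) ltac:(computable) iMr.
have lgap := lsc_add hP h1 (lsc_add hP h2 IGl).
pose P n j : Prop := \int[nu]_x sq (M n) x - (2 ^- (2 * n))%:E <
  \int[nu]_x (g n j x * g n j x)%:E.
have IGfin n j : \int[nu]_x (g n j x * g n j x)%:E \is a fin_num.
  rewrite ge0_fin_numE; last first.
    by apply: integral_ge0 => x _; rewrite lee_fin -expr2 sqr_ge0.
  apply: (@le_lt_trans _ _ (\int[nu]_x sq (M n) x)); last by rewrite ltey_eq iMfin.
  apply: ge0_le_integral => //.
  - by move=> x _; rewrite lee_fin -expr2 sqr_ge0.
  - by have := bicomputable_measurable (npair n j) bg2; rewrite npairK.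
  - exact: measurable_sq.
  - move=> x _; have /andP[g0 _] := g_bd n j x.
    by rewrite EFinM lee_pmul ?lee_fin.
have [|n|J hJ JP] := @sig_choice P.
- have := lsc_sig (k := fun=> qnat 0) (computable_const _) lgap.
  apply: sig_ext => n; rewrite /P qnum_nat qnum_pow2.
  rewrite -(fineK (IGfin _ _)) AE -EFinN -!EFinD !lte_fin; split; lra.
- have q1 : \int[nu]_x sq (M n) x - (2 ^- (2 * n))%:E < \int[nu]_x sq (M n) x.
    by rewrite AE -EFinB lte_fin; have := exp2V_gt0 R (2 * n); lra.
  have [|||||j /(_ j (leqnn j)) hj] := @fatou_sq_gt _ (Borel X) R nu (M n)
    (fun j y => (g n j y)%:E) _ _ _ _ _ _ q1; last by exists j.
  + exact: mM.
  + by [].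
  + by move=> j; have := bicomputable_measurable (npair n j) bg; rewrite npairK.
  + by move=> j x; rewrite lee_fin; case/andP: (g_bd n j x).
  + apply: aeW => x c /g_sup[j hj]; exists j => i ji.
    by rewrite lee_fin (le_trans (ltW hj))// g_mono.
exists (fun n => g n (J n)), J; split=> //.
- have := bicomputable_comp (h := fun n => npair n (J n)) ltac:(computable) bg.
  by apply: bicomputable_ext => n x; rewrite npairK.
Qed.

(** Norms of a martingale increase, so a single index whose squared norm is within [16^-k] of the
    squared supremum bounds all later growth. Such an index is recognized because the supremum is
    right-c.e. *)
Lemma martingale_indices :
  computable_real (ereal_sup (range (fun n => 'N[nu]_(2%:E)[M n]))) ->
  exists nk : nat -> nat, [/\ computable nk, forall k, (2 * k <= nk k)%N,
    forall k, (nk k < nk k.+1)%N &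
    forall k m, (nk k <= m)%N -> (A m - A (nk k) <= 2 ^- (4 * k))%R].
Proof.
move=> /ce_computable_reals[/(_ 0%N) Sfin _ Sr].
set S := ereal_sup _ in Sfin Sr; pose sg := fine S.
have SE : S = sg%:E by rewrite /sg fineK.
have N0 n : 0 <= 'N[nu]_(2%:E)[M n] by exact: Lnorm_ge0.
have NS n : 'N[nu]_(2%:E)[M n] <= S by apply: ereal_sup_ubound; exists n.
have NN n : 'N[nu]_(2%:E)[M n] * 'N[nu]_(2%:E)[M n] = (A n)%:E.
  by rewrite Lnorm2_sq.
have sg0 : (0 <= sg)%R by rewrite -lee_fin -SE (le_trans (N0 0%N)).
have A_sg n : (A n <= sg * sg)%R by rewrite -lee_fin -NN EFinM -SE lee_pmul.
have h1 := lsc_cst R hP (c := fun n => qpow2 (4 * (unpair n).1)) ltac:(computable).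
have h2 : lsc point_base (fun (_ : nat) (_ : unit) => (- (sg * sg))%:E).
  apply: (lsc_sqN hP (g := fun _ _ => sg)) => //.
  by apply: lsc_ext Sr => n _; rewrite SE.
have h2' := lsc_comp (h := fun=> 0%N) (computable_const 0) h2.
have h3 := lsc_comp (h := fun n => (unpair n).2) ltac:(computable) iMl.
have lgap := lsc_add hP h1 (lsc_add hP h2' h3).
pose P k n : Prop := (sg * sg - A n < 2 ^- (4 * k))%R.
have [|k|K0 hK KP] := @sig_choice P.
- have := lsc_sig (k := fun=> qnat 0) (computable_const _) lgap.
  apply: sig_ext => n; rewrite /P qnum_nat qnum_pow2 AE -!EFinD lte_fin; split; lra.
- have e0 := exp2V_gt0 R (4 * k); set e : R := 2 ^- (4 * k) in e0.
  (* With [t = e / (2 * sg + 1)], a norm within [t] of [sg] has its square within [2 * sg * t < e]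
     of that of [sg]. If [sg < t], the square of [sg] is already below [e]. *)
  have [sg1|sg1] := ltP sg (e / (2 * sg + 1))%R.
    exists 0%N; rewrite /P; have : (0 <= A 0)%R.
      by rewrite -lee_fin -NN mule_ge0.
    have d0 : (0 < 2 * sg + 1)%R by lra.
    by move: sg1; rewrite ltr_pdivlMr// -/e; have := mulr_ge0 sg0 sg0; nra.
  have : (sg - e / (2 * sg + 1))%:E < S.
    by rewrite SE lte_fin ltrBlDr ltrDl divr_gt0//; lra.
  move=> /ereal_sup_gt[_ [n _ <-]] hn; exists n; rewrite /P.
  have : ((sg - e / (2 * sg + 1)) * (sg - e / (2 * sg + 1)) <= A n)%R.
    by rewrite -lee_fin -NN EFinM lee_pmul ?lee_fin ?subr_ge0// ltW.
  have : (e / (2 * sg + 1) * (2 * sg + 1) = e)%R by rewrite divfK// gt_eqF//; lra.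
  have : (0 < e / (2 * sg + 1))%R by rewrite divr_gt0//; lra.
  by rewrite -/e; move: (e / (2 * sg + 1))%R => t; nra.
(* Partial sums dominate [K0]; the summand 2 makes them strictly increasing, with
   [nk k >= 2 * k]. *)
pose nk k := (\sum_(i < k.+1) (K0 i + 2))%N.
have K0_nk k : (K0 k <= nk k)%N.
  by rewrite /nk big_ord_recr /=; lia.
have nkS k : nk k.+1 = (nk k + (K0 k.+1 + 2))%N by rewrite /nk big_ord_recr.
exists nk; split.
- apply: (@computable_sum (fun _ i => K0 i + 2)%N (fun k => k.+1)); last by computable.
  by rewrite /computable2 /=; computable.
- by elim=> // k IH; rewrite nkS; lia.
- by move=> k; rewrite nkS; lia.
- move=> k m km; have := KP k; rewrite /P.
  have := martingale_norm_homo (K0_nk k); have := A_sg m; lra.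
Qed.

Lemma martingale_cvg x :
  computable_real (ereal_sup (range (fun n => 'N[nu]_(2%:E)[M n]))) ->
  SR s nu x -> exists l : R, M n x @[n --> \oo] --> l%:E.
Proof.
move=> hS Sx; have [gam [J [hJ bg g_bd g_le g_near]]] := martingale_minorants.
have [nk [hnk nk2 nk_lt nk_A]] := martingale_indices hS.
have bg2 := bicomputable_sq hB bg.
have g20 n y : 0 <= (gam n y * gam n y)%:E by rewrite lee_fin -expr2 sqr_ge0.
have mg2 n : measurable_fun setT (fun y : Borel X => (gam n y * gam n y)%:E).
  exact: (bicomputable_measurable n bg2).
have g2_le n y : (gam n y * gam n y)%:E <= sq (M n) y.
  by have /andP[g0 _] := g_bd n y; rewrite EFinM lee_pmul ?lee_fin.
have iGfin n : \int[nu]_y (gam n y * gam n y)%:E \is a fin_num.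
  rewrite ge0_fin_numE ?integral_ge0//.
  apply: (@le_lt_trans _ _ (\int[nu]_y sq (M n) y)); last by rewrite ltey_eq iMfin.
  by apply: ge0_le_integral => //; exact: measurable_sq.
pose G n : R := fine (\int[nu]_y (gam n y * gam n y)%:E).
have GE n : \int[nu]_y (gam n y * gam n y)%:E = (G n)%:E by rewrite /G fineK.
pose E n (y : Borel X) := sq (M n) y + (- (gam n y * gam n y))%:E.
have lE : lsc (ball_base s) (E : nat -> X -> \bar R) := lsc_add hB (lsc_sq hB M0 lM) bg2.2.
have E0 n y : 0 <= E n y by rewrite /E EFinN sube_ge0// g2_le.
have mE n : measurable_fun setT (E n) by exact: (lsc_measurable n lE).
have int_E n : \int[nu]_y E n y = (A n - G n)%:E.
  have : \int[nu]_y E n y + \int[nu]_y (gam n y * gam n y)%:E = (A n)%:E.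
    rewrite -ge0_integralD// -AE; apply: eq_integral => y _.
    by rewrite /E EFinN subeK.
  by rewrite GE => /(congr1 (fun t => t - (G n)%:E)); rewrite addeK.
have AG n : (A n - G n <= 2 ^- (2 * n))%R.
  by have := g_near n; rewrite AE GE -EFinB lte_fin; lra.
have AG0 n : (0 <= A n - G n)%R by rewrite -lee_fin -int_E integral_ge0.
have pos2 k : (0 < qnum (qnat (2 ^ k)))%R by rewrite qnum_nat ltr0n expn_gt0.
have pos4 k : (0 < qnum (qnat (4 ^ k)))%R by rewrite qnum_nat ltr0n expn_gt0.
have [B1 hB1] : exists B : R, forall n, (qnum (qnat (2 ^ n)))%:E * E n x <= B%:E.
  have int_t n : \int[nu]_y ((qnum (qnat (2 ^ n)))%:E * E n y) = (2 ^+ n * (A n - G n))%:E.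
    by rewrite ge0_integralZl// ?lee_fin ?ltW// int_E qnum_nat natrX.
  apply: (schnorr_sum hX hnu (t := fun n y => (qnum (qnat (2 ^ n)))%:E * E n y) (C := 1)) => //.
  - by apply: (lsc_scale hB (c := fun n => qnat (2 ^ n)) _ pos2 lE); computable.
  - by move=> n y; apply: mule_ge0; [rewrite lee_fin ltW|exact: E0].
  - have iGl := ce_integral hnu bg2.1 g20.
    have := lsc_scale hP (c := fun n => qnat (2 ^ n)) ltac:(computable) pos2
      (lsc_add hP iMr iGl).
    apply: lsc_ext => n _; rewrite int_t qnum_nat natrX AE GE -EFinN -EFinD -EFinM -EFinN.
    by congr (_%:E); ring.
  - move=> n; rewrite int_t lee_fin mul1r.
    have p0 : (0 < 2 ^+ n :> R)%R by rewrite exprn_gt0.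
    have -> : (2 ^- n = 2 ^+ n * 2 ^- (2 * n) :> R)%R.
      by rewrite mulnC exprM expr2 invfM mulrA divff ?mul1r// gt_eqF.
    by rewrite ler_pM2l.
(* The length of the [k]-th block, with both ends [nk k] and [nk k.+1] included. *)
pose L k := (nk k.+1 - nk k).+1.
pose inc k i y : R := ((gam (nk k + i)%N y + - gam (nk k) y) *
  (gam (nk k + i)%N y + - gam (nk k) y))%R.
pose W k (y : Borel X) : R := \big[Num.max/0%R]_(i < L k) inc k i y.
have bW : bicomputable (ball_base s) (W : nat -> X -> R).
  apply: (bicomputable_bigmax hB (f := inc)); first by rewrite /L; computable.
  apply: bicomputable_sq => //; apply: bicomputable_add => //.
    exact: (bicomputable_comp (h := fun n => (nk (unpair n).1 + (unpair n).2)%N)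
      ltac:(computable) bg).
  apply: bicomputable_opp.
  exact: (bicomputable_comp (h := fun n => nk (unpair n).1) ltac:(computable) bg).
have W0 k y : (0 <= W k y)%R by exact: bigmax_ge_id.
pose D k (y : Borel X) := runmax (fun i => dist (M (nk k + i)%N y) (M (nk k) y)) (L k).-1.
have lD k : l2 nu (D k) by apply: l2_runmax => i; exact: l2_dist.
(* [minorant_gap] for each increment; the defect at the variable index is bounded by the sum of the
   defects over the block, so that one bound serves for the maximum. *)
have W_le k y : (W k y)%:E <= (sq (D k) y + sq (D k) y) +
    ((E (nk k) y + E (nk k) y) + \sum_(i < L k) (E (nk k + i)%N y + E (nk k + i)%N y)).
  have D0 : 0 <= sq (D k) y by rewrite /sq mule_ge0//; case: (lD k).
  have S0 : 0 <= \sum_(i < L k) (E (nk k + i)%N y + E (nk k + i)%N y).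
    by apply: sume_ge0 => i _; rewrite adde_ge0 ?E0.
  rewrite /W; elim/big_ind: _ => [|a b ha hb|i _].
  - by do ![done|exact: E0|apply: adde_ge0].
  - by rewrite EFin_max ge_max ha.
  have /andP[a0 _] := g_bd (nk k + i)%N y; have /andP[b0 _] := g_bd (nk k) y.
  apply: (le_trans (minorant_gap a0 b0 (g_le _ _) (g_le _ _))).
  have dD : dist (M (nk k + i)%N y) (M (nk k) y) <= D k y.
    apply: (runmax_ub (fun i => dist (M (nk k + i)%N y) (M (nk k) y))).
    by rewrite -ltnS.
  rewrite leeD//; first by rewrite leeD// lee_pmul.
  by rewrite leeD2l// (bigD1 i)//= leeDl// sume_ge0// => j _; rewrite adde_ge0.
have mD k : measurable_fun setT (D k) by case: (lD k).
have int_D k : \int[nu]_y sq (D k) y <= (4 * 2 ^- (4 * k))%:E.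
  have := adapted_maximal hF hrho adM l2M martM (nk k) (L k).-1; rewrite -/(D k).
  have := nk_A k (nk k + (L k).-1)%N (leq_addr _ _); rewrite !AE.
  have := l2_fin (lD k); case: (\int[nu]_y sq (D k) y) => [I||]// _ h.
  rewrite -!EFinD !lee_fin; lra.
have geo n K : (\sum_(i < K) 2 ^- (2 * (n + i)) <= 2 * 2 ^- (2 * n) - 2 * 2 ^- (2 * (n + K)) :> R)%R.
  elim: K => [|K IH]; first by rewrite big_ord0 addn0 subrr.
  rewrite big_ord_recr /=; have h := exp2V_gt0 R (2 * (n + K)).
  have -> : (2 ^- (2 * (n + K.+1)) = 2 ^- (2 * (n + K)) / 4 :> R)%R.
    rewrite addnS mulnS addnC exprD invfM; congr (_ * _^-1)%R.
    by rewrite expr2 -natrM.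
  lra.
have mW k : measurable_fun setT (fun y : Borel X => (W k y)%:E).
  exact: (bicomputable_measurable k bW).
(* [14 = 2 * 4 + 2 + 4]: twice Doob's bound, twice the defect at [nk k], and twice the geometric sum
   of the defects of the block. The inequality [2 * k <= nk k] turns [4^-(nk k)] into [16^-k]. *)
have int_W k : \int[nu]_y (W k y)%:E <= (14 * 2 ^- (4 * k))%:E.
  have mED n : measurable_fun setT (fun y : Borel X => E n y + E n y).
    exact: emeasurable_funD.
  have mS : measurable_fun setT (fun y : Borel X => \sum_(i < L k) (E (nk k + i)%N y + E (nk k + i)%N y)).
    exact: emeasurable_sum.
  have ED0 n y : 0 <= E n y + E n y by rewrite adde_ge0 ?E0.
  have S0 y : 0 <= \sum_(i < L k) (E (nk k + i)%N y + E (nk k + i)%N y).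
    by apply: sume_ge0 => i _.
  have D0 y : 0 <= sq (D k) y by rewrite /sq mule_ge0//; case: (lD k).
  have mD2 : measurable_fun setT (sq (D k)) by exact: measurable_sq.
  have h1 : \int[nu]_y (W k y)%:E <= (\int[nu]_y sq (D k) y + \int[nu]_y sq (D k) y) +
    ((\int[nu]_y E (nk k) y + \int[nu]_y E (nk k) y) +
     \sum_(i < L k) (\int[nu]_y E (nk k + i)%N y + \int[nu]_y E (nk k + i)%N y)).
    have mR : measurable_fun setT (fun y : Borel X => (sq (D k) y + sq (D k) y) +
      ((E (nk k) y + E (nk k) y) + \sum_(i < L k) (E (nk k + i)%N y + E (nk k + i)%N y))).
      by apply: emeasurable_funD; exact: emeasurable_funD.
    have Wk0 y : 0 <= (W k y)%:E by rewrite lee_fin.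
    apply: (le_trans (@ge0_le_int _ (Borel X) R nu _ _ (mW k) mR Wk0 (W_le k))).
    rewrite ge0_integralD//; last first.
    - exact: emeasurable_funD.
    - by move=> y _; rewrite adde_ge0.
    - exact: emeasurable_funD.
    - by move=> y _; rewrite adde_ge0.
    rewrite ge0_integralD// ge0_integralD// ge0_integralD// ge0_integral_sum//.
    by under eq_bigr do rewrite ge0_integralD//.
  apply: (le_trans h1); rewrite int_E.
  under eq_bigr do rewrite int_E -EFinD.
  rewrite -EFinD sumEFin -EFinD.
  apply: (le_trans (leeD (leeD (int_D k) (int_D k)) (lexx _))); rewrite -!EFinD lee_fin.
  have h2 : (\sum_(i < L k) ((A (nk k + i) - G (nk k + i)) + (A (nk k + i) - G (nk k + i))) <=
     \sum_(i < L k) 2 ^- (2 * (nk k + i)) + \sum_(i < L k) 2 ^- (2 * (nk k + i)))%R.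
    by rewrite -big_split /=; apply: ler_sum => i _; rewrite lerD.
  have h3 := geo (nk k) (L k); have h4 := exp2V_gt0 R (2 * (nk k + L k)).
  have h5 : (2 ^- (2 * nk k) <= 2 ^- (4 * k) :> R)%R.
    rewrite lef_pV2 ?posrE ?exprn_gt0// ler_weXn2l// ?ler1n//.
    by have := nk2 k; lia.
  have h6 := AG (nk k); lra.
(* A computable integer bound of [4^k * W k], as [right_ce_integral] requires. *)
pose c k := (4 ^ k * (\sum_(i < L k) J (nk k + i) + J (nk k)) ^ 2)%N.
have hc : computable c.
  have h1 : computable (fun k => \sum_(i < L k) J (nk k + i))%N.
    apply: (@computable_sum (fun k i => J (nk k + i)%N) L); rewrite ?/computable2 /L /=; computable.
  by rewrite /c; computable.
have W_ub k y : (W k y <= ((\sum_(i < L k) J (nk k + i) + J (nk k)) ^ 2)%:R)%R.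
  apply: bigmax_le => // i _; rewrite /inc natrX expr2.
  have /andP[a0 aJ] := g_bd (nk k + i)%N y; have /andP[b0 bJ] := g_bd (nk k) y.
  have h : (J (nk k + i) <= \sum_(i < L k) J (nk k + i))%N.
    by rewrite (bigD1 i)//= leq_addr.
  have h1 : ((J (nk k + i))%:R <= (\sum_(i < L k) J (nk k + i))%:R :> R)%R by rewrite ler_nat.
  by rewrite natrD; nra.
have [B2 hB2] : exists B : R, forall k, (qnum (qnat (4 ^ k)))%:E * (W k x)%:E <= B%:E.
  have int_t k : \int[nu]_y ((qnum (qnat (4 ^ k)))%:E * (W k y)%:E) =
      (4 ^+ k)%:E * \int[nu]_y (W k y)%:E.
    rewrite ge0_integralZl// ?lee_fin ?ltW// ?qnum_nat ?natrX//.
    by move=> y _; rewrite lee_fin.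
  have bt := bicomputable_scale hB (c := fun k => qnat (4 ^ k)) ltac:(computable) pos4 bW.
  apply: (schnorr_sum hX hnu (t := fun k y => (qnum (qnat (4 ^ k)))%:E * (W k y)%:E) (C := 14)) => //.
  - exact: bt.1.
  - by move=> k y; rewrite mule_ge0// lee_fin// ltW.
  - apply: (right_ce_integral hX hnu hc bt.2) => k y; rewrite mulr_ge0 ?(ltW (pos4 k))//=.
    by rewrite qnum_nat /c [in leRHS]natrM ler_wpM2l.
  - move=> k; rewrite int_t; have p4 : (0 < 4 ^+ k :> R)%R by rewrite exprn_gt0.
    apply: (le_trans (lee_wpmul2l _ (int_W k))); first by rewrite lee_fin ltW.
    rewrite -EFinM lee_fin.
    have -> : (4 ^+ k * (14 * 2 ^- (4 * k)) = 14 * 2 ^- (2 * k) :> R)%R.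
      have -> : (4 * k = 2 * k + 2 * k)%N by lia.
      have -> : (4 = 2 ^+ 2 :> R)%R by rewrite expr2 -natrM.
      rewrite -exprM exprD invfM; field; by rewrite expf_neq0.
    rewrite ler_pM2l// lef_pV2 ?posrE ?exprn_gt0// ler_weXn2l// ?ler1n//.
    by rewrite leq_pmull.
(* An infinite [M n x] would make the defect [E n x] infinite, since [gam] is real-valued. *)
have Mfin n : M n x \is a fin_num.
  rewrite fin_numE -ltey gt_eqF ?(lt_le_trans _ (M0 n x))//=.
  rewrite ltNge leye_eq; apply/negP => /eqP Moo.
  by have := hB1 n; rewrite /E /sq Moo mulyy addye// gt0_muley ?lte_fin.
pose u n : R := fine (M n x).
have uE n : M n x = (u n)%:E by rewrite /u fineK.
have [| | | |l hl] := @cvg_of_blocks R u (gam ^~ x) nk B1 B2.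
- move=> k; rewrite nk_lt andbT; have := nk2 k; lia.
- move=> n; have /andP[-> _] := g_bd n x => /=.
  by rewrite -lee_fin -uE.
- move=> n; have := hB1 n.
  by rewrite /E /sq uE qnum_nat natrX -(EFinM (u n)) -EFinD -EFinM lee_fin.
- move=> k m /andP[km mk]; rewrite -lee_fin; apply: le_trans (hB2 k).
  rewrite -EFinM lee_fin qnum_nat natrX ler_wpM2l// ?exprn_ge0//.
  have ml : (m - nk k < L k)%N by rewrite ltnS leq_sub2r.
  have := le_bigmax (0:R)%R (fun i : 'I_(L k) => inc k i x) (Ordinal ml).
  by rewrite /inc /= subnKC.
exists l; apply: cvg_EFin; first exact: nearW.
exact: hl.
Qed.

End forward.

(** * Divergence at points where a test is infinite *)

(** The form in which Young's inequality gives upper bounds: [w n j] approximates [u n] from below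
    with an error governed by [d j]. First [p] is taken large to bring the factor of [w] near 1,
    then [j] to make the amplified error small. *)
Lemma right_ce_approx (R : realType) (u : nat -> \bar R) (w : nat -> nat -> \bar R)
    (d : nat -> R) :
  (forall n, u n \is a fin_num) -> (forall n j, (0 <= w n j <= u n)%E) ->
  (forall n j p, (u n <= (1 + p.+1%:R^-1)%:E * w n j + ((1 + p.+1%:R) * d j)%:E)%E) ->
  (forall e : R, 0 < e -> exists j, d j < e) ->
  right_ce (fun k => w (unpair k).1 (unpair k).2) -> right_ce (fun j => (d j)%:E) ->
  right_ce u.
Proof.
move=> ufin wu ub dlim hw hd; have hP := effective_point_base.
have wfin n j : w n j \is a fin_num.
  have /andP[w0 wu'] := wu n j.
  by rewrite ge0_fin_numE// (le_lt_trans wu')// ltey_eq ufin.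
apply: (@right_ce_inf _ u (fun n m => ((1 + (unpair m).2.+1%:R^-1)%:E * w n (unpair m).1 +
  ((1 + (unpair m).2.+1%:R) * d (unpair m).1)%:E)%E)) => //.
- by move=> n; move: (ufin n); case: (u n).
- move=> n r; rewrite -(fineK (ufin n)) lte_fin; set a := fine (u n) => ar.
  (* Half of the room [r - a] goes to the relative error [a / (k + 1)], half to the amplified
     [d j]. *)
  have [k hk] := qnum_gt (2 * a / (r - a)); have hk2 := lt_le_trans hk (qnum_le R k).
  have e0 : 0 < (r - a) / 2 / (1 + k.+1%:R).
    by rewrite !divr_gt0// ?subr_gt0// addr_gt0.
  have [j hj] := dlim _ e0; exists (npair j k); rewrite npairK /=.
  have /andP[w0 wa] := wu n j; move: w0 wa; rewrite -(fineK (wfin n j)) -(fineK (ufin n)).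
  rewrite !lee_fin -/a; move: (fine (w n j)) => b b0 ba.
  rewrite -EFinM -EFinD lte_fin.
  have h1 : (1 + k.+1%:R) * d j < (r - a) / 2.
    by rewrite mulrC -ltr_pdivlMr// addr_gt0.
  have h2 : k.+1%:R^-1 * b <= (r - a) / 2.
    rewrite mulrC ler_pdivrMr// (le_trans ba)//.
    move: hk2; rewrite ltr_pdivrMr ?subr_gt0// => hk2.
    have : k.+1%:R = k%:R + 1 :> R by rewrite -addn1 natrD.
    by nra.
  rewrite mulrDl mul1r; move: h1 h2 ba; set P := (_ * d j); set Q := (_ * b).
  lra.
- have h1 := lsc_scale hP (c := fun k => qadd (qnat 1) (qinv (unpair (unpair k).2).2))
    (f := fun k _ => (- w (unpair k).1 (unpair (unpair k).2).1)%E).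
  have h2 := lsc_scale hP (c := fun k => qnat (unpair (unpair k).2).2.+2)
    (f := fun k _ => (- (d (unpair (unpair k).2).1)%:E)%E).
  have h3 := lsc_add hP (h1 _ _ _) (h2 _ _ _).
  apply: lsc_ext (h3 _ _ _ _ _ _).
  + move=> k _; rewrite -(fineK (wfin _ _)) qnum_add !qnum_nat qnum_inv.
    by congr (_%:E); rewrite -(addn1 _.+1) natrD; ring.
  + by computable.
  + by move=> k; rewrite qnum_add qnum_nat qnum_inv addr_gt0// invr_gt0.
  + have := right_ce_comp (h := fun k => npair (unpair k).1 (unpair (unpair k).2).1) ltac:(computable) hw.
    by apply: lsc_ext => k _; rewrite npairK.
  + by computable.
  + by move=> k; rewrite qnum_nat.
  + exact: (right_ce_comp (h := fun k => (unpair (unpair k).2).1) ltac:(computable) hd).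
Qed.

(** A running maximum is bounded from above through a minimum of complements [c - e i], which is
    what lower semicomputability can reach. *)
Lemma bigmin_runmax (R : realType) (e : nat -> R) (c : R) q : exists r : R,
  runmax (fun i => (e i)%:E) q = r%:E /\
  \big[mine/+oo%E]_(i < q.+1) (c - e i)%:E = (c - r)%:E.
Proof.
elim: q => [|q [r [h1 h2]]].
  by exists (e 0%N); rewrite big_ord_recr big_ord0 /= minye.
exists (Num.max r (e q.+1)); rewrite big_ord_recr /= h2 [runmax _ _]h1 -EFin_max -EFin_min.
split=> //; congr (_%:E); rewrite /Num.max /Num.min.
by have [] := ltP r (e q.+1); have [] := ltP (c - r) (c - e q.+1); lra.
Qed.

Lemma fourfold_le (R : realType) (t : \bar R) (x y : R) :
  (t + (x%:E + x%:E + (x%:E + x%:E)) <= y%:E + y%:E + (y%:E + y%:E) ->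
  t <= (4 * (y - x))%:E)%E.
Proof. by case: t => [t||]; rewrite ?leNye// -!EFinD ?lee_fin//; lra. Qed.

Lemma measurable_sup d (T : measurableType d) (R : realType) (y : nat -> T -> \bar R) :
  (forall i, measurable_fun setT (y i)) ->
  measurable_fun setT (fun x => ereal_sup (range (y ^~ x))).
Proof.
move=> my; rewrite (_ : (fun x => _) = (fun x => esups (y ^~ x) 0%N)).
  exact: measurable_fun_esups.
apply/funext => x; rewrite /esups /sdrop; congr ereal_sup.
by apply/seteqP; split=> _ [i _ <-]; exists i.
Qed.

(** * Computability of conditional expectations and of their maxima *)

Section divergence.
Variables (R : realType) (X : completeMetricType R) (s : nat -> X).
Variable nu : probability (Borel X) R.
Variables (F : nat -> set (set X)) (rho : nat -> R.-ftker Borel X ~> Borel X).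
Hypothesis hX : computable_polish s.
Hypothesis hnu : computable_measure s nu.
Hypothesis hF : almost_full_filtration s nu F.
Hypothesis hrho : disintegrations s nu (KR s nu) F rho.
Local Notation qnum := (qnum R).
Local Open Scope ereal_scope.

Let hB := effective_ball_base hX.
Let hP := effective_point_base.

Lemma lsc_cond (f : nat -> X -> \bar R) (h : nat -> nat) : computable h ->
  lsc (ball_base s) f -> (forall n x, 0 <= f n x) ->
  lsc (ball_base s) (fun n => cond rho (h n) (f n)).
Proof.
move=> hh lf f0; apply: (lsc_integral hB (mu := fun n x => rho (h n) x)) => //.
have [_ _ /lsc_seqP lr] := hrho.
have := lsc_comp (h := fun j => npair (h (unpair j).1) (unpair j).2) ltac:(computable) lr.
by apply: lsc_ext => j x; rewrite npairK.
exact: lf.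
Qed.

(** At a Kurtz random point [rho n y] has mass 1, so the running maximum of conditional expectations
    of [G j] is [j] minus the minimum of those of [j - G j]. The index [k] codes the starting time,
    the index [j] of the minorant, and the number of later times. *)
Lemma right_ce_runmax_cond (G : nat -> X -> R) : bicomputable (ball_base s) G ->
  (forall j x, (0 <= G j x <= j%:R)%R) ->
  right_ce (fun k => \int[nu]_y sq (fun y : Borel X => runmax (fun i =>
    cond rho ((unpair k).1 + i) (fun z => (G (unpair (unpair k).2).1 z)%:E) y)
    (unpair (unpair k).2).2) y).
Proof.
move=> bG G_bd.
have mG j : measurable_fun setT (fun z : Borel X => (G j z)%:E).
  exact: (bicomputable_measurable j bG).
have G0 j z : 0 <= (G j z)%:E by rewrite lee_fin; case/andP: (G_bd j z).
pose H j z := (j%:R - G j z)%:E : \bar R.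
have H0 j z : 0 <= H j z by rewrite lee_fin subr_ge0; case/andP: (G_bd j z).
have lH : lsc (ball_base s) H.
  have := lsc_add hB (lsc_cst R hB (c := qnat) ltac:(computable)) bG.2.
  by apply: lsc_ext => j z; rewrite qnum_nat.
pose jj k := (unpair (unpair k).2).1; pose qq k := (unpair (unpair k).2).2.
(* The minimum with [j] keeps [Q] between 0 and [j] everywhere, also where the mass of [rho] is not
   1; at Kurtz random points it changes nothing. *)
pose P k y := mine (\big[mine/+oo]_(i < (qq k).+1) cond rho ((unpair k).1 + i) (H (jj k)) y) (jj k)%:R%:E.
have lP : lsc (ball_base s) (P : nat -> X -> \bar R).
  apply: (lsc_min hB).
    apply: (lsc_bigmin hB (f := fun k i y => cond rho ((unpair k).1 + i) (H (jj k)) y)).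
      by rewrite /qq; computable.
    apply: (@lsc_cond (fun k => H (jj (unpair k).1)) (fun k => (unpair (unpair k).1).1 + (unpair k).2)%N) => //.
      by computable.
    by apply: (lsc_comp (h := fun k => jj (unpair k).1)) => //; rewrite /jj; computable.
  have := lsc_cst R hB (c := fun k => qnat (jj k)).
  rewrite /jj => h; apply: lsc_ext (h _); last by computable.
  by move=> k y; rewrite qnum_nat.
have P0 k y : 0 <= P k y.
  rewrite /P le_min lee_fin ler0n andbT.
  elim/big_ind: _ => [|a b a0 b0|i _]; rewrite ?leey ?le_min ?a0//.
  exact: cond_ge0.
have Pj k y : P k y <= (jj k)%:R%:E by rewrite /P ge_min lexx orbT.
have Pfin k y : P k y \is a fin_num by rewrite ge0_fin_numE// (le_lt_trans (Pj k y)) ?ltry.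
pose Q k y := ((jj k)%:R - fine (P k y))%R.
have Q_bd k y : (0 <= Q k y <= (jj k)%:R)%R.
  by rewrite /Q subr_ge0 gerBl -!lee_fin !fineK// P0 Pj.
have lQ : lsc (ball_base s) (fun k y => (- Q k y)%:E).
  have := lsc_add hB lP (lsc_cst R hB (c := fun k => qopp (qnat (jj k))) ltac:(rewrite /jj; computable)).
  by apply: lsc_ext => k y; rewrite qnum_opp qnum_nat -(fineK (Pfin k y)) -EFinD opprB.
have Q0 k y : (0 <= Q k y)%R by case/andP: (Q_bd k y).
have := right_ce_integral hX hnu (c := fun k => (jj k ^ 2)%N) _ (lsc_sqN hB Q0 lQ) _.
have hc : computable (fun k => (jj k ^ 2)%N) by rewrite /jj; computable.
have mc n j : measurable_fun setT (cond rho n (fun z => (G j z)%:E)).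
  exact: (lsc_measurable j (lsc_cond (computable_const n) bG.1 G0)).
move=> /(_ hc) /(_ _)/lsc_ext; apply=> [k _|k y]; last first.
  have /andP[q0 qj] := Q_bd k y.
  by rewrite mulr_ge0//= natrX expr2 ler_pM.
congr (- _); apply: ae_eq_integral => //.
- have : measurable_fun setT (fun y : Borel X => (Q k y)%:E).
    rewrite (_ : (fun y => _) = (fun y : Borel X => - (- Q k y)%:E)).
      by apply: measurableT_comp => //; exact: (lsc_measurable k lQ).
    by apply/funext => y; rewrite -EFinN opprK.
  by move=> /measurable_sq.
- apply: measurable_sq; elim: (unpair (unpair k).2).2 => [|q IH] /=; first exact: mc.
  exact: measurable_maxe.
- apply: (ae_mono _ (KR_ae s nu)) => y Ky _.
  have condG n j : exists e : R, cond rho n (fun z => (G j z)%:E) y = e%:E /\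
      cond rho n (H j) y = (j%:R - e)%:E /\ (0 <= e <= j%:R)%R.
    have := @condD _ _ rho n (fun z => (G j z)%:E) (H j) y (mG j) (lsc_measurable j lH) (G0 j) (H0 j).
    rewrite (_ : (fun z => _) = (fun=> j%:R%:E)); last first.
      by apply/funext => z; rewrite -EFinD addrC subrK.
    rewrite (cond_cst hrho)//.
    have := @cond_ge0 _ _ rho n (fun z => (G j z)%:E) y (G0 j).
    have := @cond_ge0 _ _ rho n (H j) y (H0 j).
    case: (cond rho n (fun z => (G j z)%:E) y) (cond rho n (H j) y) => [e||]// [h||]//.
    rewrite !lee_fin => h0 e0 [jE]; exists e; split=> //; split; first by congr (_%:E); lra.
    by rewrite e0 jE lerDl.
  pose e i := fine (cond rho ((unpair k).1 + i) (fun z => (G (jj k) z)%:E) y).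
  have eE i : cond rho ((unpair k).1 + i) (fun z => (G (jj k) z)%:E) y = (e i)%:E.
    by rewrite /e; have [? [->]] := condG ((unpair k).1 + i)%N (jj k).
  have heE i : cond rho ((unpair k).1 + i) (H (jj k)) y = ((jj k)%:R - e i)%:E.
    by rewrite /e; have [? [-> []]] := condG ((unpair k).1 + i)%N (jj k).
  have e_bd i : (0 <= e i)%R.
    by rewrite /e; have [? [-> [_ /andP[]]]] := condG ((unpair k).1 + i)%N (jj k).
  have [r [h1 h2]] := bigmin_runmax e (jj k)%:R (qq k).
  have r0 : (0 <= r)%R by rewrite -lee_fin -h1; apply: runmax_ge0 => i; rewrite lee_fin.
  rewrite /sq (_ : runmax _ _ = r%:E); last first.
    by rewrite -h1; congr runmax; apply/funext => i; rewrite -eE.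
  rewrite -EFinM; congr (_%:E); suff -> : Q k y = r by [].
  rewrite /Q /P; under eq_bigr do rewrite heE.
  rewrite h2 (_ : mine _ _ = ((jj k)%:R - r)%:E); last by apply/min_idPl; rewrite lee_fin gerBl.
  by rewrite -[fine _]/((jj k)%:R - r)%R opprB addrC subrK.
Qed.

Lemma integral_sq_le (U V D : Borel X -> \bar R) (p : nat) :
  measurable_fun setT U -> measurable_fun setT V -> measurable_fun setT D ->
  (forall y, 0 <= U y) -> (forall y, 0 <= V y) -> (forall y, 0 <= D y) ->
  (forall y, U y <= V y + D y) ->
  \int[nu]_y sq U y <=
  (1 + p.+1%:R^-1)%:E * \int[nu]_y sq V y + (1 + p.+1%:R)%:E * \int[nu]_y sq D y.
Proof.
move=> mU mV mD U0 V0 D0 UVD.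
have p0 : (0 <= 1 + p.+1%:R^-1 :> R)%R by rewrite addr_ge0// invr_ge0.
have q0 : (0 <= 1 + p.+1%:R :> R)%R by rewrite addr_ge0.
have [mU2 mV2 mD2] : [/\ measurable_fun setT (sq U), measurable_fun setT (sq V) &
  measurable_fun setT (sq D)] by split; exact: measurable_sq.
have V20 y : 0 <= sq V y by exact: sq_ge0.
have D20 y : 0 <= sq D y by exact: sq_ge0.
rewrite -!ge0_integralZl// -ge0_integralD//; last 4 first.
- by move=> y _; rewrite mule_ge0.
- exact: measurable_funeM.
- by move=> y _; rewrite mule_ge0.
- exact: measurable_funeM.
apply: ge0_le_int => //.
- by apply: emeasurable_funD; exact: measurable_funeM.
- by move=> y; exact: sq_ge0.
- move=> y; apply: le_trans (sqeD_le p (V0 y) (D0 y)).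
  by rewrite /sq lee_pmul.
Qed.

(** * The martingale of conditional expectations of a test [g] in L2 *)

Section potential.
Variable g : Borel X -> \bar R.
Hypothesis lg : lsc (ball_base s) (fun _ : nat => g : X -> \bar R).
Hypothesis g0 : forall x, 0 <= g x.
Hypothesis gfin : \int[nu]_y sq g y \is a fin_num.
Hypothesis gr : right_ce (fun _ : nat => \int[nu]_y sq g y).

Let M n : Borel X -> \bar R := cond rho n g.
Let mg : measurable_fun setT g := lsc_measurable 0 lg.
Let l2g : l2 nu g.
Proof. by split=> //; rewrite ltey_eq gfin. Qed.
Let a : R := fine (\int[nu]_y sq g y).
Let aE : \int[nu]_y sq g y = a%:E.
Proof. by rewrite /a fineK. Qed.
Let M0 n x : 0 <= M n x.
Proof. exact: cond_ge0. Qed.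
Let lM : lsc (ball_base s) (M : nat -> X -> \bar R).
Proof. exact: (lsc_cond computable_id lg (fun _ => g0)). Qed.
Let adM n : measurable_wrt (F n) (M n).
Proof. exact: (cond_adapted hrho (l2_integrable l2g)). Qed.
Let l2M n : l2 nu (M n).
Proof. exact: (l2_cond hF hrho _ l2g). Qed.
Let martM n : {ae nu, forall x : Borel X, M n x = cond rho n (M n.+1) x}.
Proof. exact: (cond_tower hF hrho _ l2g). Qed.
Let mM n : measurable_fun setT (M n).
Proof. by have [] := l2M n. Qed.

Let c n : R := fine (\int[nu]_y sq (M n) y).
Let cE n : \int[nu]_y sq (M n) y = (c n)%:E.
Proof. by rewrite /c fineK// l2_fin. Qed.
Let ca n : (c n <= a)%R.
Proof. by rewrite -lee_fin -cE -aE; exact: (integral_sq_cond hF hrho). Qed.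

(* By almost-fullness, a Kurtz random point of {g > q} has all its late atoms
   inside {g > q}, up to a rho-null set. *)
Lemma potential_eventually_ge x (q : R) : KR s nu x -> q%:E < g x ->
  exists n0, forall n, (n0 <= n)%N -> q%:E <= M n x.
Proof.
move=> Kx qg; have [q0|q0] := ltP q 0%R.
  by exists 0%N => n _; apply: le_trans (M0 n x); rewrite lee_fin ltW.
have [k [qk kg]] := lte_qnum qg.
have [_ /eopen_index[h _ hE]] := lg.
have hk : [set y : X | (qnum k)%:E < g y] = ceopen s (h (npair 0 k)).
  by rewrite -hE; apply/seteqP; split=> y /=; rewrite npairK.
have [A [mA FA hA]] := filtration_gen hF.
have [|n0 [m [Ax Asub]]] := hA (h (npair 0 k)) x Kx; first by rewrite -hk.
exists n0 => n nn; rewrite -(cond_cst hrho n q%:E Kx).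
apply: ae_ge0_le_integral => //.
have : F n (A n0 m).
  by apply: (filtration_leq hF nn); rewrite FA; apply: sub_sigma_algebra; exists m.
move=> FnA; apply: (rho_atom hF hrho) => // y xy Ky _.
have := Asub y Ky ((xy _ FnA).2 Ax); rewrite -hk /= => /ltW; apply: le_trans.
exact: ltW.
Qed.

Lemma potential_norm_cvg (e : R) : (0 < e)%R ->
  exists n0, forall n, (n0 <= n)%N -> (a - e < c n)%R.
Proof.
move=> e0; have ae : (a - e)%:E < \int[nu]_y sq g y by rewrite aE lte_fin ltrBlDr ltrDl.
have [|||||n0 h] := @fatou_sq_gt _ (Borel X) R nu g M (a - e)%:E _ _ _ _ _ ae => //.
  apply: (ae_mono _ (KR_ae s nu)) => x Kx q; exact: potential_eventually_ge.
by exists n0 => n /h; rewrite cE lte_fin.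
Qed.

Lemma potential_minorants : exists G : nat -> X -> R,
  [/\ bicomputable (ball_base s) G, forall j x, (0 <= G j x <= j%:R)%R,
      forall j x, (G j x)%:E <= g x &
      forall e : R, (0 < e)%R -> exists j0, forall j, (j0 <= j)%N ->
        (a - e)%:E < \int[nu]_y (G j y * G j y)%:E].
Proof.
have [G [bG G_bd G_mono G_le G_sup]] := lsc_approx hX lg (fun _ => g0).
have bG0 : bicomputable (ball_base s) (G 0%N).
  have := bicomputable_comp (h := fun j => npair 0 j) ltac:(computable) bG.
  by apply: bicomputable_ext => j x; rewrite npairK.
exists (G 0%N); split=> // e e0.
have ae : (a - e)%:E < \int[nu]_y sq g y by rewrite aE lte_fin ltrBlDr ltrDl.
have [|||||n0 h] := @fatou_sq_gt _ (Borel X) R nu g (fun j y => (G 0%N j y)%:E) (a - e)%:E _ _ _ _ _ ae.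
- exact: mg.
- exact: g0.
- by move=> j; exact: (bicomputable_measurable j bG0).
- by move=> j x; rewrite lee_fin; case/andP: (G_bd 0%N j x).
- apply: aeW => x q /(G_sup 0%N)[j hj]; exists j => i ji.
  by rewrite lee_fin (le_trans (ltW hj))// G_mono.
by exists n0.
Qed.

Section minorants.
Variable G : nat -> X -> R.
Hypothesis bG : bicomputable (ball_base s) G.
Hypothesis G_bd : forall j x, (0 <= G j x <= j%:R)%R.
Hypothesis G_le : forall j x, (G j x)%:E <= g x.
Hypothesis G_cvg : forall e : R, (0 < e)%R -> exists j0, forall j, (j0 <= j)%N ->
  (a - e)%:E < \int[nu]_y (G j y * G j y)%:E.

Let Ge j (y : Borel X) : \bar R := (G j y)%:E.
Let G0 j y : 0 <= Ge j y.
Proof. by rewrite lee_fin; case/andP: (G_bd j y). Qed.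
Let mG j : measurable_fun setT (Ge j).
Proof. exact: (bicomputable_measurable j bG). Qed.
Let b j : R := fine (\int[nu]_y sq (Ge j) y).
Let sqG_le j y : sq (Ge j) y <= sq g y.
Proof. by apply: lee_pmul; first [exact: G0|exact: G_le]. Qed.
Let mG2 j : measurable_fun setT (sq (Ge j)).
Proof. exact: measurable_sq. Qed.
Let mg2 : measurable_fun setT (sq g).
Proof. exact: measurable_sq. Qed.
Let intG_le j : \int[nu]_y sq (Ge j) y <= a%:E.
Proof. by rewrite -aE; apply: ge0_le_int => // y; exact: sq_ge0. Qed.
Let l2G j : l2 nu (Ge j).
Proof. by split=> //; rewrite (le_lt_trans (intG_le j)) ?ltry. Qed.
Let bE j : \int[nu]_y sq (Ge j) y = (b j)%:E.
Proof. by rewrite /b fineK// l2_fin. Qed.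
Let b_le j : (b j <= a)%R.
Proof. by rewrite -lee_fin -bE. Qed.
Let b_cvg (e : R) : (0 < e)%R -> exists j0, forall j, (j0 <= j)%N -> (a - e < b j)%R.
Proof. by move=> /G_cvg[j0 h]; exists j0 => j /h; rewrite -lte_fin -bE. Qed.

(** The error of the minorant. Its squared norm is at most [a - b j], a right-c.e. quantity that
    becomes arbitrarily small and serves as [d] in [right_ce_approx]. *)
Let h j (y : Borel X) := g y + (- G j y)%:E.
Let h0 j y : 0 <= h j y.
Proof. by rewrite /h EFinN sube_ge0// G_le. Qed.
Let gE j y : g y = Ge j y + h j y.
Proof. by rewrite /h EFinN addeC subeK. Qed.
Let mh j : measurable_fun setT (h j).
Proof.
apply: emeasurable_funD => //; exact: (bicomputable_measurable j (bicomputable_opp bG)).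
Qed.
Let sqh_le j y : sq (h j) y + sq (Ge j) y <= sq g y.
Proof.
have := h0 j y; have := G0 j y; rewrite /sq (gE j) /Ge; case: (h j y) => [t||]//.
by rewrite -(EFinD (G j y)) -!EFinM -EFinD !lee_fin => G0' t0; nra.
Qed.
Let int_sqh j : \int[nu]_y sq (h j) y <= (a - b j)%:E.
Proof.
have mh2 : measurable_fun setT (sq (h j)) by exact: measurable_sq.
have h20 y : 0 <= sq (h j) y by exact: sq_ge0.
have G20 y : 0 <= sq (Ge j) y by exact: sq_ge0.
rewrite EFinB leeBrDr// -bE -ge0_integralD// -aE; apply: ge0_le_int => //.
- exact: emeasurable_funD.
- by move=> y; rewrite adde_ge0.
Qed.
Let l2h j : l2 nu (h j).
Proof. by split=> //; rewrite (le_lt_trans (int_sqh j)) ?ltry. Qed.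
Let ME n j y : M n y = cond rho n (Ge j) y + cond rho n (h j) y.
Proof.
rewrite -condD// /M; congr (cond rho n _ y).
by apply/funext => z; exact: gE.
Qed.
Let int_cond_h n j : \int[nu]_y sq (cond rho n (h j)) y <= (a - b j)%:E.
Proof. by apply: le_trans (int_sqh j); exact: (integral_sq_cond hF hrho). Qed.
Let mcG n j : measurable_fun setT (cond rho n (Ge j)).
Proof. by have [] := l2_cond hF hrho n (l2G j). Qed.
Let mch n j : measurable_fun setT (cond rho n (h j)).
Proof. by have [] := l2_cond hF hrho n (l2h j). Qed.
Let cG0 n j y : 0 <= cond rho n (Ge j) y.
Proof. exact: cond_ge0. Qed.
Let ch0 n j y : 0 <= cond rho n (h j) y.
Proof. exact: cond_ge0. Qed.
Let right_ce_defect : right_ce (fun j => (a - b j)%:E).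
Proof.
have l1 := ce_integral hnu (bicomputable_sq hB bG).1
  (fun j y => mule_ge0 (G0 j y) (G0 j y)).
have l2 := right_ce_comp (h := fun=> 0%N) (computable_const _) gr.
apply: lsc_ext (lsc_add hP l1 l2) => j _.
by rewrite [X in X + _](bE j) aE -EFinN -EFinD -EFinN opprB.
Qed.

(** [M n] splits into the conditional expectations of [Ge j] and [h j]; the former has computable
    upper bounds and the latter is small by Jensen's inequality. *)
Lemma potential_right_ce : right_ce (fun n => \int[nu]_y sq (M n) y).
Proof.
apply: (@right_ce_approx _ _ (fun n j => \int[nu]_y sq (cond rho n (Ge j)) y)
  (fun j => (a - b j)%R)).
- by move=> n; exact: l2_fin.
- move=> n j; apply/andP; split; first by apply: integral_ge0 => y _; exact: sq_ge0.
  apply: ge0_le_int; [exact: measurable_sq|exact: measurable_sq| |].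
    by move=> y; exact: sq_ge0.
  by move=> y; rewrite /sq lee_pmul// (ME n j) leeDl.
- move=> n j p; apply: (le_trans (integral_sq_le p (mM n) (mcG n j) (mch n j) _ _ _ _)) => //.
    by move=> y; rewrite (ME n j).
  by rewrite leeD2l// EFinM lee_wpmul2l// lee_fin addr_ge0.
- move=> e /b_cvg[j0 /(_ j0 (leqnn _)) hj]; exists j0; lra.
(* The running maximum of a single term. *)
- have := right_ce_comp (h := fun k => npair (unpair k).1 (npair (unpair k).2 0))
    ltac:(computable) (right_ce_runmax_cond bG G_bd).
  by apply: lsc_ext => k _; rewrite !npairK /= addn0.
- exact: right_ce_defect.
Qed.

Let S (y : Borel X) := ereal_sup (range (M ^~ y)).

(** Up to time [j] the error comes from replacing [g] by [Ge j]; after time [j] it is the increment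
    of the martingale over [M j]. *)
Let T j (y : Borel X) := runmax (fun i => cond rho i (h j) y) j +
  ereal_sup (range (fun i => dist (M (j + i)%N y) (M j y))).

Let sup_le j y : S y <= runmax (fun i => cond rho i (Ge j) y) j + T j y.
Proof.
have E0 : 0 <= ereal_sup (range (fun i => dist (M (j + i)%N y) (M j y))).
  by apply: (@le_trans _ _ (dist (M (j + 0)%N y) (M j y))) => //; apply: ereal_sup_ubound; exists 0%N.
have head n : (n <= j)%N -> M n y <= runmax (fun i => cond rho i (Ge j) y) j + runmax (fun i => cond rho i (h j) y) j.
  by move=> nj; rewrite (ME n j) leeD//; exact: (runmax_ub (fun i => cond rho i _ y)).
apply: ge_ereal_sup => _ [n _ <-]; rewrite /T addeA.
have [nj|jn] := leqP n j; first by rewrite (le_trans (head n nj))// leeDl.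
apply: (le_trans (lee_dist (M0 n y) (M0 j y))); rewrite addeC leeD ?head//.
by apply: ereal_sup_ubound; exists (n - j)%N => //; rewrite subnKC// ltnW.
Qed.

Let mS : measurable_fun setT S.
Proof.
have := lsc_sup (f := fun _ m => M m) (lsc_comp (h := fun n => (unpair n).2) ltac:(computable) lM).
exact: (lsc_measurable 0).
Qed.
Let S0 y : 0 <= S y.
Proof. by apply: (le_trans (M0 0 y)); apply: ereal_sup_ubound; exists 0%N. Qed.

(** [8 = 2 * 4]: Doob's constant for either part of [T j], doubled by [integral_sq_le] with
    [p = 0]. *)
Let dS j : R := (8 * (a - b j) + 8 * (a - c j))%R.

Let T0 j y : 0 <= T j y.
Proof.
rewrite /T adde_ge0//; first by apply: runmax_ge0 => i; exact: ch0.
by apply: (@le_trans _ _ (dist (M (j + 0)%N y) (M j y))) => //; apply: ereal_sup_ubound; exists 0%N.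
Qed.

Let mdist j i : measurable_fun setT (fun y => dist (M (j + i)%N y) (M j y)).
Proof. exact: measurable_dist. Qed.

Let mT2 j : measurable_fun setT (fun y => ereal_sup (range (fun i => dist (M (j + i)%N y) (M j y)))).
Proof. exact: measurable_sup. Qed.

Let mT1 j : measurable_fun setT (fun y => runmax (fun i => cond rho i (h j) y) j).
Proof. by have [] := l2_runmax j (fun i => l2_cond hF hrho i (l2h j)). Qed.

Let int_T j : \int[nu]_y sq (T j) y <= (dS j)%:E.
Proof.
pose T1 y := runmax (fun i => cond rho i (h j) y) j.
pose T2 (y : Borel X) := ereal_sup (range (fun i => dist (M (j + i)%N y) (M j y))).
have h1 : \int[nu]_y sq T1 y <= (4 * (a - b j))%:E.
  have := adapted_doob hF hrho (M := fun i => cond rho i (h j))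
    (fun n => cond_adapted hrho (l2_integrable (l2h j)))
    (fun n => l2_cond hF hrho n (l2h j)) (fun n => cond_tower hF hrho n (l2h j)) j.
  move=> /le_trans; apply; have hh := int_cond_h j j.
  apply: (le_trans (leeD (leeD hh hh) (leeD hh hh))); rewrite -!EFinD lee_fin; lra.
have h2 : \int[nu]_y sq T2 y <= (4 * (a - c j))%:E.
  apply: (@integral_sq_sup _ (Borel X) R nu (fun i y => dist (M (j + i)%N y) (M j y))).
  - exact: mdist.
  - by [].
  - move=> N; have := adapted_maximal hF hrho adM l2M martM j N.
    rewrite !cE => /fourfold_le /le_trans; apply.
    by rewrite lee_fin ler_pM2l// lerB.
have T10 y : 0 <= T1 y by apply: runmax_ge0 => i; exact: ch0.
have T20 y : 0 <= T2 y.
  by apply: (@le_trans _ _ (dist (M (j + 0)%N y) (M j y))) => //; apply: ereal_sup_ubound; exists 0%N.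
apply: (le_trans (integral_sq_le 0 _ (mT1 j) (mT2 j) _ T10 T20 (fun y => lexx _))).
- exact: emeasurable_funD.
- by move=> y; exact: T0.
- apply: (le_trans (leeD (lee_wpmul2l _ h1) (lee_wpmul2l _ h2))).
  + by rewrite lee_fin addr_ge0.
  + by rewrite lee_fin addr_ge0.
  + by rewrite -!EFinM -EFinD lee_fin /dS invr1; lra.
Qed.

Let right_ce_dS : right_ce (fun j => (dS j)%:E).
Proof.
have l1 := ce_integral hnu (lsc_sq hB M0 lM) (fun n y => mule_ge0 (M0 n y) (M0 n y)).
have l2 := right_ce_comp (h := fun=> 0%N) (computable_const _) gr.
have c8 : computable (fun=> qnat 8) by exact: computable_const.
have p8 (n : nat) : (0 < qnum (qnat 8))%R by rewrite qnum_nat.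
have := lsc_add hP (lsc_scale hP c8 p8 right_ce_defect) (lsc_scale hP c8 p8 (lsc_add hP l1 l2)).
apply: lsc_ext => j _; rewrite [X in _ * (X + _)](cE j) aE qnum_nat /dS.
by rewrite -!EFinN -(EFinD (c j)) -!EFinM -EFinD; congr (_%:E); ring.
Qed.

Let mW j : measurable_fun setT (fun y => runmax (fun i => cond rho i (Ge j) y) j).
Proof. by have [] := l2_runmax j (fun i => l2_cond hF hrho i (l2G j)). Qed.

(* The maximal function is approximated by the maximum of the first j
   conditional expectations of G j; Doob's inequality bounds the error T j. *)
Lemma potential_sup_right_ce : \int[nu]_y sq S y \is a fin_num /\
  right_ce (fun _ => \int[nu]_y sq S y).
Proof.
have Sfin : \int[nu]_y sq S y \is a fin_num.
  rewrite ge0_fin_numE; last by apply: integral_ge0 => y _; exact: sq_ge0.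
  apply: (@le_lt_trans _ _ (a%:E + a%:E + (a%:E + a%:E))); last by rewrite -!EFinD ltry.
  apply: (@integral_sq_sup _ (Borel X)) => // N.
  apply: (le_trans (adapted_doob hF hrho adM l2M martM N)).
  by rewrite cE !leeD// lee_fin.
split=> //; apply: (@right_ce_approx _ _ (fun _ j =>
  \int[nu]_y sq (fun y => runmax (fun i => cond rho i (Ge j) y) j) y) dS) => //.
- move=> n j; apply/andP; split.
    by apply: integral_ge0 => y _; apply: sq_ge0 => z; exact: runmax_ge0.
  have W0 y : 0 <= runmax (fun i => cond rho i (Ge j) y) j by exact: runmax_ge0.
  apply: ge0_le_int; [exact: measurable_sq|exact: measurable_sq| |].
    by move=> y; exact: sq_ge0.
  move=> y; rewrite /sq lee_pmul//; apply: runmax_lub => i _.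
    apply: (@le_trans _ _ (M i y)); first by rewrite (ME i j) leeDl.
    by apply: ereal_sup_ubound; exists i.
  apply: (@le_trans _ _ (M i y)); first by rewrite (ME i j) leeDl.
  by apply: ereal_sup_ubound; exists i.
- move=> n j p.
  have mT : measurable_fun setT (T j) by exact: emeasurable_funD.
  apply: (le_trans (integral_sq_le p mS (mW j) mT S0 _ (T0 j) (sup_le j))).
    by move=> y; exact: runmax_ge0.
  by rewrite leeD2l// EFinM lee_wpmul2l// lee_fin addr_ge0.
(* Each of the two defects enters [dS] with the factor 8. *)
- move=> e e0; have e1 : (0 < e / 16)%R by rewrite divr_gt0.
  have [j0 h1] := b_cvg e1; have [j1 h2] := potential_norm_cvg e1.
  exists (maxn j0 j1); have := h1 _ (leq_maxl j0 j1); have := h2 _ (leq_maxr j0 j1).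
  by rewrite /dS; lra.
- have := right_ce_comp (h := fun k => npair 0 (npair (unpair k).2 (unpair k).2))
    ltac:(computable) (right_ce_runmax_cond bG G_bd).
  by apply: lsc_ext => k _; rewrite !npairK.
Qed.

(** [schnorr_ae_le] needs the L1 norm of [M n], which is that of [g]. Integrating
    [h <= 1/(p+1) + (p+1) h^2] leaves an additive error; the constant 1 added to the integral turns
    it into the relative error that [right_ce_approx] allows. *)
Lemma potential_integral_right_ce : right_ce (fun _ => \int[nu]_y g y).
Proof.
have ig := l2_integrable l2g.
have ifin : \int[nu]_y g y \is a fin_num by exact: integrable_fin_num.
have iGE j : \int[nu]_y g y = \int[nu]_y Ge j y + \int[nu]_y h j y.
  by rewrite -ge0_integralD//; apply: eq_integral => y _; exact: gE.
have h1 : right_ce (fun _ => 1 + \int[nu]_y g y).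
  apply: (@right_ce_approx _ _ (fun _ j => 1 + \int[nu]_y Ge j y) (fun j => (a - b j)%R)).
  - by move=> n; rewrite fin_numD ifin.
  - move=> n j; rewrite adde_ge0 ?integral_ge0//= leeD2l// (iGE j) leeDl//.
    exact: integral_ge0.
  - move=> n j p.
    have p0 : (0 <= p.+1%:R^-1 :> R)%R by rewrite invr_ge0.
    have p1 : (0 <= p.+1%:R :> R)%R by [].
    have hh : \int[nu]_y h j y <= p.+1%:R^-1%:E + p.+1%:R%:E * (a - b j)%:E.
      apply: le_trans (_ : \int[nu]_y (p.+1%:R^-1%:E + p.+1%:R%:E * sq (h j) y) <= _).
        have mh2 : measurable_fun setT (sq (h j)) by exact: measurable_sq.
        apply: ge0_le_int => //.
          by apply: emeasurable_funD => //; exact: measurable_funeM.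
        move=> y; rewrite /sq; have := h0 j y; case: (h j y) => [t||]//.
          rewrite -!EFinM -EFinD !lee_fin => t0.
          rewrite -(@ler_pM2l _ p.+1%:R)// mulrDr divff// mulrA -expr2.
          by have := sqr_ge0 (p.+1%:R * t - 1)%R; nra.
        by rewrite mulyy gt0_muley ?addey// lte_fin.
      have mh2 : measurable_fun setT (sq (h j)) by exact: measurable_sq.
      rewrite ge0_integralD//; last 2 first.
      + by move=> y _; rewrite mule_ge0// sq_ge0.
      + exact: measurable_funeM.
      rewrite integral_cst//= (probability_setT nu) mule1 ge0_integralZl//; last first.
        by move=> y _; exact: sq_ge0.
      by rewrite leeD2l// lee_wpmul2l.
    have I0 : 0 <= \int[nu]_y Ge j y by exact: integral_ge0.
    rewrite (iGE j); apply: (le_trans (leeD2l _ (leeD2l _ hh))).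
    have : \int[nu]_y Ge j y \is a fin_num.
      by apply: integrable_fin_num => //; exact: l2_integrable.
    move: I0; case: (\int[nu]_y Ge j y) => [I||]// I0 _.
    suff : (1 + (I + (p.+1%:R^-1 + p.+1%:R * (a - b j))) <=
        (1 + p.+1%:R^-1) * (1 + I) + (1 + p.+1%:R) * (a - b j))%R by rewrite -lee_fin.
    rewrite lee_fin in I0; have := b_le j; have := mulr_ge0 p0 I0.
    by move: (p.+1%:R^-1 : R)%R (p.+1%:R : R)%R (b j) => q r t; nra.
  - move=> e /b_cvg[j0 /(_ j0 (leqnn _)) hj]; exists j0; lra.
  - have := right_ce_integral hX hnu (c := id) computable_id bG.2 G_bd.
    move=> /(right_ce_comp (h := fun k => (unpair k).2) ltac:(computable)).
    move=> /(lsc_add hP (lsc_cst R hP (c := fun=> qopp (qnat 1)) (computable_const _))).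
    by apply: lsc_ext => k _; rewrite qnum_opp qnum_nat EFinN -oppeD.
  - exact: right_ce_defect.
have := lsc_add hP (lsc_cst R hP (c := fun=> qnat 1) (computable_const _)) h1.
apply: lsc_ext => _ _; rewrite -(fineK ifin) qnum_nat.
by congr (_%:E); ring.
Qed.

End minorants.

(** For the martingale identity at every Schnorr random point, both sides are lower semicomputable,
    agree almost everywhere by [cond_tower], and share the computable integral of [g], so
    [schnorr_ae_le] applies in both directions. *)
Lemma potential_martingale : schnorr_martingale s nu 2 F rho (M : nat -> X -> \bar R).
Proof.
have [G [bG G_bd G_le G_cvg]] := potential_minorants.
split=> //.
- apply/(schnorr_tests2P hX hnu); split=> //; first by move=> n; exact: l2_fin.
  exact: (potential_right_ce bG G_bd G_le G_cvg).
- move=> n x Sx.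
  have l1 := lsc_comp (h := fun=> n) (computable_const _) lM.
  have l2 : lsc (ball_base s) (fun _ : nat => cond rho n (M n.+1) : X -> \bar R).
    apply: (lsc_cond (h := fun=> n) (computable_const _) _ (fun _ => M0 n.+1)).
    exact: (lsc_comp (h := fun=> n.+1) (computable_const _) lM).
  have ig := l2_integrable l2g.
  have int1 : \int[nu]_y M n y = \int[nu]_y g y by exact: (integral_cond hF hrho).
  have int2 : \int[nu]_y cond rho n (M n.+1) y = \int[nu]_y g y.
    by rewrite (integral_cond hF hrho) ?(integral_cond hF hrho)//; exact: (cond_integrable hrho).
  have gfin' : \int[nu]_y g y \is a fin_num by exact: integrable_fin_num.
  have gr' := potential_integral_right_ce bG G_bd G_le G_cvg.
  have cM0 y : 0 <= cond rho n (M n.+1) y by exact: cond_ge0.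
  apply/eqP; rewrite eq_le; apply/andP; split.
    apply: (schnorr_ae_le hX hnu l2 l1 cM0 (M0 n) _ _ _ Sx); rewrite ?int2//.
    by apply: (ae_mono _ (martM n)) => y ->.
  by apply: (schnorr_ae_le hX hnu l1 l2 (M0 n) cM0 _ _ _ Sx); rewrite ?int1//; exact: martM.
Qed.

(** The supremum is the norm of [g]: Jensen's inequality bounds it from above, [potential_norm_cvg]
    from below. *)
Lemma potential_sup_norm :
  computable_real (ereal_sup (range (fun n => 'N[nu]_(2%:E)[M n]))).
Proof.
have [_ _] : schnorr_tests s nu 2 (fun _ => g : X -> \bar R).
  by apply/(schnorr_tests2P hX hnu).
suff -> : ereal_sup (range (fun n => 'N[nu]_(2%:E)[M n])) = 'N[nu]_(2%:E)[g] by [].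
have N0 (f : Borel X -> \bar R) : 0 <= 'N[nu]_(2%:E)[f] by exact: Lnorm_ge0.
have Ng2 := Lnorm2_sq nu g0; rewrite aE in Ng2.
have NM2 n := Lnorm2_sq nu (M0 n).
apply/eqP; rewrite eq_le; apply/andP; split.
- apply: ge_ereal_sup => _ [n _ <-]; rewrite leNgt; apply/negP => lt_gM.
  have := NM2 n; rewrite cE; have := ca n; have := N0 g; move: lt_gM Ng2.
  case: 'N[nu]_(2%:E)[g] => [p||]//; case: 'N[nu]_(2%:E)[M n] => [q||]//.
  rewrite lte_fin lee_fin => pq [p2] p0 cna [q2]; nra.
- rewrite leNgt; apply/negP => lt_Sg.
  have S0 : 0 <= ereal_sup (range (fun n => 'N[nu]_(2%:E)[M n])).
    by apply: (le_trans (N0 (M 0%N))); apply: ereal_sup_ubound; exists 0%N.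
  move: lt_Sg Ng2 S0.
  case SE : (ereal_sup _) => [t||]//; case: 'N[nu]_(2%:E)[g] => [p||]//.
  rewrite lte_fin lee_fin => tp [p2] t0.
  have [|n0 /(_ n0 (leqnn _)) h] := @potential_norm_cvg (a - t * t); first by nra.
  have : 'N[nu]_(2%:E)[M n0] <= t%:E by rewrite -SE; apply: ereal_sup_ubound; exists n0.
  move: (N0 (M n0)) (NM2 n0); rewrite cE; case: 'N[nu]_(2%:E)[M n0] => [q||]//.
  by rewrite !lee_fin => q0 [q2] qt; clear SE; nra.
Qed.

Lemma potential_sup_test :
  schnorr_test s nu 2 (fun y => ereal_sup (range (fun n => M n y))).
Proof.
have [G [bG G_bd G_le G_cvg]] := potential_minorants.
have [Sfin Sr] := potential_sup_right_ce bG G_bd G_le G_cvg.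
apply/(schnorr_tests2P hX hnu); split=> //.
- exact: (lsc_sup (f := fun _ m => M m) (lsc_comp (h := fun n => (unpair n).2) ltac:(computable) lM)).
- by move=> _ y; apply: (le_trans (M0 0 y)); apply: ereal_sup_ubound; exists 0%N.
Qed.

End potential.

End divergence.

Lemma KR_martingale_cvg_SR (R : realType) (X : completeMetricType R) (s : nat -> X)
    (nu : probability (Borel X) R) (F : nat -> set (set X))
    (rho : nat -> R.-ftker Borel X ~> Borel X) (x : X) :
  computable_polish s -> computable_measure s nu -> almost_full_filtration s nu F ->
  disintegrations s nu (KR s nu) F rho -> KR s nu x ->
  (forall M : nat -> X -> \bar R, schnorr_martingale s nu 2 F rho M ->
    computable_real (ereal_sup (range (fun n => ('N[nu]_(2%:E)[M n])%E))) ->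
    schnorr_test s nu 2 (fun y => ereal_sup (range (fun n => M n y))) ->
    exists l : R, M n x @[n --> \oo] --> l%:E) ->
  SR s nu x.
Proof.
move=> hX hnu hF hrho Kx hM f [/lsc_seqP lf f0 /ce_computable_reals[Nfin _ Nr]].
rewrite ltey; apply/eqP => fx.
(* The default [+oo] would also apply to [-oo], which nonnegativity of [f] excludes. *)
pose g (y : Borel X) : \bar R := if f y is r%:E then (Num.sqrt r)%:E else +oo%E.
have g0 y : (0 <= g y)%E.
  by rewrite /g; case: (f y) => [r||]; rewrite ?leey// lee_fin sqrtr_ge0.
have gg y : (g y * g y)%E = f y.
  rewrite /g; have := f0 0%N y; case: (f y) => [r||]//.
  by rewrite lee_fin -EFinM => r0; rewrite -expr2 sqr_sqrtr.
have hB := effective_ball_base hX.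
have lg : lsc (ball_base s) (fun _ : nat => g : X -> \bar R).
  by apply: (lsc_sqrt hB (f := fun _ => f)) => // n y; rewrite gg.
have intg : (\int[nu]_y sq g y = 'N[nu]_(1%:E)[f])%E.
  rewrite (Lnorm1_ge0 nu (f := f : Borel X -> \bar R) (f0 0%N)).
  by apply: eq_integral => y _; exact: gg.
have gfin : (\int[nu]_y sq g y)%E \is a fin_num by rewrite intg; exact: Nfin 0%N.
have gr : right_ce (fun _ : nat => \int[nu]_y sq g y)%E.
  by apply: lsc_ext Nr => n _; rewrite intg.
have [l] := hM _ (potential_martingale hX hnu hF hrho lg g0 gfin gr)
  (potential_sup_norm hX hnu hF hrho lg g0 gfin gr)
  (potential_sup_test hX hnu hF hrho lg g0 gfin gr).
(* As [g x] is infinite, [M n x] is eventually at least [l + 1], against the limit [l]. *)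
have gx : ((l + 1)%:E < g x)%E by rewrite /g fx ltry.
have [n0 h] := potential_eventually_ge hF hrho lg g0 Kx gx.
move=> hl; have : ((l + 1)%:E <= l%:E)%E.
  rewrite -(cvg_lim (@ereal_hausdorff R) hl); apply: lime_ge.
    by apply/cvg_ex; exists l%:E.
  by exists n0.
by rewrite lee_fin gerDl ler10.
Qed.

Theorem theorem12p2 (R : realType) (X : completeMetricType R) (s : nat -> X)
  (nu : probability (Borel X) R)
  (F : nat -> set (set X)) (rho : nat -> R.-ftker Borel X ~> Borel X)
  (hX : computable_polish s)
  (hnu : computable_measure s nu)
  (hF : almost_full_filtration s nu F)
  (hrho : schnorr_disintegrations s nu F rho)
  (x : X) :
  SR s nu x <->
  KR s nu x /\
  forall M : nat -> X -> \bar R,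
    schnorr_martingale s nu 2 F rho M ->
    computable_real (ereal_sup (range (fun n => ('N[nu]_(2%:E)[M n])%E))) ->
    schnorr_test s nu 2 (fun y => ereal_sup (range (fun n => M n y))) ->
    exists l : R, M n x @[n --> \oo] --> l%:E.
Proof.
have [hK _] := hrho; split=> [Sx|[Kx hM]]; last exact: KR_martingale_cvg_SR hK Kx hM.
split=> [|M hM hS _]; first exact: (SR_KR hX hnu Sx).
exact: (martingale_cvg hX hnu hF hK hM hS Sx).
Qed.
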